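(* The Palm probability distribution of $H_I$ with respect to $\mathcal V_I$ is a Nakagami distribution with parameters $\left(\frac32,\frac{3}{2\lambda\pi}\right)$.
   Context: Model. Let $\lambda,v>0$. $\Phi=\sum_i\delta_{X_i}$ is a homogeneous Poisson point process of intensity $\lambda$ on $\mathbb R^2$ and $(\Theta_i)$ are i.i.d. uniform angles on $[-\pi,\pi)$, independent of $\Phi$. Base station (BS) $i$ is at $X_i^t=X_i+vt(\cos\Theta_i,\sin\Theta_i)$ at time $t\in\mathbb R$; $d_i(t)=\|X_i^t\|$ is its distance to the user at the origin. $T_i$ is the time at which $d_i$ is minimal and $H_i=d_i(T_i)$. The max interference point process $\mathcal V_I$ on $\mathbb R$ consists of the times $s=T_i$ such that exactly one BS $j$ satisfies $d_j(s)<H_i$. At such a time, $H_I=H_i$ (the distance of the nearest interferer). Palm expectation: for a stationary point process $N$ on $\mathbb R$ with intensity $\lambda_N\in(0,\infty)$, built time-shift-compatibly from the moving configuration, $\mathbb E^0_N[f]=\lambda_N^{-1}\,\mathbb E\big[\sum_{t\in N\cap[0,1]}f_t\big]$, where $f_t$ is the quantity $f$ observed at time $t$. The Nakagami distribution with parameters $(m,\omega)$ has density $\frac{2m^m}{\Gamma(m)\omega^m}x^{2m-1}e^{-mx^2/\omega}$, $x\ge0$. *)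

(* Defs.v *)
From HB Require Import structures.
From mathcomp Require Export all_boot all_order all_algebra.
From mathcomp Require Export all_classical all_reals all_analysis.
From mathcomp Require Export measurable_realfun.
Export Order.TTheory GRing.Theory Num.Theory.
Export numFieldNormedType.Exports.

Set Implicit Arguments.
Unset Strict Implicit.
Unset Printing Implicit Defensive.

Global Open Scope classical_set_scope.
Global Open Scope ring_scope.

(* For [uniform_prob (ltNpi R)]: the library's uniform law on [-pi, pi], which
   as a law is the uniform law on [-pi, pi[. *)
Lemma ltNpi (R : realType) : - (pi : R) < pi.
Proof. by rewrite -subr_gt0 opprK addr_gt0 ?pi_gt0. Qed.

Section independence.
Context d d' (Omega : measurableType d) (T : measurableType d') (R : realType).
Local Open Scope ereal_scope.

Definition mutually_independent (P : probability Omega R) (I : eqType)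
    (Y : I -> Omega -> T) : Prop :=
  forall (s : seq I) (A : I -> set T), uniq s ->
    (forall i, measurable (A i)) ->
    P (\bigcap_(i in [set` s]) (Y i @^-1` A i)) =
    \prod_(i <- s) P (Y i @^-1` A i).

Definition sigma_family (I : Type) (Y : I -> Omega -> T) : set (set Omega) :=
  <<s \bigcup_i g_sigma_algebra_preimage (Y i) >>.

End independence.

Definition independent_sigma d (Omega : measurableType d) (R : realType)
    (P : probability Omega R) (F G : set (set Omega)) : Prop :=
  forall A B, F A -> G B -> P (A `&` B) = (P A * P B)%E.

Section point_process.
Context d d' (Omega : measurableType d) (T : measurableType d') (R : realType).
Local Open Scope ereal_scope.

(* The random counting measure Phi = sum_i delta_{X_i}. *)
Definition point_measure (X : nat -> Omega -> T) (w : Omega) (B : set T) : \bar R :=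
  \sum_(i <oo) \d_(X i w) B.

(* The Poisson mass function is spelled out because the value of
   [poisson_pmf r k] at r = 0 is 1 for every k, whereas here a Lambda-null set
   must contain no point almost surely (0 ^+ 0 = 1). *)
Definition poisson_point_process (P : probability Omega R)
    (Lambda : set T -> \bar R) (X : nat -> Omega -> T) : Prop :=
  (forall (B : set T) (k : nat), measurable B -> Lambda B < +oo ->
     let r := fine (Lambda B) in
     P [set w | point_measure X w B = k%:R%:E] =
     (expR (- r) * r ^+ k / k`!%:R)%:E) /\
  (forall (n : nat) (B : 'I_n -> set T), (forall i, measurable (B i)) ->
     trivIset setT B ->
     mutually_independent P
       (fun i w => point_measure X w (B i))).

End point_process.

Section palm.
Context d (Omega : measurableType d) (R : realType) (P : probability Omega R).
Local Open Scope ereal_scope.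

(* A simple point process N on the line is the random set of its points;
   [f w t] is the quantity observed at time t in the configuration w. *)
Definition unit_window_sum (N : Omega -> set R) (f : Omega -> R -> \bar R) : \bar R :=
  \int[P]_w \esum_(t in N w `&` `[0%R, 1%R]) f w t.

Definition intensity (N : Omega -> set R) : \bar R :=
  unit_window_sum N (fun _ _ => 1).

(* The window formula for the Palm expectation; it has its usual meaning when
   0 < intensity N < +oo. *)
Definition palm_expectation (N : Omega -> set R) (f : Omega -> R -> \bar R) : \bar R :=
  (intensity N)^-1 * unit_window_sum N f.

Definition palm_distribution (N : Omega -> set R) (h : Omega -> R -> R) (B : set R) :
    \bar R :=
  palm_expectation N (fun w t => (\1_B (h w t))%:E).

End palm.

Section nakagami.
Context (R : realType).

Definition Gamma_fun (z : R) : R :=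
  (\int[lebesgue_measure]_(x in `]0, +oo[) (x `^ (z - 1) * expR (- x)))%R.

Definition nakagami_pdf (m w x : R) : R :=
  if 0 <= x then
    2 * m `^ m / (Gamma_fun m * w `^ m) * x `^ (2 * m - 1)
    * expR (- (m * x ^+ 2 / w))
  else 0.

Definition nakagami_prob (m w : R) (B : set R) : \bar R :=
  (\int[lebesgue_measure]_(x in B) (nakagami_pdf m w x)%:E)%E.

End nakagami.

Section moving_stations.
Context (R : realType).

(* Euclidean norm; the library norm on R * R is the sup norm. *)
Definition norm2 (x : R * R) : R := Num.sqrt (x.1 ^+ 2 + x.2 ^+ 2).

(* A configuration is the sequence of initial positions x and angles a. *)
Variables (v : R) (x : nat -> R * R) (a : nat -> R).

Definition position (i : nat) (t : R) : R * R :=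
  ((x i).1 + v * t * cos (a i), (x i).2 + v * t * sin (a i)).

Definition dist (i : nat) (t : R) : R := norm2 (position i t).

(* The minimizer exists and is unique as soon as v != 0. *)
Definition closest_time (i : nat) : R :=
  xget 0 [set t | forall s, dist i t <= dist i s].

Definition closest_dist (i : nat) : R := dist i (closest_time i).

Definition max_interference_at (i : nat) (s : R) : Prop :=
  s = closest_time i /\ exists! j : nat, dist j s < closest_dist i.

Definition max_interference : set R :=
  [set s | exists i, max_interference_at i s].

(* H_I at time s: the value of H_i for an i witnessing that s is a point of
   the process; two witnesses at the same s have equal H_i, otherwise the one
   with the larger H_i would see two strictly closer stations. *)
Definition interferer_dist (s : R) : R :=
  xget 0 [set h | exists2 i, max_interference_at i s & h = closest_dist i].

End moving_stations.

(* Main.v *)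
From HB Require Import structures.
Require Import Defs.
From mathcomp Require Import ring lra.

(** Mark every station by its heading, Z_k = (X_k, Theta_k). The marked stations
form a Poisson process whose intensity M is lambda times the area measure,
times the uniform law of the angle. A marked point z has a time [foot z] of
closest approach to the origin and a distance [miss z] at that time, and its
squared distance at time t is miss^2 + v^2 (t - foot)^2 ([sqdistE]).

Two computations of M decide the law. Rotating the plane by the heading turns
(- v foot, +- miss) into Cartesian coordinates, so under M the pair
(foot, miss) has density 2 lambda v on R x [0, oo)
([marked_intensity_foot_miss]). For fixed t and h, the stations within
distance h at time t form a disc of radius h whatever the heading, so their
number is Poisson of mean lambda pi h^2 ([marked_intensity_ball]). The Mecke
formula combines both: the mean number of stations i with closest approach in
the unit time window, miss distance in B, and exactly one station closer at
that time, is
  2 lambda v  int_B  lambda pi h^2 exp (- lambda pi h^2) dh.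
After normalization this is a density proportional to h^2 exp (- lambda pi h^2),
which is the Nakagami density with parameters 3/2 and 3 / (2 lambda pi); the
normalizing constant comes from substituting x = lambda pi h^2 in the integral
of Gamma (3/2) ([integral_one_closer_prob_Gamma]).

The case of the Mecke formula used here is proved by discretization. Round the
times and the distances down to multiples of 1/(n+1). Stations whose pair
(foot, miss) rounds to (t, h) form a set C, stations closer than h at time t
form a set D, and C and D are disjoint because a station of C never comes
closer than its miss distance, which is at least h. The counts in C and D are
therefore independent Poisson variables, and
  E [N(C) 1(N(D) = 1)] = M(C) M(D) exp (- M(D))
([integral_marked_count_single]). Summing over the cells and letting n tend to
infinity gives the formula ([integral_interferer_sum]), by dominated
convergence, since almost surely no two distances to be compared are equal.

The identity for the pair of counts is read off the generating function
E [a^N(C) b^N(D)], by difference quotients at a = 1 and at b = 0. The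
generating function is a value of the Laplace functional of the marked process
([integral_inf_prod_marked]); averaging out the independent marks one after the
other ([integrate_out_marks]) reduces it to the Laplace functional of the
positions ([integral_inf_prod_poisson]), which follows from the definition of a
Poisson process for step functions and by uniform approximation in general.

That ties have probability zero is shown by freezing everything but one
heading ([heading_avoids_level]): a tie is then an equation
p cos t + q sin t = r with (p, q) nonzero, which has finitely many solutions.
Off these ties, the points of the process are indexed injectively by the
stations that see exactly one closer station ([esum_max_interference]). *)

Set Implicit Arguments.
Unset Strict Implicit.
Unset Printing Implicit Defensive.

(** * Integrals off null sets and freezing of an independent variable *)

Local Open Scope ereal_scope.

Section measure_tools.
Context d (T : measurableType d) (R : realType).
Import HBNNSimple.

(** The integral of a nonnegative function is the supremum over the simple
functions below it, measurable or not, and that supremum ignores null sets.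
This makes it possible to integrate the sum over the random points of the
process, which is only seen to agree almost surely with a measurable series. *)
Lemma ge0_integral_eq_off_null (mu : {measure set T -> \bar R})
    (f g : T -> \bar R) (N : set T) :
  measurable N -> mu N = 0 -> measurable_fun setT g ->
  (forall x, 0 <= f x) -> (forall x, 0 <= g x) ->
  (forall x, ~ N x -> f x = g x) -> \int[mu]_x f x = \int[mu]_x g x.
Proof.
move=> mN N0 mg f0 g0 fg; apply/eqP; rewrite eq_le; apply/andP; split.
- rewrite [leLHS]ge0_integralTE//; apply/ge_ereal_sup => _ [h hf <-].
  rewrite -integralT_nnsfun; apply: ae_ge0_le_integral => //.
  + by move=> x _; rewrite lee_fin.
  + exact/measurable_EFinP.
  + exists N; split => // x /= nh; apply: contrapT => Nx; apply: nh => _.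
    by rewrite -fg.
- have -> : \int[mu]_x g x = \int[mu]_x (g \_ (~` N)) x.
    apply: ge0_ae_eq_integral => //.
    + by apply/(measurable_restrictT _ _).1; [exact: measurableC|exact: measurable_funTS].
    + by move=> x _; apply: erestrict_ge0.
    + exists N; split => // x /= nh; apply: contrapT => Nx; apply: nh => _.
      by rewrite patchE mem_set.
  rewrite !ge0_integralTE//; last by move=> x; apply: erestrict_ge0.
  apply: ereal_sup_le => _ [h hg <-]; exists h => // x; apply: le_trans (hg x) _.
  by rewrite patchE; case: ifPn => //; rewrite inE => /fg ->.
Qed.

(** The finite measures A |-> P (A & B) and A |-> P A * P B agree on the
pi-system G, hence on the sigma-algebra it generates. *)
Lemma indep_event_sigma (P : probability T R) (G : set (set T)) (B : set T) :
  G `<=` measurable -> setI_closed G -> measurable B ->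
  (forall A, G A -> P (A `&` B) = P A * P B) ->
  forall A, <<s G >> A -> P (A `&` B) = P A * P B.
Proof.
move=> Gm GI mB GB A GA.
have PBE : (fine (P B))%:E = P B by rewrite fineK// fin_num_measure.
have PB0 : (0 <= fine (P B))%R by rewrite fine_ge0.
pose c : {nonneg R} := NngNum PB0.
have E : mrestr P mB A = mscale c P A.
  apply: (@g_sigma_algebra_measure_unique_trace _ _ _ G setT) => //.
  - by move=> X [/Gm].
  - by move=> X Y [GX _] [GY _]; split => //; exact: GI.
  - transitivity (P B); first by rewrite /= /mrestr setTI.
    by transitivity ((fine (P B))%:E * P setT); rewrite // probability_setT mule1.
  - by move=> X [GX _]; rewrite /= /mrestr GB// /mscale/= PBE muleC.
  - by rewrite /= /mrestr setTI; apply: le_lt_trans (probability_le1 _ _) _ => //; rewrite ltry.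
  - by have /(_ _ GA) : <<s G >> `<=` <<s [set X | G X /\ X `<=` setT] >>
      by apply: sub_sigma_algebra2 => X GX; split.
move: E; rewrite /= /mrestr /mscale/= => ->.
by rewrite PBE muleC.
Qed.

End measure_tools.

Section freezing.
Context d d' (T : measurableType d) (T' : measurableType d') (R : realType).
Variables (P : probability T R) (G : set (set T)) (Y : {RV P >-> T'}).
Hypothesis Gm : G `<=` measurable.
Hypothesis GY : forall A B, <<s G >> A -> measurable B ->
  P (A `&` Y @^-1` B) = P A * P (Y @^-1` B).

Let idG : T -> g_sigma_algebraType G := id.

Let sGm : <<s G >> `<=` (measurable : set (set T)).
Proof. by apply: smallest_sub => //; exact: sigma_algebra_measurable. Qed.

Let midG : measurable_fun setT idG.
Proof. by move=> _ B mB; rewrite setTI; exact: sGm. Qed.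

HB.instance Definition _ := isMeasurableFun.Build _ _ _ _ idG midG.

Let PG := distribution P [the {mfun T >-> g_sigma_algebraType G} of idG].

Let idY : T -> g_sigma_algebraType G * T' := fun w => (idG w, Y w).

Let midY : measurable_fun setT idY.
Proof. exact/measurable_fun_pair. Qed.

HB.instance Definition _ := isMeasurableFun.Build _ _ _ _ idY midY.

(** By independence the pair (w, Y w), whose first component is observed through
the sigma-algebra generated by G, has a product law; the claim is then Fubini.
In probabilistic terms, Y may be averaged out while everything measurable with
respect to G is kept fixed. *)
Lemma integral_freeze (F : g_sigma_algebraType G * T' -> \bar R) :
  measurable_fun setT F -> (forall x, 0 <= F x) ->
  \int[P]_w F (w, Y w) = \int[P]_w \int[distribution P Y]_y F (w, y).
Proof.
move=> mF F0.
pose PY := distribution P [the {mfun T >-> (g_sigma_algebraType G * T')%type} of idY].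
transitivity (\int[PY]_z F z).
  by rewrite /PY ge0_integral_distribution.
transitivity (\int[PG \x distribution P Y]_z F z).
  apply: eq_measure_integral => A mA _; apply/esym.
  by apply: (product_measure_unique _ mA) => A1 A2 mA1 mA2; exact: GY.
rewrite fubini_tonelli1// /PG.
rewrite [RHS](_ : _ = \int[P]_w (fubini_F (distribution P Y) F \o idG) w)//.
rewrite -ge0_integral_distribution//; first exact: measurable_fun_fubini_tonelli_F.
by move=> x; apply: integral_ge0.
Qed.

End freezing.

(** * Independent marks and their integration *)

Section marks.
Context d d' (T : measurableType d) (T' : measurableType d') (R : realType).
Variables (P : probability T R) (F0 : set (set T)) (Y : nat -> {RV P >-> T'}).
Hypothesis F0m : F0 `<=` measurable.
Hypothesis F0I : setI_closed F0.
Hypothesis F0T : F0 setT.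
Hypothesis F0Y : forall E n (A : nat -> set T'), F0 E ->
  (forall i, measurable (A i)) ->
  P (E `&` \bigcap_(i < n) (Y i @^-1` A i)) =
  P E * \prod_(i < n) P (Y i @^-1` A i).

(** A pi-system that generates the base information F0 together with all marks
except the j-th one. *)
Definition cylinders_without (j : nat) : set (set T) :=
  [set E | exists F (A : nat -> set T'),
    [/\ F0 F, forall i, measurable (A i), A j = setT,
        (exists n, forall i, (n <= i)%N -> A i = setT) &
        E = F `&` \bigcap_i (Y i @^-1` A i)]].

Let mY i (A : set T') : measurable A -> measurable (Y i @^-1` A).
Proof. by move=> mA; rewrite -[X in measurable X]setTI; exact: measurable_funP. Qed.

Lemma cylinders_without_measurable j : cylinders_without j `<=` measurable.
Proof.
move=> _ [F [A [/F0m mF mA _ _ ->]]]; apply: measurableI => //.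
by apply: bigcapT_measurable => i; exact: mY.
Qed.

Lemma cylinders_without_setI j : setI_closed (cylinders_without j).
Proof.
move=> _ _ [F [A [F1 mA Aj [n An] ->]]] [G [B [G1 mB Bj [m Bm] ->]]].
exists (F `&` G), (fun i => A i `&` B i); split.
- exact: F0I.
- by move=> i; exact: measurableI.
- by rewrite Aj Bj setTI.
- exists (maxn n m) => i; rewrite geq_max => /andP[ni mi].
  by rewrite An// Bm// setTI.
- by rewrite setIACA bigcapI; congr (_ `&` _); apply: eq_bigcapr.
Qed.

Lemma cylinders_without_base j E : F0 E -> cylinders_without j E.
Proof.
move=> FE; exists E, (fun=> setT); split => //; first by exists 0%N.
by rewrite bigcapT// ?setIT// => i _; rewrite preimage_setT.
Qed.

Lemma cylinders_without_mark j k (A : set T') : k != j -> measurable A ->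
  cylinders_without j (Y k @^-1` A).
Proof.
move=> kj mA; exists setT, (fun i => if i == k then A else setT); split => //.
- by move=> i; case: ifP.
- by rewrite eq_sym (negbTE kj).
- by exists k.+1 => i ki; rewrite gtn_eqF.
- rewrite setTI; apply/seteqP; split => [w Aw i _ /=|w /(_ k Logic.I)/=].
    by case: ifPn => [/eqP ->|].
  by rewrite eqxx.
Qed.

Let P_cylinder E n (A : nat -> set T') : F0 E -> (forall i, measurable (A i)) ->
  (forall i, (n <= i)%N -> A i = setT) ->
  P (E `&` \bigcap_i (Y i @^-1` A i)) = P E * \prod_(i < n) P (Y i @^-1` A i).
Proof.
move=> FE mA An; rewrite -F0Y//; congr (P (_ `&` _)).
apply/seteqP; split => w h i; first by move=> _; exact: h.
by move=> _; have [/h//|/An] := ltnP i n; rewrite /preimage/= => ->.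
Qed.

(** On a cylinder that leaves the j-th mark free, prescribing that mark gives a
cylinder again, whose probability is a product; [indep_event_sigma] extends
this from cylinders to the sigma-algebra. *)
Lemma cylinders_without_indep j (E : set T) (B : set T') :
  <<s cylinders_without j >> E -> measurable B ->
  P (E `&` Y j @^-1` B) = P E * P (Y j @^-1` B).
Proof.
move=> GE mB; apply: (@indep_event_sigma _ _ _ _ (cylinders_without j)) GE.
- exact: cylinders_without_measurable.
- exact: cylinders_without_setI.
- exact: mY.
move=> _ [F [A [FF mA Aj [n An] ->]]].
pose A' i := if i == j then B else A i.
have mA' i : measurable (A' i) by rewrite /A'; case: ifP.
pose N := maxn n j.+1; have jN : (j < N)%N by rewrite /N leq_max ltnSn orbT.
have AN i : (N <= i)%N -> A i = setT.
  by move=> Ni; apply: An; rewrite (leq_trans _ Ni)// leq_maxl.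
have A'N i : (N <= i)%N -> A' i = setT.
  by move=> Ni; rewrite /A' gtn_eqF ?(leq_trans jN)//; exact: AN.
rewrite -setIA (_ : _ `&` _ @^-1` B = \bigcap_i (Y i @^-1` A' i)); last first.
  apply/seteqP; split=> [w [h hj] i _|w h]; rewrite /A' /=.
    by case: ifPn => [/eqP ->//|_]; exact: h.
  split; last by have := h j Logic.I; rewrite /A' /= eqxx.
  move=> i _; have := h i Logic.I; rewrite /A' /=; case: ifPn => // /eqP ->.
  by rewrite Aj.
rewrite (P_cylinder FF mA' A'N) (P_cylinder FF mA AN) -muleA; congr (_ * _).
rewrite (bigD1 (Ordinal jN))//= [in RHS](bigD1 (Ordinal jN))//=.
rewrite Aj preimage_setT probability_setT mul1e muleC /A' eqxx; congr (_ * _).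
by apply: eq_bigr => i; rewrite -val_eqE/= => /negbTE ->.
Qed.

Section integrate_out.
Variable g : nat -> g_sigma_algebraType F0 * T' -> R.
Hypothesis mg : forall k, measurable_fun setT (g k).
Hypothesis g01 : forall k z, (0 <= g k z <= 1)%R.

(** A version of the conditional expectation of g k (w, Y k w) given F0. *)
Definition mark_mean k (w : T) : R :=
  fine (\int[distribution P (Y k)]_y (g k (w, y))%:E).

Let mgw k w : measurable_fun setT (fun y => (g k (w, y))%:E).
Proof. by apply/measurable_EFinP; exact: measurableT_comp. Qed.

Let int_le1 k w : \int[distribution P (Y k)]_y (g k (w, y))%:E <= 1.
Proof.
rewrite -(@probability_setT _ _ _ (distribution P (Y k))) -[leRHS]mul1e -integral_cst//.
apply: ge0_le_integral => //.
- by move=> y _; rewrite lee_fin; have /andP[] := g01 k (w, y).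
- by move=> y _; rewrite lee_fin; have /andP[] := g01 k (w, y).
Qed.

Lemma mark_meanE k w :
  (mark_mean k w)%:E = \int[distribution P (Y k)]_y (g k (w, y))%:E.
Proof.
rewrite /mark_mean fineK// ge0_fin_numE; last first.
  by apply: integral_ge0 => y _; rewrite lee_fin; have /andP[] := g01 k (w, y).
by rewrite (le_lt_trans (int_le1 _ _))// ltry.
Qed.

Lemma mark_mean01 k w : (0 <= mark_mean k w <= 1)%R.
Proof.
rewrite -!lee_fin mark_meanE int_le1 andbT.
by apply: integral_ge0 => y _; rewrite lee_fin; have /andP[] := g01 k (w, y).
Qed.

Lemma measurable_mark_mean k :
  measurable_fun setT (mark_mean k : g_sigma_algebraType F0 -> R).
Proof.
apply/measurable_EFinP.
rewrite (_ : _ \o _ =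
  fubini_F (distribution P (Y k)) (fun z : g_sigma_algebraType F0 * T' => (g k z)%:E)).
  apply: measurable_fun_fubini_tonelli_F => //.
    exact/measurable_EFinP.
  by move=> z; rewrite lee_fin; have /andP[] := g01 k z.
by apply/funext => w /=; rewrite mark_meanE.
Qed.

Let base_gen j : measurable_fun setT
  (id : g_sigma_algebraType (cylinders_without j) -> g_sigma_algebraType F0).
Proof.
move=> _ B mB; rewrite setTI.
apply: (sub_sigma_algebra2 _ mB) => E; exact: cylinders_without_base.
Qed.

Let base_gen_comp j d2 (S : measurableType d2) (f : g_sigma_algebraType F0 -> S) :
  measurable_fun setT f ->
  measurable_fun setT (f : g_sigma_algebraType (cylinders_without j) -> S).
Proof. by move=> mf; exact: (measurableT_comp mf (@base_gen j)). Qed.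

Let mark_gen j k : k != j -> measurable_fun setT
  (Y k : g_sigma_algebraType (cylinders_without j) -> T').
Proof.
move=> kj _ B mB; rewrite setTI; apply: sub_sigma_algebra.
exact: cylinders_without_mark.
Qed.

(* Interpolates between the original product (j = 0) and the averaged one (j = K). *)
Let W K j w := (\prod_(k < K) (if (k < j)%N then mark_mean k w else g k (w, Y k w)))%R.

Let W_step K j : (j < K)%N -> \int[P]_w (W K j w)%:E = \int[P]_w (W K j.+1 w)%:E.
Proof.
move=> jK; pose o := Ordinal jK.
pose C w := (\prod_(k < K | k != o)
  (if (k < j)%N then mark_mean k w else g k (w, Y k w)))%R.
have C0 w : (0 <= C w)%R.
  apply: prodr_ge0 => k _; case: ifP => _.
    by have /andP[] := mark_mean01 k w.
  by have /andP[] := g01 k (w, Y k w).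
have mC : measurable_fun setT (C : g_sigma_algebraType (cylinders_without j) -> R).
  rewrite /C; under eq_fun do rewrite big_mkcond/=.
  apply: measurable_prod => k _; case: (boolP (k != o)) => //= ko; case: (boolP (k < j)%N) => kj.
    by apply: base_gen_comp; exact: measurable_mark_mean.
  apply: (measurableT_comp (mg k)).
  apply: (@measurable_fun_pair _ _ _ (g_sigma_algebraType (cylinders_without j))
    (g_sigma_algebraType F0) T' id (Y k)); first exact: base_gen.
  apply: mark_gen; apply: contra ko => /eqP kj'; apply/eqP; exact: val_inj.
pose F (z : g_sigma_algebraType (cylinders_without j) * T') := (C z.1 * g j z)%:E.
have mF : measurable_fun setT F.
  apply/measurable_EFinP; apply: measurable_funM.
    by apply: (measurableT_comp mC); exact: measurable_fst.
  apply: (measurableT_comp (mg j)).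
  apply/measurable_fun_pairP; split.
    by apply: (measurableT_comp (@base_gen j)); exact: measurable_fst.
  exact: measurable_snd.
have F0' z : 0 <= F z by rewrite lee_fin mulr_ge0//; have /andP[] := g01 j z.
transitivity (\int[P]_w F (w, Y j w)).
  apply: eq_integral => w _; rewrite /F/= /W (bigD1 o)//= ltnn mulrC; congr (_%:E).
transitivity (\int[P]_w \int[distribution P (Y j)]_y F (w, y)).
  apply: integral_freeze => //; first exact: cylinders_without_measurable.
  by move=> A B; exact: cylinders_without_indep.
apply: eq_integral => w _; rewrite /F /=.
under eq_integral do rewrite EFinM.
rewrite ge0_integralZl_EFin//; last first.
  by move=> y _; rewrite lee_fin; have /andP[] := g01 j (w, y).
rewrite -mark_meanE -EFinM /W (bigD1 o)//= ltnSn mulrC; congr (_ * _)%:E.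
apply: eq_bigr => k ko; rewrite ltnS (leq_eqVlt k j).
suff -> : (k == j :> nat) = false by [].
by apply: contraNF ko => /eqP kj; apply/eqP; exact: val_inj.
Qed.

(** One mark at a time: given the base information and the other marks, all
factors but the j-th are constant, so freezing turns the j-th factor into its
mean. *)
Lemma integrate_out_marks K :
  \int[P]_w (\prod_(k < K) g k (w, Y k w))%:E = \int[P]_w (\prod_(k < K) mark_mean k w)%:E.
Proof.
have H j : (j <= K)%N -> \int[P]_w (W K 0 w)%:E = \int[P]_w (W K j w)%:E.
  by elim: j => // j IH jK; rewrite IH ?(ltnW jK)// W_step.
have -> : \int[P]_w (\prod_(k < K) mark_mean k w)%:E = \int[P]_w (W K K w)%:E.
  apply: eq_integral => w _; congr (_%:E); apply: eq_bigr => k _; by rewrite ltn_ord.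
by rewrite -H.
Qed.

End integrate_out.

Lemma integral_prod_indep (u : nat -> T' -> R) K :
  (forall k, measurable_fun setT (u k)) -> (forall k y, (0 <= u k y <= 1)%R) ->
  \int[P]_w (\prod_(k < K) u k (Y k w))%:E =
  \prod_(k < K) \int[P]_w (u k (Y k w))%:E.
Proof.
move=> mu u01.
rewrite (@integrate_out_marks (fun k z => u k z.2))//; last first.
  by move=> k; exact: measurableT_comp.
pose m k := (fine (\int[distribution P (Y k)]_y (u k y)%:E)).
rewrite (_ : (fun _ => _) = cst ((\prod_(k < K) m k)%:E)); last by apply/funext => w.
rewrite integral_cst//= probability_setT mule1 -prodEFin; apply: eq_bigr => k _.
transitivity (\int[distribution P (Y k)]_y (u k y)%:E); last first.
  rewrite ge0_integral_distribution//; first exact/measurable_EFinP.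
  by move=> y; rewrite lee_fin; have /andP[] := u01 k y.
have := @mark_meanE (fun k z => u k z.2) _ _ k (point : T).
by rewrite /mark_mean /= => ->// k' z'; exact: measurableT_comp.
Qed.

End marks.

(** * Counting points in a set *)

(** Reads a counting series as a natural number; an infinite count is read
as 0. *)
Definition ereal_nat (R : realType) (y : \bar R) : nat := Num.truncn (fine y).

Lemma ereal_natK (R : realType) n : ereal_nat (n%:R%:E : \bar R) = n.
Proof. by rewrite /ereal_nat/= natrK. Qed.

Section counting.
Context (R : realType).
Implicit Type b : nat -> bool.

(** The partial sums are natural numbers below a bound, so their maximum is
attained, and no term can be added afterwards. *)
Lemma eseries_bool_stationary b : \sum_(i <oo) (b i)%:R%:E < (+oo : \bar R) ->
  exists K, forall k, (K <= k)%N -> b k = false.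
Proof.
set S := (X in X < _) => Sfin.
have b0 i : 0 <= (b i)%:R%:E :> \bar R by rewrite lee_fin.
have S0 : 0 <= S by apply: nneseries_ge0.
have sumE K : (\sum_(i < K) b i)%:R%:E = \sum_(0 <= i < K) (b i)%:R%:E :> \bar R.
  by rewrite sumEFin -natr_sum big_mkord.
have sub K : (\sum_(i < K) b i <= Num.truncn (fine S))%N.
  rewrite truncn_ge_nat ?fine_ge0// -lee_fin fineK; last by rewrite ge0_fin_numE.
  by rewrite sumE; apply: nneseries_lim_ge.
pose p m := `[< exists K, (\sum_(i < K) b i)%N = m >].
have p0 : exists m, p m by exists 0%N; apply/asboolP; exists 0%N; rewrite big_ord0.
have pub m : p m -> (m <= Num.truncn (fine S))%N by move=> /asboolP[K <-].
case: (ex_maxnP p0 pub) => m /asboolP[K Km] mmax.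
exists K => k Kk; apply/negbTE/negP => bk.
have /mmax : p (\sum_(i < k.+1) b i)%N by apply/asboolP; exists k.+1.
rewrite big_ord_recr/= bk addn1 -Km.
apply/negP; rewrite -ltnNge ltnS.
rewrite -!(big_mkord xpredT (fun i => nat_of_bool (b i))).
by rewrite (big_cat_nat (leq0n K) Kk)/= leq_addr.
Qed.

Lemma eseries_bool_stationaryE b K : (forall k, (K <= k)%N -> b k = false) ->
  \sum_(i <oo) (b i)%:R%:E = (\sum_(i < K) b i)%:R%:E :> \bar R.
Proof.
move=> bK; rewrite (@nneseries_split _ _ 0 K); last by move=> *; rewrite lee_fin.
rewrite add0n eseries0 ?adde0; last by move=> k Kk _; rewrite bK.
by rewrite sumEFin -natr_sum big_mkord.
Qed.

Section points.
Context d (Omega : measurableType d) d' (E : measurableType d').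
Variable Z : nat -> Omega -> E.
Notation N := (point_measure R Z).

Lemma point_measureE w C : N w C = \sum_(i <oo) (Z i w \in C)%:R%:E.
Proof. by apply: eq_eseriesr => i _; rewrite diracE. Qed.

Lemma point_measure_stationary w C : N w C < +oo ->
  exists K, [/\ forall k, (K <= k)%N -> Z k w \notin C,
    forall k, (K <= k)%N -> ereal_nat (N w C) = (\sum_(i < k) (Z i w \in C))%N &
    N w C = (ereal_nat (N w C))%:R%:E].
Proof.
rewrite point_measureE => /eseries_bool_stationary[K hK]; exists K; split.
- by move=> k /hK ->.
- move=> k Kk; rewrite (@eseries_bool_stationaryE _ k) ?ereal_natK// => i ki.
  by apply: hK; exact: leq_trans ki.
- by rewrite (eseries_bool_stationaryE hK) ereal_natK.
Qed.

Lemma measurable_point_measure C : (forall i, measurable_fun setT (Z i)) ->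
  measurable C -> measurable_fun setT (fun w => N w C).
Proof.
move=> mZ mC; apply: ge0_emeasurable_sum => [i w _ _|i _]; first by [].
rewrite (_ : (fun _ => _) = EFin \o ((\1_C : E -> R) \o Z i)); last first.
  by apply/funext => w/=; rewrite diracE indicE.
by apply/measurable_EFinP; apply: measurableT_comp.
Qed.

End points.

Lemma measurable_ereal_nat : measurable_fun setT (@ereal_nat R).
Proof.
have m1 n : measurable (@ereal_nat R @^-1` [set n]).
  have mE (f : \bar R -> bool) : measurable_fun setT f -> measurable [set y | f y].
    move=> mf; rewrite (_ : [set y | f y] = f @^-1` [set true]).
      by rewrite -[X in measurable X]setTI; exact: mf.
    by apply/seteqP; split => y.
  have mfine : measurable_fun setT (@fine R) by exact: fine_measurable.
  rewrite (_ : _ @^-1` _ = [set y | (n%:R <= fine y)%R && (fine y < n.+1%:R)%R]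
     `|` (if n is 0%N then [set y | (fine y < 0)%R] else set0)).
    apply: measurableU.
      by apply: mE; apply: measurable_and; [exact: measurable_fun_ler|exact: measurable_fun_ltr].
    by case: n => //; apply: mE; exact: measurable_fun_ltr.
  apply/seteqP; split => y; rewrite /ereal_nat /=.
    move=> <-; have [y0|y0] := leP 0%R (fine y); first by left; exact: truncn_itv.
    by right; rewrite (truncn0Pn _ _)// -ltNge (lt_trans y0).
  move=> [/truncn_def //|]; case: n => // /= y0.
  apply/eqP; rewrite -leqn0 truncn_le_nat (lt_trans y0)//.
move=> _ A _; rewrite setTI.
rewrite (_ : _ @^-1` A = \bigcup_(n in A) (@ereal_nat R @^-1` [set n])); last first.
  by apply/seteqP; split => [y Ay|y [n An]]; [exists (ereal_nat y)|rewrite /preimage/= => ->].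
by apply: bigcup_measurable.
Qed.

End counting.

(** * Counts of a Poisson process in disjoint sets *)

Lemma eseries_exp (R : realType) (x : R) : (0 <= x)%R ->
  \sum_(k <oo) (x ^+ k / k`!%:R)%:E = (expR x)%:E.
Proof.
move=> x0; rewrite expRE -EFin_lim; last first.
  rewrite /pseries/=; under eq_fun do rewrite mulrC.
  exact: is_cvg_series_exp_coeff.
apply/congr_lim/funext => n/=; rewrite /pseries/= /series/= -sumEFin//.
by under eq_bigr do rewrite mulrC.
Qed.

Section poisson.
Context d (Omega : measurableType d) d' (E : measurableType d') (R : realType).
Variables (P : probability Omega R) (Lambda : {measure set E -> \bar R}).
Variable X : nat -> {RV P >-> E}.
Hypothesis hX : poisson_point_process P Lambda (fun i => X i : Omega -> E).
Notation N := (point_measure R (fun i => X i : Omega -> E)).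

Let mN B : measurable B -> measurable_fun setT (N ^~ B).
Proof. by move=> mB; exact: measurable_point_measure. Qed.

Let A B k := [set w | N w B = k%:R%:E].

Let mA B k : measurable B -> measurable (A B k).
Proof.
move=> mB; rewrite -[X in measurable X]setTI.
have := mN mB measurableT (emeasurable_set1 (k%:R%:E : \bar R)).
by rewrite !setTI.
Qed.

Let tA B : trivIset setT (A B).
Proof.
apply/trivIsetP => i j _ _ ij; rewrite -subset0 => w []; rewrite /A/= => -> [/eqP].
by rewrite eqr_nat (negbTE ij).
Qed.

Let pmf B k := (expR (- fine (Lambda B)) * fine (Lambda B) ^+ k / k`!%:R)%R.

Let PA B k : measurable B -> Lambda B < +oo -> P (A B k) = (pmf B k)%:E.
Proof. by move=> mB LB; have /(_ B k mB LB) := hX.1. Qed.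

Lemma poisson_count_generating B (a : R) : (0 <= a)%R ->
  \sum_(k <oo) (a ^+ k)%:E * (pmf B k)%:E =
  (expR (- ((1 - a) * fine (Lambda B))))%:E.
Proof.
move=> a0; set r := fine _.
have r0 : (0 <= r)%R by rewrite fine_ge0.
transitivity (\sum_(k <oo) (expR (- r))%:E * ((a * r) ^+ k / k`!%:R)%:E).
  apply: eq_eseriesr => k _; rewrite /pmf -!EFinM -/r exprMn; congr (_%:E).
  by rewrite -!mulrA mulrCA.
rewrite nneseriesZl//; last first.
  by move=> k _; rewrite lee_fin divr_ge0// exprn_ge0// mulr_ge0.
rewrite eseries_exp ?mulr_ge0// -EFinM -expRD; congr (expR _)%:E.
by rewrite mulrBl mul1r opprB addrC.
Qed.

Let PAC B : measurable B -> Lambda B < +oo -> P (~` \bigcup_k A B k) = 0.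
Proof.
move=> mB LB.
have mU : measurable (\bigcup_k A B k) by apply: bigcupT_measurable => k; exact: mA.
rewrite probability_setC// (measure_semi_bigcup P (fun k => mA k mB) (@tA B))//.
rewrite (_ : \sum_(_ <oo) _ = 1) ?subee//.
transitivity (\sum_(k <oo) ((1 : R) ^+ k)%:E * (pmf B k)%:E).
  by apply: eq_eseriesr => k _; rewrite expr1n mul1e; exact: PA.
by rewrite poisson_count_generating// subrr mul0r oppr0 expR0.
Qed.

(** The Poisson masses add up to one, which leaves no mass for an infinite
count. *)
Lemma poisson_count_fin B : measurable B -> Lambda B < +oo ->
  exists Nul, [/\ measurable Nul, P Nul = 0 & forall w, ~ Nul w -> N w B < +oo].
Proof.
move=> mB LB; exists (~` \bigcup_k A B k); split; last 1 first.
- by move=> w /contrapT[k _ ->]; rewrite ltry.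
- by apply: measurableC; apply: bigcupT_measurable => k; exact: mA.
- exact: PAC.
Qed.

Lemma integral_poisson_count B (u : nat -> R) :
  measurable B -> Lambda B < +oo -> (forall k, (0 <= u k)%R) ->
  \int[P]_w (u (ereal_nat (N w B)))%:E = \sum_(k <oo) (u k)%:E * (pmf B k)%:E.
Proof.
move=> mB LB u0.
have mU : measurable (\bigcup_k A B k) by apply: bigcupT_measurable => k; exact: mA.
have mu : measurable_fun setT (fun w => (u (ereal_nat (N w B)))%:E).
  apply/measurable_EFinP; apply: (@measurableT_comp _ _ _ _ _ _ u).
    by move=> *.
  by apply: measurableT_comp; [exact: measurable_ereal_nat|exact: mN].
rewrite (ge0_negligible_integral (measurableC mU))//; last 2 first.
- by move=> w _; rewrite lee_fin.
- exact: PAC.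
rewrite setDE setCK setTI ge0_integral_bigcup//; last 3 first.
- by move=> k; exact: mA.
- exact: measurable_funTS.
- by move=> w _; rewrite lee_fin.
apply: eq_eseriesr => k _.
rewrite (eq_integral (cst (u k)%:E)); last first.
  by move=> w /set_mem; rewrite /A/= => ->; rewrite ereal_natK.
by rewrite integral_cst; [congr (_ * _); exact: PA|exact: mA].
Qed.

Lemma integral_poisson_pow B (a : R) :
  measurable B -> Lambda B < +oo -> (0 <= a)%R ->
  \int[P]_w (a ^+ ereal_nat (N w B))%:E =
  (expR (- ((1 - a) * fine (Lambda B))))%:E.
Proof.
move=> mB LB a0; rewrite (@integral_poisson_count B (fun k => a ^+ k)%R)//.
  exact: poisson_count_generating.
by move=> k; rewrite exprn_ge0.
Qed.

Let mnat B : measurable B -> measurable_fun setT (fun w => ereal_nat (N w B)).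
Proof. by move=> mB; apply: measurableT_comp; [exact: measurable_ereal_nat|exact: mN]. Qed.

(** Since k <= 2 ^ k, the mean is bounded by the generating function at 2. *)
Lemma poisson_count_integrable B : measurable B -> Lambda B < +oo ->
  P.-integrable setT (fun w => (ereal_nat (N w B))%:R%:E).
Proof.
move=> mB LB; apply/integrableP; split.
  apply/measurable_EFinP; apply: (@measurableT_comp _ _ _ _ _ _ (fun k => k%:R : R)).
    by move=> *.
  exact: mnat.
apply: (@le_lt_trans _ _ (\int[P]_w ((2 : R) ^+ ereal_nat (N w B))%:E)).
  apply: ge0_le_integral => //.
  - apply: measurableT_comp => //; apply/measurable_EFinP.
    apply: (@measurableT_comp _ _ _ _ _ _ (fun k => k%:R : R)); first by move=> *.
    exact: mnat.
  - apply/measurable_EFinP; apply: (@measurableT_comp _ _ _ _ _ _ (fun k => 2 ^+ k : R)%R).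
      by move=> *.
    exact: mnat.
  - move=> w _; rewrite gee0_abs ?lee_fin// -natrX ler_nat.
    by rewrite ltnW// ltn_expl.
by rewrite integral_poisson_pow// ltry.
Qed.

Let countRV B (mB : measurable B) : {mfun Omega >-> \bar R} :=
  HB.pack (N ^~ B) (isMeasurableFun.Build _ _ _ _ _ (mN mB)).

(** The counts in the disjoint sets B m are independent, so the expectation
factors into one-dimensional generating functions. *)
Lemma integral_poisson_prod_pow (B : nat -> set E) (a : nat -> R) M :
  (forall m, measurable (B m)) -> (forall m, Lambda (B m) < +oo) ->
  trivIset setT B -> (forall m, (0 <= a m <= 1)%R) ->
  \int[P]_w (\prod_(m < M) a m ^+ ereal_nat (N w (B m)))%:E =
  (expR (- \sum_(m < M) (1 - a m) * fine (Lambda (B m))))%:E.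
Proof.
move=> mB LB tB a01.
pose u m (y : \bar R) := (a m ^+ ereal_nat y)%R.
have mu m : measurable_fun setT (u m).
  apply: (@measurableT_comp _ _ _ _ _ _ (fun k => a m ^+ k : R)%R).
    by move=> *.
  exact: measurable_ereal_nat.
have u01 m y : (0 <= u m y <= 1)%R.
  by have /andP[? ?] := a01 m; rewrite exprn_ge0//= exprn_ile1.
(* The counts play the role of the marks over the trivial base {setT}. *)
rewrite (@integral_prod_indep _ _ _ _ _ P [set setT] (fun m => countRV (mB m)) _ _ _ _ u)//.
- rewrite -sumrN expR_sum -prodEFin; apply: eq_bigr => m _.
  by rewrite -integral_poisson_pow//; have /andP[] := a01 m.
- by move=> _ ->.
- by move=> _ _ -> ->; rewrite setTI.
move=> _ n A0 -> mA0; rewrite setTI probability_setT mul1e.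
have tBn : trivIset setT (fun i : 'I_n => B i).
  apply/trivIsetP => i j _ _ ij; move/trivIsetP: tB; apply => //.
have := (hX.2 n (fun i => B i)) (fun i => mB i) tBn (index_enum 'I_n) (fun i => A0 i)
  (index_enum_uniq _) (fun i => mA0 i).
rewrite /= => <-.
  congr (P _); apply/seteqP; split => w h i.
    by move=> _; exact: (h i (ltn_ord i)).
  by move=> iN; have := h (Ordinal iN); apply; rewrite /= mem_index_enum.
Qed.

End poisson.

(** * Infinite products over a Poisson process *)

(** Dominated convergence for real functions, with a single null set for all
exceptional points. *)
Lemma dominated_cvg_real d (T : measurableType d) (R : realType)
    (mu : {measure set T -> \bar R}) (Nul : set T) (f_ : nat -> T -> R) (f g : T -> R) :
  measurable Nul -> mu Nul = 0 ->
  (forall n, measurable_fun setT (f_ n)) -> measurable_fun setT f ->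
  mu.-integrable setT (EFin \o g) ->
  (forall n x, ~ Nul x -> (`|f_ n x| <= g x)%R) ->
  (forall x, ~ Nul x -> f_ ^~ x @ \oo --> f x) ->
  \int[mu]_x (f_ n x)%:E @[n --> \oo] --> \int[mu]_x (f x)%:E.
Proof.
move=> mN N0 mf_ mf ig fg ff.
have [] := @dominated_convergence _ _ _ mu setT measurableT
  (fun n x => (f_ n x)%:E) (fun x => (f x)%:E) (EFin \o g) _ _ _ ig _ => //.
- by move=> n; exact/measurable_EFinP.
- exact/measurable_EFinP.
- exists Nul; split => // x /= h; apply: contrapT => Nx; apply: h => _.
  by apply: cvg_EFin; [exact: nearW|exact: ff].
- exists Nul; split => // x /= h; apply: contrapT => Nx; apply: h => n _.
  by rewrite lee_fin fg.
Qed.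

Lemma integrable_indic_fin d (T : measurableType d) (R : realType)
    (mu : {measure set T -> \bar R}) (A : set T) :
  measurable A -> mu A < +oo -> mu.-integrable setT (EFin \o \1_A).
Proof.
move=> mA Ay; apply/integrableP; split; first exact/measurable_EFinP.
rewrite (eq_integral (fun x => (\1_A x)%:E)) ?integral_indic ?setIT// => x _.
by rewrite /= ger0_norm.
Qed.

Section inf_prod.
Context (R : realType).
Implicit Types b : nat -> R.

(** The infinite product of b; it is used for factors in [0, 1], whose partial
products decrease. *)
Definition inf_prod b : R := limn (fun K => \prod_(k < K) b k)%R.

Lemma prodr_itv01 b K : (forall k, (0 <= b k <= 1)%R) -> (0 <= \prod_(k < K) b k <= 1)%R.
Proof.
move=> b01; elim/big_ind: _ => [|x y /andP[x0 x1] /andP[y0 y1]|k _].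
- by rewrite ler01 lexx.
- by rewrite mulr_ge0//= mulr_ile1.
- exact: b01.
Qed.

Lemma inf_prod_cvg b : (forall k, (0 <= b k <= 1)%R) ->
  (\prod_(k < K) b k)%R @[K --> \oo] --> inf_prod b.
Proof.
move=> b01; apply: nonincreasing_is_cvgn.
  apply/nonincreasing_seqP => n; rewrite big_ord_recr/=.
  have /andP[p0 _] := prodr_itv01 n b01; rewrite ler_piMr//; by have /andP[] := b01 n.
by exists 0%R => _ [n _ <-]; have /andP[] := prodr_itv01 n b01.
Qed.

Lemma inf_prod01 b : (forall k, (0 <= b k <= 1)%R) -> (0 <= inf_prod b <= 1)%R.
Proof.
move=> b01; have bc := inf_prod_cvg b01; apply/andP; split.
  by apply: limr_ge; [exact: bc|apply: nearW => n; have /andP[] := prodr_itv01 n b01].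
by apply: limr_le; [exact: bc|apply: nearW => n; have /andP[] := prodr_itv01 n b01].
Qed.

Lemma inf_prod_stationary b K : (forall k, (K <= k)%N -> b k = 1%R) ->
  inf_prod b = (\prod_(k < K) b k)%R.
Proof.
move=> bK; apply: lim_near_cst => //; near=> n.
have Kn : (K <= n)%N by near: n; exact: nbhs_infty_ge.
rewrite -!(big_mkord xpredT b) (big_cat_nat (leq0n K) Kn)/=.
have -> : (\prod_(K <= k < n) b k = 1)%R; last by rewrite mulr1.
by rewrite big_nat_cond big1// => k; rewrite andbT => /andP[/bK].
Unshelve. all: by end_near. Qed.

Lemma measurable_inf_prod d (T : measurableType d) (f : nat -> T -> R) :
  (forall k, measurable_fun setT (f k)) -> (forall k x, (0 <= f k x <= 1)%R) ->
  measurable_fun setT (fun x => inf_prod (f ^~ x)).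
Proof.
move=> mf f01; apply: (measurable_fun_cvg (h := fun K x => \prod_(k < K) f k x)%R).
  by move=> K; apply: measurable_prod.
by move=> x _; apply: inf_prod_cvg.
Qed.

Lemma integral_inf_prod_cvg d (T : measurableType d) (P : probability T R) (f : nat -> T -> R) :
  (forall k, measurable_fun setT (f k)) -> (forall k x, (0 <= f k x <= 1)%R) ->
  \int[P]_x (\prod_(k < K) f k x)%:E @[K --> \oo] --> \int[P]_x (inf_prod (f ^~ x))%:E.
Proof.
move=> mf f01; apply: (@dominated_cvg_real _ _ _ _ set0 _ _ (cst 1%R)) => //.
- by move=> K; apply: measurable_prod.
- exact: measurable_inf_prod.
- exact: finite_measure_integrable_cst.
- by move=> n x _; have /andP[? ?] := prodr_itv01 n (f01 ^~ x); rewrite ger0_norm.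
- by move=> x _; apply: inf_prod_cvg.
Qed.

End inf_prod.

Section poisson_product.
Context d (Omega : measurableType d) d' (E : measurableType d') (R : realType).
Variables (P : probability Omega R) (Lambda : {measure set E -> \bar R}).
Variable X : nat -> {RV P >-> E}.
Hypothesis hX : poisson_point_process P Lambda (fun i => X i : Omega -> E).
Notation N := (point_measure R (fun i => X i : Omega -> E)).
Variables (B : set E) (mB : measurable B) (LB : Lambda B < +oo).

(* The value of [step] is 1 off B, so points outside B do not contribute. *)
Let step (a : nat -> R) (q : E -> nat) x := (if x \in B then a (q x) else 1)%R.

(** If C m is the part of B where q equals m, the product over all points of the
step function is the product of the powers a m ^+ N (C m), whose expectation
is known. *)
Lemma integral_inf_prod_step (a : nat -> R) (q : E -> nat) M :
  (forall m, (0 <= a m <= 1)%R) -> measurable_fun setT q ->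
  (forall x, (q x < M)%N) ->
  \int[P]_w (inf_prod (fun k => step a q (X k w)))%:E =
  (expR (- fine (\int[Lambda]_x (1 - step a q x)%:E)))%:E.
Proof.
move=> a01 mq qM; pose C m := B `&` q @^-1` [set m].
have mC m : measurable (C m).
  by apply: measurableI => //; rewrite -[X in measurable X]setTI; exact: mq.
have LC m : Lambda (C m) < +oo.
  by apply: le_lt_trans LB; apply: le_measure; rewrite ?inE//; exact: subIsetl.
have tC : trivIset setT C.
  apply/trivIsetP => i j _ _ ij; rewrite -subset0 => x [[_ Ci] [_ Cj]].
  by move: Ci Cj ij; rewrite /preimage/= => -> ->; rewrite eqxx.
have stepE x : step a q x = (\prod_(m < M) a m ^+ (x \in C m))%R.
  rewrite /step; case: ifPn => xB; last first.
    rewrite big1// => m _; rewrite (_ : (_ \in _) = false) ?expr0//.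
    by apply: contraNF xB; rewrite !inE => -[].
  rewrite (bigD1 (Ordinal (qM x)))//= mem_set ?expr1; last first.
    by split => //=; exact: set_mem xB.
  rewrite big1 ?mulr1// => m mq'; rewrite memNset ?expr0// => -[_ /= qm].
  by move: mq'; rewrite -val_eqE/= qm eqxx.
have stepE1 x : (1 - step a q x = \sum_(m < M) (1 - a m) * \1_(C m) x)%R.
  rewrite /step; case: ifPn => xB; last first.
    rewrite subrr big1// => m _; rewrite indicE (_ : (_ \in _) = false) ?mulr0//.
    by apply: contraNF xB; rewrite !inE => -[].
  rewrite (bigD1 (Ordinal (qM x)))//= indicE mem_set ?mulr1; last first.
    by split => //=; exact: set_mem xB.
  rewrite big1 ?addr0// => m mq'; rewrite indicE memNset ?mulr0// => -[_ /= qm].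
  by move: mq'; rewrite -val_eqE/= qm eqxx.
have -> : fine (\int[Lambda]_x (1 - step a q x)%:E) =
    (\sum_(m < M) (1 - a m) * fine (Lambda (C m)))%R.
  rewrite (_ : \int[_]_x _ = (\sum_(m < M) (1 - a m) * fine (Lambda (C m)))%:E)//.
  transitivity (\int[Lambda]_x \sum_(m < M) ((1 - a m) * \1_(C m) x)%:E).
    by apply: eq_integral => x _; rewrite stepE1 sumEFin.
  rewrite ge0_integral_sum//; last 2 first.
    by move=> m; apply/measurable_EFinP; apply: measurable_funM.
    move=> m x _; rewrite lee_fin mulr_ge0//; have /andP[_] := a01 m.
    by rewrite subr_ge0.
  rewrite -sumEFin; apply: eq_bigr => m _.
  under eq_integral do rewrite EFinM.
  rewrite ge0_integralZl_EFin//; last 2 first.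
  - by apply/measurable_EFinP.
  - by have /andP[_] := a01 m; rewrite subr_ge0.
  rewrite integral_indic// setIT EFinM fineK// ge0_fin_numE//.
have [Nul [mNul Nul0 hNul]] := poisson_count_fin hX mB LB.
rewrite -(integral_poisson_prod_pow hX M mC LC tC a01).
have mnat m : measurable_fun setT (fun w => a m ^+ ereal_nat (N w (C m)))%R.
  apply: (@measurableT_comp _ _ _ _ _ _ (fun k => a m ^+ k : R)%R); first by move=> *.
  apply: measurableT_comp; first exact: measurable_ereal_nat.
  exact: measurable_point_measure.
have mstep : measurable_fun setT (step a q).
  rewrite (_ : step a q = fun x => \prod_(m < M) a m ^+ (x \in C m))%R; last first.
    by apply/funext.
  apply: measurable_prod => m _.
  apply: (@measurableT_comp _ _ _ _ _ _ (fun k => a m ^+ (nat_of_bool k) : R)%R).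
    by move=> *.
  rewrite (_ : (fun x => x \in C m) = (fun x => (0 < (\1_(C m) x : R))%R)).
    by apply: measurable_fun_ltr.
  by apply/funext => x; rewrite indicE; case: (_ \in _); rewrite /= ?ltr01 ?ltxx.
have step01 x : (0 <= step a q x <= 1)%R.
  by rewrite /step; case: ifP => _ //; rewrite ler01 lexx.
apply: ge0_integral_eq_off_null mNul Nul0 _ _ _ _.
- by apply/measurable_EFinP; apply: measurable_prod.
- move=> w; rewrite lee_fin.
  by have /andP[] := inf_prod01 (fun k => step01 (X k w)).
- move=> w; rewrite lee_fin prodr_ge0// => m _.
  by rewrite exprn_ge0//; have /andP[] := a01 m.
move=> w /hNul/point_measure_stationary[K [hK _ _]]; congr (_%:E).
rewrite (@inf_prod_stationary _ _ K); last first.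
  by move=> k /hK XkB; rewrite /step (negbTE XkB).
under eq_bigr do rewrite stepE.
rewrite exchange_big/=; apply: eq_bigr => m _.
rewrite prodrXr point_measureE (@eseries_bool_stationaryE _ _ K) ?ereal_natK//.
move=> k /hK; apply: contraNF; rewrite !inE => -[]//.
Qed.

(** The Laplace functional of a Poisson process, for a factor h equal to 1 off a
set of finite intensity. Rounding h down on B gives step functions, and both
sides pass to the limit: almost surely finitely many points are in B, and on
the right the integrands are dominated by the indicator of B. *)
Lemma integral_inf_prod_poisson (h : E -> R) :
  measurable_fun setT h -> (forall x, (0 <= h x <= 1)%R) ->
  (forall x, ~ B x -> h x = 1%R) ->
  \int[P]_w (inf_prod (fun k => h (X k w)))%:E =
  (expR (- fine (\int[Lambda]_x (1 - h x)%:E)))%:E.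
Proof.
move=> mh h01 hB.
pose q n x := Num.truncn (n.+1%:R * h x)%R.
(* The minimum with 1 keeps a n m in [0, 1] also for levels m that h does not reach. *)
pose a n (m : nat) : R := Order.min 1%R (m%:R / n.+1%:R)%R.
pose s n := step (a n) (q n).
have a01 n m : (0 <= a n m <= 1)%R.
  by rewrite /a le_min ler01 divr_ge0//= ge_min lexx.
have nh0 n x : (0 <= n.+1%:R * h x)%R by rewrite mulr_ge0//; have /andP[] := h01 x.
have qM n x : (q n x < n.+2)%N.
  rewrite /q truncn_lt_nat// (@le_lt_trans _ _ n.+1%:R)//; last by rewrite ltr_nat.
  by rewrite ler_piMr//; have /andP[] := h01 x.
have mq n : measurable_fun setT (q n).
  rewrite (_ : q n = @ereal_nat R \o (EFin \o (fun x => n.+1%:R * h x)%R))//.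
  apply: measurableT_comp; first exact: measurable_ereal_nat.
  by apply/measurable_EFinP; exact: measurable_funM.
have s01 n x : (0 <= s n x <= 1)%R.
  by rewrite /s/step; case: ifP => _ //; rewrite ler01 lexx.
have sh n x : (`|h x - s n x| <= n.+1%:R^-1)%R.
  rewrite /s /step; case: ifPn => [xB|/negP xB]; last first.
    by rewrite hB ?subrr ?normr0 ?invr_ge0// => Bx; apply: xB; exact: mem_set.
  have /andP[q1 q2] := truncn_itv (nh0 n x).
  have n0 : (0 < n.+1%:R :> R)%R by rewrite ltr0n.
  have -> : a n (q n x) = ((q n x)%:R / n.+1%:R)%R.
    apply/min_idPr; rewrite ler_pdivrMr// mul1r (le_trans q1)// ler_piMr//.
    by have /andP[] := h01 x.
  have -> : (h x - (q n x)%:R / n.+1%:R = (n.+1%:R * h x - (q n x)%:R) / n.+1%:R)%R.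
    by rewrite mulrBl mulrAC mulfV ?mul1r// gt_eqF.
  rewrite ger0_norm; last by rewrite divr_ge0// subr_ge0.
  rewrite ler_pdivrMr// mulVf ?gt_eqF// lerBlDl.
  by rewrite (le_trans (ltW q2))// -natr1.
have s_h x : s ^~ x @ \oo --> h x.
  apply/cvgrPdist_le => e e0; near=> n; apply: le_trans (sh n x) _.
  rewrite -[leRHS]invrK lef_pV2 ?posrE ?invr_gt0//.
  rewrite (le_trans (ltW (truncnS_gt e^-1)))// ler_nat ltnS.
  by near: n; exact: nbhs_infty_ge.
have ms n : measurable_fun setT (s n).
  apply: measurable_fun_ifT => //.
    rewrite (_ : (fun x => x \in B) = (fun x => (0 < (\1_B x : R))%R)).
      by apply: measurable_fun_ltr.
    by apply/funext => x; rewrite indicE; case: (_ \in _); rewrite /= ?ltr01 ?ltxx.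
  by apply: (@measurableT_comp _ _ _ _ _ _ (a n)) => //; move=> *.
have [Nul [mNul Nul0 hNul]] := poisson_count_fin hX mB LB.
have mX (f : E -> R) k : measurable_fun setT f -> measurable_fun setT (fun w => f (X k w)).
  by move=> mf; apply: measurableT_comp.
have c1 : \int[P]_w (inf_prod (fun k => s n (X k w)))%:E @[n --> \oo] -->
    \int[P]_w (inf_prod (fun k => h (X k w)))%:E.
  apply: (@dominated_cvg_real _ _ _ _ Nul _ _ (cst 1%R)) => //.
  - by move=> n; apply: measurable_inf_prod => // k; exact: mX.
  - by apply: measurable_inf_prod => // k; exact: mX.
  - exact: finite_measure_integrable_cst.
  - move=> n w _; have /andP[? ?] := inf_prod01 (fun k => s01 n (X k w)).
    by rewrite ger0_norm.
  move=> w /hNul/point_measure_stationary[K [hK _ _]].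
  rewrite (@inf_prod_stationary _ _ K); last first.
    by move=> k /hK/negP XkB; rewrite hB// => ?; apply: XkB; exact: mem_set.
  rewrite (_ : (fun n => _) = (fun n => \prod_(k < K) s n (X k w))%R); last first.
    apply/funext => n; rewrite (@inf_prod_stationary _ _ K)// => k /hK XkB.
    by rewrite /s /step (negbTE XkB).
  elim: K {hK} => [|K IH].
    by under eq_fun do rewrite big_ord0; rewrite big_ord0; exact: cvg_cst.
  under eq_fun do rewrite big_ord_recr/=; rewrite big_ord_recr/=.
  by apply: cvgM.
have c2 : \int[Lambda]_x (1 - s n x)%:E @[n --> \oo] --> \int[Lambda]_x (1 - h x)%:E.
  apply: (@dominated_cvg_real _ _ _ _ set0 _ _ (\1_B)) => //.
  - by move=> n; exact: measurable_funB.
  - exact: measurable_funB.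
  - exact: integrable_indic_fin.
  - move=> n x _; have /andP[? ?] := s01 n x; rewrite ger0_norm ?subr_ge0//.
    rewrite indicE /s /step; case: ifPn => xB /=; last by rewrite subrr.
    by rewrite gerBl; have /andP[] := a01 n (q n x).
  - by move=> x _; apply: cvgB; [exact: cvg_cst|exact: s_h].
have fin1 : \int[Lambda]_x (1 - h x)%:E \is a fin_num.
  rewrite ge0_fin_numE; last first.
    by apply: integral_ge0 => x _; rewrite lee_fin subr_ge0; have /andP[] := h01 x.
  apply: le_lt_trans LB.
  have -> : Lambda B = \int[Lambda]_x (\1_B x)%:E by rewrite integral_indic// setIT.
  apply: ge0_le_integral => //.
  - by move=> x _; rewrite lee_fin subr_ge0; have /andP[] := h01 x.
  - by apply/measurable_EFinP; exact: measurable_funB.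
  - exact/measurable_EFinP.
  move=> x _; rewrite lee_fin indicE; case: (boolP (x \in B)) => xB /=.
    by rewrite gerBl; have /andP[] := h01 x.
  by rewrite hB ?subrr// => ?; move/negP: xB; apply; exact: mem_set.
have c3 : (expR (- fine (\int[Lambda]_x (1 - s n x)%:E)))%:E @[n --> \oo] -->
    (expR (- fine (\int[Lambda]_x (1 - h x)%:E)))%:E.
  apply: cvg_EFin; first exact: nearW.
  apply: (cvg_comp _ expR); last exact: continuous_expR.
  by apply: cvgN; apply: fine_cvg; rewrite fineK.
rewrite -(cvg_lim _ c1)// -[RHS](cvg_lim _ c3)//; congr (limn _).
apply/funext => n; rewrite (integral_inf_prod_step (a01 n) (mq n) (qM n)) //.
Unshelve. all: by end_near. Qed.

End poisson_product.

(** * Counts of the independently marked Poisson process *)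

Lemma integral_probability1 d (T : measurableType d) (R : realType) (U : probability T R) :
  \int[U]_x (1%R)%:E = 1.
Proof. by rewrite (integral_cst U measurableT (1%R)%:E)/= probability_setT mule1. Qed.

Section quotients.
Context (R : realType).

(** The difference quotient of the exponential along 1 / (n + 1), squeezed
between y and y * expR (y / (n + 1)). *)
Lemma cvg_exp_quotient (y : R) :
  (n.+1%:R * (expR (y / n.+1%:R) - 1))%R @[n --> \oo] --> y.
Proof.
have h0 : (y / n.+1%:R)%R @[n --> \oo] --> (0 : R)%R.
  rewrite -[X in _ --> X](mulr0 y); apply: cvgM; first exact: cvg_cst.
  exact: cvg_harmonic.
have h1 : (y * expR (y / n.+1%:R))%R @[n --> \oo] --> y.
  suff : (y * expR (y / n.+1%:R))%R @[n --> \oo] --> (y * expR 0)%R.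
    by rewrite expR0 mulr1.
  apply: cvgM; first exact: cvg_cst.
  exact: (cvg_comp _ expR h0 (@continuous_expR R 0%R)).
apply: (squeeze_cvgr _ (cvg_cst y) h1); apply: nearW => n.
have n0 : (0 < n.+1%:R :> R)%R by rewrite ltr0n.
set x := (y / n.+1%:R)%R.
have -> : y = (n.+1%:R * x)%R by rewrite /x mulrC divfK// gt_eqF.
rewrite -mulrA !ler_pM2l// lerBrDl expR_ge1Dx/= lerBlDr.
have : (1 - x <= expR (- x))%R by exact: expR_ge1Dx.
have e0 := expR_gt0 x; rewrite expRN -(ler_pM2r e0) mulVf ?gt_eqF//.
by move=> ?; lra.
Qed.

Context d (T : measurableType d) (mu : {measure set T -> \bar R}).

Lemma integral_scaled_diff (c a b : R) (f g : T -> R) :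
  mu.-integrable setT (EFin \o f) -> mu.-integrable setT (EFin \o g) ->
  \int[mu]_x (f x)%:E = a%:E -> \int[mu]_x (g x)%:E = b%:E ->
  \int[mu]_x (c * (f x - g x))%:E = (c * (a - b))%:E.
Proof.
move=> iF iG fa gb.
under eq_integral do rewrite EFinM.
rewrite integralZl//.
  by under eq_integral do rewrite EFinB; rewrite integralB_EFin// fa gb.
rewrite (_ : (fun _ => _) = (EFin \o f) \- (EFin \o g)) ?integrableB//.
Qed.

Lemma le_integrable_real (f g : T -> R) : measurable_fun setT f ->
  mu.-integrable setT (EFin \o g) -> (forall x, `|f x| <= `|g x|)%R ->
  mu.-integrable setT (EFin \o f).
Proof.
move=> mf ig fg; apply: le_integrable ig => //; first exact/measurable_EFinP.
by move=> x _; rewrite /= lee_fin.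
Qed.

End quotients.

Section marked_poisson.
Context d (Omega : measurableType d) d1 (E : measurableType d1)
  d2 (T' : measurableType d2) (R : realType).
Variables (P : probability Omega R) (Lambda : {sigma_finite_measure set E -> \bar R}).
Variables (U : probability T' R).
Variables (X : nat -> {RV P >-> E}) (Theta : nat -> {RV P >-> T'}).
Hypothesis hX : poisson_point_process P Lambda (fun i => X i : Omega -> E).
Hypothesis hU : forall i (A : set T'), measurable A -> distribution P (Theta i) A = U A.
Hypothesis hiid : mutually_independent P (fun i => Theta i : Omega -> T').
Hypothesis hindep : independent_sigma P
  (sigma_family (fun i => X i : Omega -> E)) (sigma_family (fun i => Theta i : Omega -> T')).

Definition base_sigma := sigma_family (fun i => X i : Omega -> E).

Let sub_meas d3 (S : measurableType d3) (Y : nat -> {RV P >-> S}) :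
  sigma_family (fun i => Y i : Omega -> S) `<=` measurable.
Proof.
apply: smallest_sub; first exact: sigma_algebra_measurable.
move=> A [i _ [B mB <-]].
by apply: measurable_funP.
Qed.

Let sigma_mem d3 (S : measurableType d3) (Y : nat -> {RV P >-> S}) i (B : set S) :
  measurable B -> sigma_family (fun i => Y i : Omega -> S) (Y i @^-1` B).
Proof.
move=> mB; apply: sub_sigma_algebra; exists i => //; exists B => //.
by rewrite setTI.
Qed.

Lemma base_sigma_measurable : base_sigma `<=` measurable.
Proof. exact: sub_meas. Qed.

Lemma base_sigmaI : setI_closed base_sigma.
Proof.
move=> A B hA hB; set G := \bigcup_i g_sigma_algebra_preimage (X i).
exact: (@measurableI _ (g_sigma_algebraType G) A B hA hB).
Qed.

Lemma base_sigmaT : base_sigma setT.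
Proof.
set G := \bigcup_i g_sigma_algebra_preimage (X i).
exact: (@measurableT _ (g_sigma_algebraType G)).
Qed.

Lemma base_sigma_indep A n (B : nat -> set T') : base_sigma A ->
  (forall i, measurable (B i)) ->
  P (A `&` \bigcap_(i < n) (Theta i @^-1` B i)) =
  P A * \prod_(i < n) P (Theta i @^-1` B i).
Proof.
move=> hA mB; rewrite hindep//.
  congr (_ * _); rewrite -(big_mkord xpredT (fun i => P (Theta i @^-1` B i))).
  rewrite -(@hiid (index_iota 0 n) B (iota_uniq _ _) mB); congr (P _).
  by apply/seteqP; split => w h i /=; [rewrite mem_index_iota; exact: h|
    move=> iN; apply: h; rewrite /= mem_index_iota].
set G := \bigcup_i g_sigma_algebra_preimage (Theta i).
apply: (@bigcap_measurableType _ (g_sigma_algebraType G) (fun i => Theta i @^-1` B i)).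
by move=> i _; exact: sigma_mem.
Qed.

Lemma measurable_base_X i : measurable_fun setT (X i : g_sigma_algebraType base_sigma -> E).
Proof.
by move=> _ B mB; rewrite setTI; apply: sub_sigma_algebra; exact: sigma_mem.
Qed.

Definition marked k w := (X k w, Theta k w).

Lemma measurable_marked k : measurable_fun setT (marked k).
Proof. exact: measurable_fun_pair. Qed.

Variables (B : set E) (mB : measurable B) (LB : Lambda B < +oo).

Let mkZ (g : E * T' -> R) k : measurable_fun setT g ->
  measurable_fun setT (fun w => g (marked k w)).
Proof. by move=> mg; apply: measurableT_comp => //; exact: measurable_marked. Qed.

(** Independent marking preserves the Poisson property, in terms of Laplace
functionals: averaging the marks out of g gives a function gb of the position
alone, to which the Laplace functional of the positions applies. *)
Lemma integral_inf_prod_marked (g : E * T' -> R) :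
  measurable_fun setT g -> (forall z, (0 <= g z <= 1)%R) ->
  (forall z, ~ B z.1 -> g z = 1%R) ->
  \int[P]_w (inf_prod (fun k => g (marked k w)))%:E =
  (expR (- fine (\int[Lambda \x U]_z (1 - g z)%:E)))%:E.
Proof.
move=> mg g01 gB.
pose gb x := fine (\int[U]_y (g (x, y))%:E).
have mgx x : measurable_fun setT (fun y => (g (x, y))%:E).
  by apply/measurable_EFinP; exact: measurableT_comp.
have gbE x : (gb x)%:E = \int[U]_y (g (x, y))%:E.
  rewrite /gb fineK// ge0_fin_numE.
    apply: (@le_lt_trans _ _ (\int[U]_y (1%R)%:E)); last first.
      by rewrite integral_probability1 ltry.
    apply: ge0_le_integral => //.
    - by move=> y _; rewrite lee_fin; have /andP[] := g01 (x, y).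
    - by move=> y _; rewrite lee_fin; have /andP[] := g01 (x, y).
  by apply: integral_ge0 => y _; rewrite lee_fin; have /andP[] := g01 (x, y).
have gb01 x : (0 <= gb x <= 1)%R.
  rewrite -!lee_fin gbE integral_ge0/=; last first.
    by move=> y _; rewrite lee_fin; have /andP[] := g01 (x, y).
  rewrite -[leRHS](integral_probability1 U).
  apply: ge0_le_integral => //.
  - by move=> y _; rewrite lee_fin; have /andP[] := g01 (x, y).
  - by move=> y _; rewrite lee_fin; have /andP[] := g01 (x, y).
have mgb : measurable_fun setT gb.
  apply/measurable_EFinP.
  rewrite (_ : _ \o _ = fubini_F U (fun z => (g z)%:E)); last first.
    by apply/funext => x /=; rewrite gbE.
  apply: measurable_fun_fubini_tonelli_F; first exact/measurable_EFinP.
  by move=> z; rewrite lee_fin; have /andP[] := g01 z.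
have gbB x : ~ B x -> gb x = 1%R.
  move=> Bx; rewrite /gb (eq_integral (cst (1%R)%:E)).
    by rewrite integral_probability1.
  by move=> y _; rewrite gB.
have -> : \int[Lambda \x U]_z (1 - g z)%:E = \int[Lambda]_x (1 - gb x)%:E.
  rewrite fubini_tonelli1/=; last 2 first.
  - by apply/measurable_EFinP; exact: measurable_funB.
  - by move=> z; rewrite lee_fin subr_ge0; have /andP[] := g01 z.
  apply: eq_integral => x _; rewrite /fubini_F/=.
  under eq_integral do rewrite -[(_ - _)%R]mul1r.
  rewrite (@integral_scaled_diff _ _ _ U 1 1 (gb x))//.
  - by rewrite mul1r.
  - exact: finite_measure_integrable_cst.
  - apply: (@le_integrable_real _ _ _ _ _ (cst 1%R)) => //.
    + exact: measurableT_comp.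
    + exact: finite_measure_integrable_cst.
    + by move=> y; have /andP[? ?] := g01 (x, y); rewrite !ger0_norm//.
  - exact: integral_probability1.
rewrite -(integral_inf_prod_poisson hX mB LB mgb gb01 gbB).
have c1 := @integral_inf_prod_cvg _ _ _ P (fun k w => g (marked k w))
  (fun k => mkZ k mg) (fun k w => g01 _).
have mgbX k : measurable_fun setT (fun w => gb (X k w)) by apply: measurableT_comp.
have c2 := @integral_inf_prod_cvg _ _ _ P (fun k w => gb (X k w)) mgbX (fun k w => gb01 _).
rewrite -(cvg_lim _ c1)// -[RHS](cvg_lim _ c2)//; congr (limn _).
apply/funext => K.
rewrite (@integrate_out_marks _ _ _ _ _ P base_sigma Theta base_sigma_measurable
  base_sigmaI base_sigmaT base_sigma_indep (fun k z => g (X k z.1, z.2)))//.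
- apply: eq_integral => w _; congr (_%:E); apply: eq_bigr => k _.
  rewrite /mark_mean /gb; congr fine; apply: eq_measure_integral => A mA _; exact: hU.
move=> k; apply: (measurableT_comp mg); apply/measurable_fun_pairP; split.
  by apply: (measurableT_comp (measurable_base_X k)); exact: measurable_fst.
exact: measurable_snd.
Qed.

Notation N := (point_measure R marked).
Notation M := (Lambda \x U).

Let NB := point_measure R (fun k => X k : Omega -> E).

Lemma marked_count_le w C : C `<=` B `*` setT -> N w C <= NB w B.
Proof.
move=> CB; rewrite /NB !point_measureE; apply: lee_nneseries => i _; rewrite !lee_fin//.
rewrite ler_nat; case: (boolP (marked i w \in C)) => // /set_mem/CB[/= /mem_set -> _]//.
Qed.

Lemma marked_measure_fin C : measurable C -> C `<=` B `*` setT -> M C < +oo.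
Proof.
move=> mC CB; apply: (@le_lt_trans _ _ (M (B `*` setT))).
  by apply: le_measure; rewrite ?inE//; exact: measurableX.
by rewrite product_measure1E//= probability_setT mule1.
Qed.

Let cnt C w := ereal_nat (N w C).

Let mcnt C (u : nat -> R) : measurable C -> measurable_fun setT (fun w => u (cnt C w)).
Proof.
move=> mC; apply: (@measurableT_comp _ _ _ _ _ _ u); first by move=> *.
apply: measurableT_comp; first exact: measurable_ereal_nat.
apply: measurable_point_measure => //; exact: measurable_marked.
Qed.

Section two_sets.
Variables (C D : set (E * T')) (mC : measurable C) (mD : measurable D).
Hypotheses (CB : C `<=` B `*` setT) (DB : D `<=` B `*` setT) (CD : C `&` D = set0).

(** The Laplace functional at the function equal to a on C, b on D and 1
elsewhere. *)
Lemma integral_marked_pow (a b : R) : (0 <= a <= 1)%R -> (0 <= b <= 1)%R ->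
  \int[P]_w (a ^+ cnt C w * b ^+ cnt D w)%:E =
  (expR (- ((1 - a) * fine (M C) + (1 - b) * fine (M D))))%:E.
Proof.
move=> a01 b01; have [[a0 a1] [b0 b1]] := (andP a01, andP b01).
pose g z := (a ^+ (z \in C) * b ^+ (z \in D))%R.
have mg1 (c : R) S : measurable S -> measurable_fun setT (fun z : E * T' => c ^+ (z \in S))%R.
  move=> mS; apply: (@measurableT_comp _ _ _ _ _ _ (fun k => c ^+ (nat_of_bool k) : R)%R).
    by move=> *.
  rewrite (_ : (fun x => x \in S) = (fun x => (0 < (\1_S x : R))%R)).
    by apply: measurable_fun_ltr.
  by apply/funext => x; rewrite indicE; case: (_ \in _); rewrite /= ?ltr01 ?ltxx.
have mg : measurable_fun setT g by apply: measurable_funM; exact: mg1.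
have g01 z : (0 <= g z <= 1)%R.
  by rewrite /g mulr_ge0 ?exprn_ge0//= mulr_ile1 ?exprn_ge0 ?exprn_ile1.
have gB z : ~ B z.1 -> g z = 1%R.
  by move=> nB; rewrite /g !memNset ?expr0 ?mulr1// => [/DB|/CB] [].
have -> : ((1 - a) * fine (M C) + (1 - b) * fine (M D))%R =
    fine (\int[M]_z (1 - g z)%:E).
  rewrite (_ : \int[M]_z _ = ((1 - a) * fine (M C) + (1 - b) * fine (M D))%:E)//.
  transitivity (\int[M]_z (((1 - a) * \1_C z)%:E + ((1 - b) * \1_D z)%:E)).
    apply: eq_integral => z _; rewrite -EFinD !indicE /g; congr (_%:E).
    case: (boolP (z \in C)) => zC; case: (boolP (z \in D)) => zD; rewrite /= ?expr0 ?expr1; try lra.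
    suff : set0 z by [].
    by rewrite -CD; split; exact: set_mem.
  have iE (c : R) S : (0 <= c)%R -> measurable S -> M S < +oo ->
      \int[M]_z (c * \1_S z)%:E = (c * fine (M S))%:E.
    move=> c0 mS Sy; under eq_integral do rewrite EFinM.
    rewrite ge0_integralZl_EFin//; last exact/measurable_EFinP.
    by rewrite integral_indic// setIT EFinM fineK// ge0_fin_numE.
  rewrite ge0_integralD//.
  - by rewrite !iE ?subr_ge0//; exact: marked_measure_fin.
  - by move=> z _; rewrite lee_fin mulr_ge0// subr_ge0.
  - by apply/measurable_EFinP; apply: measurable_funM.
  - by move=> z _; rewrite lee_fin mulr_ge0// subr_ge0.
  - by apply/measurable_EFinP; apply: measurable_funM.
rewrite -(integral_inf_prod_marked mg g01 gB).
have [Nul [mNul Nul0 hNul]] := poisson_count_fin hX mB LB.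
apply/esym; apply: (ge0_integral_eq_off_null mNul Nul0) => //.
- by apply/measurable_EFinP; apply: measurable_funM; apply: (@mcnt _ (fun k => _ ^+ k)%R).
- by move=> w; rewrite lee_fin; have /andP[] := inf_prod01 (fun k => g01 (marked k w)).
- by move=> w; rewrite lee_fin mulr_ge0// exprn_ge0.
move=> w /hNul/point_measure_stationary[K [hK _ _]]; congr (_%:E).
have hS S : S `<=` B `*` setT -> forall k, (K <= k)%N -> (marked k w \in S) = false.
  move=> SB k /hK; apply: contraNF => /set_mem/SB[/= Xk _]; exact: mem_set.
rewrite (@inf_prod_stationary _ _ K); last first.
  by move=> k kK; rewrite /g !hS// mulr1.
rewrite big_split/= !prodrXr; congr (_ ^+ _ * _ ^+ _)%R.
  by rewrite /cnt point_measureE (@eseries_bool_stationaryE _ _ K) ?ereal_natK//; exact: hS.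
by rewrite /cnt point_measureE (@eseries_bool_stationaryE _ _ K) ?ereal_natK//; exact: hS.
Qed.

Let le_cnt S w : S `<=` B `*` setT -> NB w B < +oo -> (cnt S w <= ereal_nat (NB w B))%N.
Proof.
move=> SB fB; have le := marked_count_le w SB.
have [_ [_ _ EB]] := point_measure_stationary fB.
have [_ [_ _ ES]] := point_measure_stationary (le_lt_trans le fB).
by rewrite /NB ES EB lee_fin ler_nat in le.
Qed.

Let iPow (a b : R) : (0 <= a <= 1)%R -> (0 <= b <= 1)%R ->
  P.-integrable setT (fun w => (a ^+ cnt C w * b ^+ cnt D w)%:E).
Proof.
move=> /andP[a0 a1] /andP[b0 b1].
apply: (@le_integrable_real _ _ _ P _ (cst 1%R)) => //.
- by apply: measurable_funM; apply: (@mcnt _ (fun k => _ ^+ k)%R).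
- exact: finite_measure_integrable_cst.
by move=> w; rewrite !ger0_norm ?mulr_ge0 ?exprn_ge0// mulr_ile1 ?exprn_ge0 ?exprn_ile1.
Qed.

(** Differentiates the joint generating function in a at a = 1. With
s = 1 / (n + 1), the quotient (1 - (1 - s) ^+ m) / s is a geometric sum with
limit m and at most m, so the integrable number of points over B dominates. *)
Lemma integral_marked_count_pow (b : R) : (0 <= b <= 1)%R ->
  \int[P]_w ((cnt C w)%:R * b ^+ cnt D w)%:E =
  (fine (M C) * expR (- ((1 - b) * fine (M D))))%:E.
Proof.
move=> b01; have /andP[b0 b1] := b01.
have [Nul [mNul Nul0 hNul]] := poisson_count_fin hX mB LB.
pose s n : R := (n.+1%:R^-1)%R.
have s01 n : (0 <= 1 - s n <= 1)%R.
  by rewrite subr_ge0 gerBl invr_ge0 ler0n andbT invf_le1// ler1n.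
have s1 : (1 - s n)%R @[n --> \oo] --> (1 : R)%R.
  rewrite -[X in _ --> X](subr0 1%R); apply: cvgB; first exact: cvg_cst.
  exact: cvg_harmonic.
pose q n m := (\sum_(i < m) (1 - s n) ^+ i)%R.
have qE n m : q n m = (n.+1%:R * (1 - (1 - s n) ^+ m))%R.
  rewrite -opprB subrX1 -/(q n m) addrAC subrr add0r mulNr opprK.
  by rewrite mulrA /s mulfV ?mul1r.
have c1 : \int[P]_w (q n (cnt C w) * b ^+ cnt D w)%:E @[n --> \oo] -->
    \int[P]_w ((cnt C w)%:R * b ^+ cnt D w)%:E.
  apply: (@dominated_cvg_real _ _ _ _ Nul _ _ (fun w => (ereal_nat (NB w B))%:R)) => //.
  - move=> n; apply: measurable_funM; first exact: (@mcnt _ (q n)).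
    exact: (@mcnt _ (fun k => _ ^+ k)%R).
  - apply: measurable_funM; first exact: (@mcnt _ (fun k => k%:R)).
    exact: (@mcnt _ (fun k => _ ^+ k)%R).
  - exact: (poisson_count_integrable hX mB LB).
  - move=> n w /hNul fB; rewrite normrM !ger0_norm ?exprn_ge0//; last first.
      by apply: sumr_ge0 => i _; rewrite exprn_ge0//; have /andP[] := s01 n.
    apply: (@le_trans _ _ ((cnt C w)%:R)); last by rewrite ler_nat le_cnt.
    apply: (@le_trans _ _ (q n (cnt C w))).
      rewrite ler_piMr ?exprn_ile1//.
      by apply: sumr_ge0 => i _; rewrite exprn_ge0//; have /andP[] := s01 n.
    rewrite /q -[X in (_ <= X%:R)%R](card_ord (cnt C w)) -sumr_const.
    by apply: ler_sum => i _; have /andP[? ?] := s01 n; rewrite exprn_ile1.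
  move=> w _; apply: cvgM; last exact: cvg_cst.
  rewrite (_ : (cnt C w)%:R = (\sum_(i < cnt C w) 1)%R :> R); last first.
    by rewrite sumr_const card_ord.
  rewrite /q; elim: (cnt C w) => [|i IH].
    by under eq_fun do rewrite big_ord0; rewrite big_ord0; exact: cvg_cst.
  under eq_fun do rewrite big_ord_recr/=; rewrite big_ord_recr/=.
  apply: cvgD => //; suff : ((1 - s n) ^+ i)%R @[n --> \oo] --> (1 ^+ i : R)%R.
    by rewrite expr1n.
  exact: (cvg_comp _ (fun x : R => x ^+ i)%R s1 (@exprn_continuous R i 1%R)).
have c2 : (fun n => (expR (- ((1 - b) * fine (M D))) *
      (- (n.+1%:R * (expR (- fine (M C) / n.+1%:R) - 1))))%:E) @ \oo -->
    (fine (M C) * expR (- ((1 - b) * fine (M D))))%:E.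
  apply: cvg_EFin; first exact: nearW.
  have -> : (fine (M C) * expR (- ((1 - b) * fine (M D))) =
      expR (- ((1 - b) * fine (M D))) * - - fine (M C))%R by rewrite opprK mulrC.
  by apply: cvgM; [exact: cvg_cst|apply: cvgN; exact: cvg_exp_quotient].
rewrite -(cvg_lim _ c1)// -[RHS](cvg_lim _ c2)//; congr (limn _).
apply/funext => n.
have one01 : (0 <= (1 : R) <= 1)%R by rewrite ler01 lexx.
have := @integral_scaled_diff _ _ _ P n.+1%:R _ _ _ _ (iPow one01 b01) (iPow (s01 n) b01)
  (integral_marked_pow one01 b01) (integral_marked_pow (s01 n) b01).
move=> h; transitivity (\int[P]_w (n.+1%:R * (1 ^+ cnt C w * b ^+ cnt D w -
     (1 - s n) ^+ cnt C w * b ^+ cnt D w))%:E).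
  apply: eq_integral => w _; rewrite qE expr1n; congr (_%:E).
  by rewrite -mulrBl mulrA.
rewrite h; congr (_%:E); rewrite subrr mul0r add0r.
rewrite [X in (_ - expR (- (X * _ + _)))%R](_ : _ = s n)%R; last by rewrite opprB addrC subrK.
rewrite opprD expRD (_ : (- (s n * _))%R = (- fine (M C) / n.+1%:R)%R); last first.
  by rewrite /s mulrC mulNr.
ring.
Qed.

(** Picks the coefficient of b in the generating function: with
s = 1 / (n + 1), the quotient (s ^+ m - 0 ^+ m) / s tends to the indicator of
m = 1 and stays in [0, 1]. *)
Lemma integral_marked_count_single :
  \int[P]_w ((cnt C w)%:R * (cnt D w == 1%N)%:R)%:E =
  (fine (M C) * (fine (M D) * expR (- fine (M D))))%:E.
Proof.
have [Nul [mNul Nul0 hNul]] := poisson_count_fin hX mB LB.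
pose s n : R := (n.+1%:R^-1)%R.
have s01 n : (0 <= s n <= 1)%R.
  by rewrite invr_ge0 ler0n/= invf_le1// ler1n.
pose q n m := ((0 < m)%:R * s n ^+ m.-1)%R : R.
have qE n m : q n m = (n.+1%:R * (s n ^+ m - 0 ^+ m))%R.
  rewrite /q; case: m => [|m]; first by rewrite mul0r !expr0 subrr mulr0.
  by rewrite mul1r/= expr0n subr0 exprS mulrA /s mulfV ?mul1r.
have q01 n m : (0 <= q n m <= 1)%R.
  have /andP[? ?] := s01 n.
  by rewrite /q mulr_ge0 ?exprn_ge0//= mulr_ile1 ?exprn_ge0 ?exprn_ile1// lern1 leq_b1.
have c1 : \int[P]_w ((cnt C w)%:R * q n (cnt D w))%:E @[n --> \oo] -->
    \int[P]_w ((cnt C w)%:R * (cnt D w == 1%N)%:R)%:E.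
  apply: (@dominated_cvg_real _ _ _ _ Nul _ _ (fun w => (ereal_nat (NB w B))%:R)) => //.
  - by move=> n; apply: measurable_funM; [exact: (@mcnt _ (fun k => k%:R))|exact: (@mcnt _ (q n))].
  - apply: measurable_funM; first exact: (@mcnt _ (fun k => k%:R)).
    exact: (@mcnt _ (fun k => (k == 1%N)%:R)).
  - exact: (poisson_count_integrable hX mB LB).
  - move=> n w /hNul fB; have /andP[? ?] := q01 n (cnt D w).
    rewrite normrM !ger0_norm//.
    apply: (@le_trans _ _ ((cnt C w)%:R)); last by rewrite ler_nat le_cnt.
    by rewrite ler_piMr.
  move=> w _; apply: cvgM; first exact: cvg_cst.
  case: (cnt D w) => [|[|m]]; rewrite /q.
  - by under eq_fun do rewrite mul0r; exact: cvg_cst.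
  - by under eq_fun do rewrite mul1r expr0; exact: cvg_cst.
  under eq_fun do rewrite mul1r exprS.
  rewrite (_ : (m.+2 == 1%N)%:R = (0 * 0 ^+ m)%R :> R); last by rewrite mul0r.
  apply: cvgM; first exact: cvg_harmonic.
  exact: (cvg_comp _ (fun x : R => x ^+ m)%R (@cvg_harmonic R) (@exprn_continuous R m 0%R)).
have c2 : (fun n => (fine (M C) * (expR (- fine (M D)) *
      (n.+1%:R * (expR (fine (M D) / n.+1%:R) - 1))))%:E) @ \oo -->
    (fine (M C) * (fine (M D) * expR (- fine (M D))))%:E.
  apply: cvg_EFin; first exact: nearW.
  rewrite (mulrC (fine (M D)) (expR _)).
  apply: cvgM; first exact: cvg_cst.
  by apply: cvgM; [exact: cvg_cst|exact: cvg_exp_quotient].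
rewrite -(cvg_lim _ c1)// -[RHS](cvg_lim _ c2)//; congr (limn _).
apply/funext => n.
have z01 : (0 <= (0 : R) <= 1)%R by rewrite ler01 lexx.
have iC (b : R) : (0 <= b <= 1)%R ->
    P.-integrable setT (EFin \o (fun w => (cnt C w)%:R * b ^+ cnt D w)%R).
  move=> b01; have /andP[b0 b1] := b01; apply/integrableP; split.
    apply/measurable_EFinP; apply: measurable_funM; first exact: (@mcnt _ (fun k => k%:R)).
    exact: (@mcnt _ (fun k => b ^+ k)%R).
  rewrite (eq_integral (fun w => ((cnt C w)%:R * b ^+ cnt D w)%:E)).
    by rewrite integral_marked_count_pow// ltry.
  by move=> w _; rewrite /= ger0_norm// mulr_ge0// exprn_ge0.
have := @integral_scaled_diff _ _ _ P n.+1%:R _ _ _ _ (iC _ (s01 n)) (iC _ z01)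
  (integral_marked_count_pow (s01 n)) (integral_marked_count_pow z01).
move=> h; transitivity (\int[P]_w (n.+1%:R * ((cnt C w)%:R * s n ^+ cnt D w -
     (cnt C w)%:R * 0 ^+ cnt D w))%:E).
  apply: eq_integral => w _; rewrite qE; congr (_%:E).
  by rewrite -mulrBr mulrCA.
rewrite h; congr (_%:E); rewrite subr0 mul1r.
rewrite (_ : (- ((1 - s n) * _))%R = (- fine (M D) + fine (M D) / n.+1%:R)%R); last first.
  by rewrite /s; ring.
rewrite expRD; ring.
Qed.

End two_sets.

End marked_poisson.

Local Close Scope ereal_scope.

(** * Affine maps and rotations *)

Section affine.
Context (R : realType).
Local Notation mu := (@lebesgue_measure R).

Lemma measurable_affine (a b : R) : measurable_fun setT (fun x : R => a * x + b).
Proof. by apply: measurable_funD => //; exact: measurable_funM. Qed.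

Lemma measurable_affine_preimage (a b : R) (A : set R) :
  measurable A -> measurable ((fun x : R => a * x + b) @^-1` A).
Proof.
by move=> mA; rewrite -[X in measurable X]setTI; exact: measurable_affine.
Qed.

(* Both sides are measures that agree on half-open intervals. *)
Let affine_pos (a b : R) (A : set R) : 0 < a -> measurable A ->
  mu ((fun x : R => a * x + b) @^-1` A) = (a^-1%:E * mu A)%E.
Proof.
move=> a0 mA; have a0' : 0 <= a by exact: ltW.
have an0 : a != 0 by rewrite gt_eqF.
pose f : R -> measurableTypeR R := fun x => a * x + b.
have mf : measurable_fun setT f by exact: measurable_affine.
pose pf : {measure set (measurableTypeR R) -> \bar R} :=
  measure_function_pushforward__canonical__measure_function_Measure mu mf.
pose m : {measure set (measurableTypeR R) -> \bar R} := mscale (NngNum a0') pf.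
have E : mu A = m A.
  apply: lebesgue_measure_unique mA => _ [[l r]] /= _ <-.
  rewrite /m /mscale/= /pushforward/=.
  rewrite (_ : _ @^-1` _ = `](l - b) / a, (r - b) / a]%classic); last first.
    apply/seteqP; split => x /=; rewrite !in_itv/= /f ltr_pdivrMr// ler_pdivlMr//;
    by rewrite ltrBlDr lerBrDr [x * a]mulrC.
  rewrite !lebesgue_measure_itv/= !lte_fin ltr_pM2r ?invr_gt0// ltrD2r.
  case: ifPn => _; last by rewrite mule0.
  by rewrite -!EFinB -EFinM; congr (_%:E); field.
rewrite E /m /mscale/= /pushforward/= muleA -EFinM mulVf// mul1e//.
Qed.

Lemma lebesgue_affine (a b : R) (A : set R) : a != 0 -> measurable A ->
  mu ((fun x : R => a * x + b) @^-1` A) = (`|a|^-1%:E * mu A)%E.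
Proof.
move=> a0 mA; have [ap|an|a00] := ltgtP 0 a.
- by rewrite gtr0_norm// affine_pos.
- rewrite ltr0_norm// -(@affine_pos (- a) b)// ?oppr_gt0//.
  rewrite -[RHS]lebesgue_measureN; last exact: measurable_affine_preimage.
  rewrite /pushforward; congr (mu _); apply/seteqP; split => x /=;
  by rewrite mulrNN.
- by rewrite -a00 eqxx in a0.
Qed.

Lemma ge0_integral_affine (a b : R) (f : R -> \bar R) : a != 0 ->
  measurable_fun setT f -> (forall x, 0 <= f x)%E ->
  (\int[mu]_x f (a * x + b)%R = `|a|^-1%:E * \int[mu]_x f x)%E.
Proof.
move=> a0 mf f0; have a1 : 0 <= `|a|^-1 by rewrite invr_ge0.
pose g : R -> measurableTypeR R := fun x => a * x + b.
have mg : measurable_fun setT g by exact: measurable_affine.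
transitivity
  (\int[measure_function_pushforward__canonical__measure_function_Measure mu mg]_x f x)%E.
  by rewrite ge0_integral_pushforward.
transitivity (\int[mscale (NngNum a1) mu]_x f x)%E; last first.
  by rewrite ge0_integral_mscale.
by apply: eq_measure_integral => A mA _; exact: lebesgue_affine.
Qed.

End affine.

Section rotation.
Context (R : realType).
Local Notation mu := (@lebesgue_measure R).
Local Open Scope ereal_scope.

(** For c != 0 a rotation is a product of two shears and a diagonal map, each of
which is treated by Fubini and the affine change of variables. *)
Lemma ge0_integral_rotation (c s : R) (F : R * R -> \bar R) :
  c != 0%R -> (c ^+ 2 + s ^+ 2 = 1)%R ->
  measurable_fun setT F -> (forall z, 0 <= F z) ->
  \int[mu \x mu]_z F (c * z.1 + s * z.2, c * z.2 - s * z.1)%R = \int[mu \x mu]_z F z.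
Proof.
move=> c0 cs mF F0.
have ac : `|c|%R != 0%R by rewrite normr_eq0.
have m1 (a b : R) : measurable_fun setT (fun z : R * R => a * z.1 + b * z.2)%R.
  by apply: measurable_funD; apply: measurable_funM.
have mFp (a b a' b' : R) : measurable_fun setT
    (fun z : R * R => F (a * z.1 + b * z.2, a' * z.1 + b' * z.2)%R).
  by apply: measurableT_comp => //; apply: measurable_fun_pair; exact: m1.
have rotE (z : R * R) : F (c * z.1 + s * z.2, c * z.2 - s * z.1)%R =
    F (c * z.1 + s * z.2, (- s) * z.1 + c * z.2)%R.
  by congr (F (_, _)); rewrite mulNr addrC.
under eq_integral do rewrite rotE.
rewrite fubini_tonelli2//; last exact: mFp.
pose G (z : R * R) := F (1 * z.1 + 0 * z.2, (- (s / c)) * z.1 + c^-1 * z.2)%R.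
have mG : measurable_fun setT G by exact: mFp.
transitivity (\int[mu]_y (`|c|^-1%:E * \int[mu]_x G (x, y))).
  apply: eq_integral => y _; rewrite /fubini_G/=.
  rewrite -(@ge0_integral_affine _ c (s * y))//; last 2 first.
  - exact: measurable_fun_pair1.
  - by move=> x; exact: F0.
  apply: eq_integral => x _; rewrite /G/=; congr (F (_, _)); first by rewrite mul1r mul0r addr0.
  apply: (mulfI c0).
  transitivity (- s * (c * x) + (c ^+ 2 + s ^+ 2 - s ^+ 2) * y)%R; first by ring.
  by rewrite cs; field.
rewrite ge0_integralZl_EFin//; last 2 first.
- by move=> y _; apply: integral_ge0 => x _; exact: F0.
- apply: (@measurable_fun_fubini_tonelli_G _ _ _ _ _ mu G) => // z; exact: F0.
have -> : \int[mu]_y \int[mu]_x G (x, y) = \int[mu \x mu]_z G z.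
  by rewrite fubini_tonelli2// => z; exact: F0.
rewrite fubini_tonelli1//; last by move=> z; exact: F0.
transitivity (`|c|^-1%:E * \int[mu]_x (`|c|%:E * \int[mu]_y F (x, y))).
  congr (_ * _); apply: eq_integral => x _; rewrite /fubini_F/=.
  have ci : c^-1%R != 0%R by rewrite invr_eq0.
  rewrite [in RHS](_ : `|c| = `|c^-1|^-1)%R; last by rewrite normfV invrK.
  rewrite -(@ge0_integral_affine _ c^-1 (- (s / c) * x))//; last first.
    exact: measurable_fun_pair2.
  by apply: eq_integral => y _; rewrite /G/= mul1r mul0r addr0 [(_ * y + _)%R]addrC.
rewrite ge0_integralZl_EFin//; last 2 first.
- by move=> y _; apply: integral_ge0 => x _; exact: F0.
- apply: (@measurable_fun_fubini_tonelli_F _ _ _ _ _ mu F) => // z; exact: F0.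
by rewrite muleA -EFinM mulVf// mul1e fubini_tonelli1.
Qed.

Lemma lebesgue2_rotation (c s : R) (S : set (R * R)) :
  c != 0%R -> (c ^+ 2 + s ^+ 2 = 1)%R -> measurable S ->
  (mu \x mu) [set z | S (c * z.1 + s * z.2, c * z.2 - s * z.1)%R] = (mu \x mu) S.
Proof.
move=> c0 cs mS.
pose r (z : R * R) := (c * z.1 + s * z.2, c * z.2 - s * z.1)%R.
have mr : measurable_fun setT r.
  apply: measurable_fun_pair; first by apply: measurable_funD; apply: measurable_funM.
  by apply: measurable_funB; apply: measurable_funM.
have mrS : measurable (r @^-1` S) by rewrite -[X in measurable X]setTI; exact: mr.
rewrite -[LHS]/((mu \x mu) (r @^-1` S)).
rewrite -[r @^-1` S]setIT -integral_indic// -[S in RHS]setIT -integral_indic//.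
rewrite -(@ge0_integral_rotation c s (fun z => (\1_S z)%:E))//.
exact/measurable_EFinP.
Qed.

End rotation.

(** * Area of a disc *)

Section disc.
Context (R : realType).
Local Notation mu := (@lebesgue_measure R).

Lemma derivable_LRcontinuous (F : R -> R) (a b : R) :
  (forall x, derivable F x 1) -> derivable_oo_LRcontinuous F a b.
Proof.
move=> dF.
have cF x : {for x, continuous F} by apply: differentiable_continuous; exact/derivable1_diffP.
split; first by move=> x _; exact: dF.
- exact/cvg_at_right_filter/cF.
- exact/cvg_at_left_filter/cF.
Qed.

(** The substitution x = sin t turns the integrand into cos^2 t. *)
Lemma integral_semicircle :
  (\int[mu]_(x in `[(-1)%R, 1%R]) (Num.sqrt (1 - x ^+ 2))%:E = (pi / 2)%:E)%E.
Proof.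
have p0 : 0 < pi :> R := pi_gt0 R.
have dsin x : derivable (@sin R) x 1 by [].
have sin'E : (@sin R)^`()%classic = @cos R.
  by apply/funext => x; rewrite derive1E; apply: derive_val.
have -> : `[(-1)%R, 1%R]%classic = `[sin (- (pi / 2)), sin (pi / 2 : R)]%classic.
  by rewrite sinN sin_pihalf.
rewrite integration_by_substitution_increasing; first last.
- apply: continuous_subspaceT => x.
  apply: (@continuous_comp _ _ _ (fun x : R => 1 - x ^+ 2) Num.sqrt); last exact: sqrt_continuous.
  by apply: cvgB; [exact: cvg_cst|exact: exprn_continuous].
- exact: derivable_LRcontinuous.
- rewrite sin'E; apply/cvg_ex; exists (cos (pi / 2)); apply: cvg_at_left_filter.
  exact: continuous_cos.
- rewrite sin'E; apply/cvg_ex; exists (cos (- (pi / 2))); apply: cvg_at_right_filter.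
  exact: continuous_cos.
- by rewrite sin'E => x _; exact: continuous_cos.
- by move=> x y xI yI xy; rewrite ltr_sin.
- by lra.
pose F (t : R) := (t + sin t * cos t) / 2.
have dF (t : R) : is_derive t 1 F (cos t ^+ 2).
  rewrite /F; apply: is_derive_eq; rewrite /GRing.scale/=.
  have := cos2Dsin2 t; lra.
transitivity (\int[mu]_(x in `[(- (pi / 2))%R, (pi / 2)%R]) (cos x ^+ 2)%:E)%E.
  apply: eq_integral => x; rewrite inE/= in_itv/= => /andP[x1 x2].
  have c0 : 0 <= cos x by apply: cos_ge0_pihalf; rewrite x1 x2.
  rewrite sin'E; congr (_%:E); transitivity (Num.sqrt (1 - sin x ^+ 2) * cos x) => //.
  rewrite (_ : 1 - sin x ^+ 2 = cos x ^+ 2); last by have := cos2Dsin2 x; lra.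
  by rewrite sqrtr_sqr ger0_norm// expr2.
rewrite (@continuous_FTC2 _ _ F).
- rewrite /F cosN cos_pihalf !mulr0 !addr0 -EFinB; congr (_%:E); lra.
- by lra.
- apply: continuous_subspaceT => x.
  apply: (@continuous_comp _ _ _ (@cos R) (fun x : R => x ^+ 2)); first exact: continuous_cos.
  exact: exprn_continuous.
- by apply: derivable_LRcontinuous => x.
- by move=> x _; rewrite derive1E derive_val.
Qed.

(** The sections are intervals of length 2 sqrt (h^2 - x^2), and the area of the
unit half-disc is [integral_semicircle]. *)
Lemma lebesgue2_disc (h : R) (a : R * R) : 0 <= h ->
  ((mu \x mu) [set x | ((x.1 + a.1) ^+ 2 + (x.2 + a.2) ^+ 2 < h ^+ 2)%R] =
   (pi * h ^+ 2)%:E)%E.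
Proof.
move=> h0; have [->|hn0] := eqVneq h 0.
  rewrite expr0n/= mulr0 (_ : [set _ | _] = set0) ?measure0//.
  apply/seteqP; split => // x /=; rewrite ltNge => /negP; apply.
  by rewrite addr_ge0// sqr_ge0.
have hp : 0 < h by rewrite lt_neqAle eq_sym hn0.
pose w x := Num.sqrt (h ^+ 2 - (x + a.1) ^+ 2).
transitivity (\int[mu]_x (2 * w x)%:E)%E.
  apply: eq_integral => x _ /=.
  rewrite (_ : xsection _ _ = `]- a.2 - w x, - a.2 + w x[%classic).
    rewrite lebesgue_measure_itv/= lte_fin.
    have w0 : 0 <= w x by exact: sqrtr_ge0.
    case: ifPn => [_|]; first by rewrite -EFinB; congr (_%:E); ring.
    rewrite -leNgt => ww; rewrite (_ : w x = 0) ?mulr0//; lra.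
  apply/seteqP; split => y; rewrite /xsection/= in_itv/= inE/=.
    move=> xy; have : `|y + a.2| < w x.
      rewrite -sqrtr_sqr ltr_sqrt; last by have := sqr_ge0 (y + a.2); lra.
      lra.
    by rewrite ltr_norml => /andP[? ?]; apply/andP; split; lra.
  move=> /andP[y1 y2]; have : `|y + a.2| < w x.
    by rewrite ltr_norml; apply/andP; split; lra.
  rewrite -sqrtr_sqr => yw.
  have : 0 < w x by apply: le_lt_trans yw; exact: sqrtr_ge0.
  rewrite sqrtr_gt0 => hw; move: yw; rewrite ltr_sqrt// => ?; lra.
pose f x : R := 2 * Num.sqrt (h ^+ 2 - x ^+ 2).
have mf : measurable_fun setT f.
  apply: measurable_funM => //; apply: measurableT_comp; last first.
    by apply: measurable_funB => //; exact: measurable_funX.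
  by apply: continuous_measurable_fun => x; exact: sqrt_continuous.
have mf' : measurable_fun setT (EFin \o f) by exact/measurable_EFinP.
have f0 x : (0 <= (EFin \o f) x)%E by rewrite lee_fin mulr_ge0// sqrtr_ge0.
transitivity (\int[mu]_x (f x)%:E)%E.
  rewrite -[LHS]mul1e -[RHS]mul1e.
  have := @ge0_integral_affine R 1 a.1 (EFin \o f) (oner_neq0 _) mf' f0.
  rewrite normr1 invr1 !mul1e => <- //.
  by apply: eq_integral => x _; rewrite /= /f /w mul1r.
transitivity (h%:E * \int[mu]_x (f (h * x + 0))%:E)%E.
  have := @ge0_integral_affine R h 0 (EFin \o f) hn0 mf' f0.
  rewrite /= => ->.
  by rewrite muleA -EFinM ger0_norm// mulfV// mul1e.
transitivity (h%:E * ((2 * h)%:E * \int[mu]_(x in `[(-1)%R, 1%R]) (Num.sqrt (1 - x ^+ 2))%:E))%E.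
  congr (_ * _)%E; rewrite [in RHS]integral_mkcond -ge0_integralZl_EFin//; last 3 first.
  - by move=> x _; apply: erestrict_ge0 => y _; rewrite lee_fin sqrtr_ge0.
  - apply/(measurable_restrictT _ _).1 => //; apply: measurable_funTS.
    apply/measurable_EFinP; apply: measurableT_comp; last first.
      by apply: measurable_funB => //; exact: measurable_funX.
    by apply: continuous_measurable_fun => x; exact: sqrt_continuous.
  - by rewrite mulr_ge0.
  apply: eq_integral => x _; rewrite /f addr0 patchE.
  rewrite (_ : h ^+ 2 - (h * x) ^+ 2 = h ^+ 2 * (1 - x ^+ 2)); last by ring.
  rewrite sqrtrM ?sqr_ge0// sqrtr_sqr ger0_norm//.
  case: ifPn => [_|]; first by rewrite -EFinM; congr (_%:E); ring.
  rewrite notin_setE/= in_itv/= => /negP; rewrite negb_and -!ltNge => xo.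
  rewrite ler0_sqrtr ?mulr0 ?mule0//; case/orP: xo => ?; nra.
rewrite integral_semicircle -!EFinM; congr (_%:E); by field.
Qed.

End disc.

(** * Geometry and intensity of a moving point *)

Section angle.
Context (R : realType).
Local Notation mu := (@lebesgue_measure R).
Local Notation U := (uniform_prob (ltNpi R)).

(** Eliminating sin t between the equation and cos^2 t + sin^2 t = 1 leaves a
quadratic equation for cos t. *)
Lemma finite_cos_sin_level (p q r : R) : (p != 0) || (q != 0) ->
  finite_set ([set t | p * cos t + q * sin t = r] `&` `[- pi, pi]).
Proof.
move=> pq0.
have D0 : 0 < p ^+ 2 + q ^+ 2.
  by case/orP: pq0 => ?; [apply: ltr_pwDl|apply: ltr_wpDl]; rewrite ?sqr_ge0// exprn_even_gt0.
set D := p ^+ 2 + q ^+ 2 in D0.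
pose e := Num.sqrt ((p * r) ^+ 2 - D * (r ^+ 2 - q ^+ 2)).
pose k1 := (p * r + e) / D; pose k2 := (p * r - e) / D.
apply: (@sub_finite_set _ _ [set acos k1; - acos k1; acos k2; - acos k2]).
  move=> t [/= E]; rewrite in_itv/= => /andP[t1 t2].
  have cs := cos2Dsin2 t.
  have sq : (D * cos t - p * r) ^+ 2 = (p * r) ^+ 2 - D * (r ^+ 2 - q ^+ 2).
    have E2 : q * sin t = r - p * cos t by rewrite -E; ring.
    have : (q * sin t) ^+ 2 = (r - p * cos t) ^+ 2 by rewrite E2.
    have -> : (q * sin t) ^+ 2 = q ^+ 2 * (1 - cos t ^+ 2) by rewrite -cs; ring.
    move=> H; apply/eqP; rewrite -subr_eq0.
    have -> : (D * cos t - p * r) ^+ 2 - ((p * r) ^+ 2 - D * (r ^+ 2 - q ^+ 2)) =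
        D * ((r - p * cos t) ^+ 2 - q ^+ 2 * (1 - cos t ^+ 2)) by rewrite /D; ring.
    by rewrite H subrr mulr0.
  have kk : cos t = k1 \/ cos t = k2.
    have : `|D * cos t - p * r| = e by rewrite /e -sq sqrtr_sqr.
    have Dn : D != 0 by rewrite gt_eqF.
    case: (ler0P (D * cos t - p * r)) => _ H; [right|left];
      by rewrite /k1 /k2 -H; field.
  have tt : t = acos (cos t) \/ t = - acos (cos t).
    have [t0|t0] := leP 0 t.
      by left; rewrite cosK// in_itv/= t0.
    by right; rewrite -cosN cosK ?opprK// in_itv/= oppr_ge0 ltW// lerNl.
  case: kk tt => -> [] ->; [left;left;left|left;left;right|left;right|right] => //.
by rewrite !finite_setU; do !split; exact: finite_set1.
Qed.

Lemma uniform_cos_sin_level (p q r : R) : (p != 0) || (q != 0) ->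
  U [set t | p * cos t + q * sin t = r] = 0%E.
Proof.
move=> pq0; have F := finite_cos_sin_level r pq0.
have cF := finite_set_countable F.
have F0 := countable_lebesgue_measure0 cF.
transitivity (U ([set t | p * cos t + q * sin t = r] `&` `[- pi, pi])).
  by rewrite /uniform_prob integral_uniform_pdf.
move/null_content_dominatesP: (dominates_uniform_prob (ltNpi R)); apply => //.
by apply: countable_measurable => // x; exact: measurable_set1.
Qed.

End angle.

Section moving_point.
Context (R : realType).
Local Notation mu := (@lebesgue_measure R).
Local Notation U := (uniform_prob (ltNpi R)).
Variables (lambda v : R) (hlambda : 0 < lambda) (hv : 0 < v).

(** Named in order to carry the structure of a sigma-finite measure. *)
Definition plane_intensity : set (R * R) -> \bar R :=
  mscale (NngNum (ltW hlambda)) (mu \x mu)%E.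

Lemma plane_intensityE A : plane_intensity A = (lambda%:E * (mu \x mu) A)%E.
Proof. by []. Qed.

Let plane_intensity0 : plane_intensity set0 = 0%E.
Proof. exact: measure0. Qed.

Let plane_intensity_ge0 A : (0 <= plane_intensity A)%E.
Proof. exact: measure_ge0. Qed.

Let plane_intensity_sigma_additive : semi_sigma_additive plane_intensity.
Proof.
exact: (@measure_semi_sigma_additive _ _ _ (mscale (NngNum (ltW hlambda)) (mu \x mu)%E)).
Qed.

HB.instance Definition _ := isMeasure.Build _ _ _ plane_intensity
  plane_intensity0 plane_intensity_ge0 plane_intensity_sigma_additive.

Let plane_intensity_sigma_finite : sigma_finite setT plane_intensity.
Proof.
pose I n : set R := `[- n%:R, n%:R]%classic.
exists (fun n => I n `*` I n).
  apply/seteqP; split => // -[x y] _.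
  exists (Num.truncn (`|x| + `|y|)).+1 => //=; rewrite /I/= !in_itv/= -!ler_norml.
  have := truncnS_gt (`|x| + `|y|); have := normr_ge0 x; have := normr_ge0 y.
  by move=> *; split; lra.
move=> n; split; first by apply: measurableX; exact: measurable_itv.
rewrite plane_intensityE product_measure1E; [|exact: measurable_itv..].
have Iy : (mu (I n) < +oo)%E.
  by rewrite /I lebesgue_measure_itv/=; case: ifP => _; rewrite -?EFinB ?ltry.
apply: lte_mul_pinfty; rewrite ?lee_fin ?ltW//.
by apply: lte_mul_pinfty => //; rewrite ge0_fin_numE.
Qed.

HB.instance Definition _ := Measure_isSigmaFinite.Build _ _ _ plane_intensity
  plane_intensity_sigma_finite.

(** Named in order to carry the structure of a probability on R. *)
Definition angle_law : set R -> \bar R := U.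

Let angle_law0 : angle_law set0 = 0%E.
Proof. exact: measure0. Qed.

Let angle_law_ge0 A : (0 <= angle_law A)%E.
Proof. exact: measure_ge0. Qed.

Let angle_law_sigma_additive : semi_sigma_additive angle_law.
Proof. exact: (@measure_semi_sigma_additive _ _ _ (uniform_prob (ltNpi R))). Qed.

HB.instance Definition _ := isMeasure.Build _ _ _ angle_law
  angle_law0 angle_law_ge0 angle_law_sigma_additive.

Let angle_law_setT : angle_law setT = 1%:E.
Proof. exact: probability_setT. Qed.

HB.instance Definition _ := Measure_isProbability.Build _ _ _ angle_law angle_law_setT.

Local Notation M := (plane_intensity \x angle_law)%E.

(** The time at which a point starting at z.1 with heading z.2 and speed v is at
the foot of the perpendicular from the origin to its trajectory. *)
Definition foot (z : R * R * R) : R := - (cos z.2 * z.1.1 + sin z.2 * z.1.2) / v.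

Definition miss (z : R * R * R) : R := `|cos z.2 * z.1.2 - sin z.2 * z.1.1|.

Definition sqdist (t : R) (z : R * R * R) : R :=
  (z.1.1 + v * t * cos z.2) ^+ 2 + (z.1.2 + v * t * sin z.2) ^+ 2.

Lemma sqdistE t z : sqdist t z = miss z ^+ 2 + (v * (t - foot z)) ^+ 2.
Proof.
rewrite /sqdist /miss /foot real_normK ?num_real// mulrBr mulrCA mulfV ?gt_eqF// mulr1.
have cs := cos2Dsin2 z.2; move: (cos _) (sin _) cs => c s cs.
have s2 : s ^+ 2 = 1 - c ^+ 2 by rewrite -cs; ring.
by ring: s2.
Qed.

Lemma measurable_coords :
  [/\ measurable_fun setT (fun z : R * R * R => z.1.1),
      measurable_fun setT (fun z : R * R * R => z.1.2),
      measurable_fun setT (fun z : R * R * R => cos z.2) &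
      measurable_fun setT (fun z : R * R * R => sin z.2)].
Proof.
split.
- by apply: measurableT_comp; [exact: measurable_fst|exact: measurable_fst].
- by apply: measurableT_comp; [exact: measurable_snd|exact: measurable_fst].
- apply: measurableT_comp; last exact: measurable_snd.
  exact: (continuous_measurable_fun (@continuous_cos R)).
- apply: measurableT_comp; last exact: measurable_snd.
  exact: (continuous_measurable_fun (@continuous_sin R)).
Qed.

Lemma measurable_foot : measurable_fun setT foot.
Proof.
have [? ? ? ?] := measurable_coords.
apply: measurable_funM => //; apply: measurable_funN.
by apply: measurable_funD; apply: measurable_funM.
Qed.

Lemma measurable_miss : measurable_fun setT miss.
Proof.
have [? ? ? ?] := measurable_coords.
apply: measurableT_comp => //.
by apply: measurable_funB; apply: measurable_funM.
Qed.

Lemma measurable_sqdist t : measurable_fun setT (sqdist t).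
Proof.
have [? ? ? ?] := measurable_coords.
by apply: measurable_funD; apply: measurable_funX; apply: measurable_funD => //;
  apply: measurable_funM.
Qed.

Let measureM S : measurable S ->
  M S = (\int[angle_law]_y plane_intensity (ysection S y))%E.
Proof.
move=> mS; rewrite -[S in LHS]setIT -integral_indic//.
rewrite fubini_tonelli2//; last exact/measurable_EFinP.
apply: eq_integral => y _; rewrite /fubini_G/=.
transitivity (\int[plane_intensity]_x (\1_(ysection S y) x)%:E)%E.
  by apply: eq_integral => x _; rewrite !indicE /ysection mem_setE.
by rewrite integral_indic ?setIT//; exact: measurable_ysection.
Qed.

(** For every heading, the section is a disc of radius h. *)
Lemma marked_intensity_ball t h : 0 <= h ->
  M [set z | sqdist t z < h ^+ 2] = (lambda * (pi * h ^+ 2))%:E.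
Proof.
move=> h0; have mS : measurable [set z | sqdist t z < h ^+ 2].
  rewrite (_ : [set z | _] = (fun z => sqdist t z < h ^+ 2) @^-1` [set true]); last first.
    by apply/seteqP; split => z.
  rewrite -[X in measurable X]setTI; apply: measurable_fun_ltr => //.
  exact: measurable_sqdist.
rewrite measureM// (eq_integral (cst (lambda * (pi * h ^+ 2))%:E)).
  by rewrite integral_cst//= probability_setT mule1.
move=> y _; rewrite plane_intensityE /=.
have -> : ysection [set z | sqdist t z < h ^+ 2] y =
  [set x | ((x.1 + v * t * cos y) ^+ 2 + (x.2 + v * t * sin y) ^+ 2 < h ^+ 2)%R].
  by apply/seteqP; split => x /=; rewrite /ysection/= ?inE.
by rewrite (@lebesgue2_disc R h (v * t * cos y, v * t * sin y)).
Qed.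

(** Rotating by the heading y turns - v * foot and +- miss into the two
coordinates. The factor v comes from rescaling the first coordinate to a time
and the factor 2 from the two sides of the trajectory. *)
Lemma marked_intensity_foot_miss (I J : set R) : measurable I -> measurable J ->
  (forall x, J x -> 0 <= x) ->
  (M [set z | I (foot z) /\ J (miss z)] = lambda%:E * (v%:E * mu I * (2%:E * mu J)))%E.
Proof.
move=> mI mJ J0.
have mS : measurable [set z | I (foot z) /\ J (miss z)].
  rewrite (_ : [set z | _] = (foot @^-1` I) `&` (miss @^-1` J))//.
  by apply: measurableI; rewrite -[X in measurable X]setTI;
    [exact: measurable_foot|exact: measurable_miss].
rewrite measureM//.
have vn0 : v != 0 by rewrite gt_eqF.
pose I' := (fun p : R => (- v^-1) * p + 0) @^-1` I.
pose J' := (fun q : R => `|q|) @^-1` J.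
have mI' : measurable I' by exact: measurable_affine_preimage.
have mJ' : measurable J' by rewrite -[X in measurable X]setTI; exact: normr_measurable.
have I'E : (mu I' = v%:E * mu I)%E.
  by rewrite /I' lebesgue_affine ?oppr_eq0 ?invr_eq0// normrN gtr0_norm ?invr_gt0// invrK.
have J'E : (mu J' = 2%:E * mu J)%E.
  have mJ0 : measurable (J `\ 0) by apply: measurableD => //; exact: measurable_set1.
  have -> : J' = J `|` (-%R @^-1` (J `\ 0)).
    apply/seteqP; split => x; rewrite /J' /=.
      have [x0|x0] := leP 0 x; first by rewrite ger0_norm//; left.
      rewrite ltr0_norm// => Jx; right; split => //=.
      by move/eqP; rewrite oppr_eq0 lt_eqF.
    move=> [Jx|[Jx _]]; first by rewrite ger0_norm//; exact: J0.
    by rewrite ler0_norm// -oppr_ge0; exact: J0.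
  rewrite measureU//; last 2 first.
  - by rewrite -[X in measurable X]setTI; exact: oppr_measurable.
  - rewrite -subset0 => x [/J0 x0 [/J0]]; rewrite oppr_ge0 => x1 /=.
    by apply; apply/eqP; rewrite oppr_eq0 eq_le x0 x1.
  have H : mu (-%R @^-1` (J `\ 0)) = mu J.
    transitivity (mu (J `\ 0)); first exact: lebesgue_measureN.
    have {2}-> : J = (J `\ 0) `|` (J `&` [set 0]) by rewrite setUC setUIDK.
    rewrite measureU0//; first by apply: measurableI => //; exact: measurable_set1.
    by apply: subset_measure0 (lebesgue_measure_set1 (0 : R)) => //; exact: measurableI.
  by rewrite [X in (_ + X)%E](H : _) -mule2n mule_natl.
transitivity (\int[angle_law]_y cst (lambda%:E * (v%:E * mu I * (2%:E * mu J))) y)%E; last first.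
  by rewrite integral_cst//= probability_setT mule1.
(* The decomposition of a rotation into shears excludes vertical headings. *)
have nullc : angle_law [set y | cos y = 0] = 0%E.
  rewrite -[RHS](@uniform_cos_sin_level R 1 0 0) ?oner_eq0//; congr (U _).
  by apply/seteqP; split => y /=; rewrite mul1r mul0r addr0.
apply: ge0_ae_eq_integral => //.
- by apply: measurable_fun_ysection; rewrite ?inE.
- by move=> y _; rewrite !mule_ge0// lee_fin ltW.
exists [set y | cos y = 0]; split => //.
  have := continuous_measurable_fun (@continuous_cos R) measurableT (measurable_set1 0).
  by rewrite setTI.
move=> y /= ny; apply: contrapT => /eqP c0; apply: ny => _.
rewrite plane_intensityE; congr (_ * _)%E.
rewrite (_ : ysection _ _ =
    [set x | (I' `*` J') (cos y * x.1 + sin y * x.2, cos y * x.2 - sin y * x.1)]).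
  rewrite lebesgue2_rotation//; last exact: measurableX.
    by transitivity (mu I' * mu J')%E; [exact: product_measure1E|rewrite I'E J'E].
  by rewrite cos2Dsin2.
have footE p : - v^-1 * p + 0 = - p / v by rewrite addr0 !mulNr mulrC.
by apply/seteqP; split => x /=; rewrite /ysection/= ?inE/= /I' /J' /foot /miss/= footE.
Qed.

End moving_point.

(** * Coincidences of probability zero *)

Section null_events.
Context (R : realType) d (Omega : measurableType d) (P : probability Omega R).
Variables (lambda v : R) (hlambda : 0 < lambda) (hv : 0 < v).
Variables (X : nat -> {RV P >-> (R * R)%type}) (Theta : nat -> {RV P >-> R}).
Hypothesis hX : poisson_point_process P (plane_intensity hlambda)
  (fun i => X i : Omega -> R * R).
Hypothesis hU : forall i (A : set R), measurable A ->
  distribution P (Theta i) A = angle_law A.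
Hypothesis hiid : mutually_independent P (fun i => Theta i : Omega -> R).
Hypothesis hindep : independent_sigma P
  (sigma_family (fun i => X i : Omega -> R * R))
  (sigma_family (fun i => Theta i : Omega -> R)).

Local Notation Z := (marked X Theta).
Local Notation G j := (cylinders_without (base_sigma X) Theta j).

(** The number of stations at the origin is Poisson of mean 0. *)
Lemma station_off_origin i : P.-negligible [set w | X i w = (0, 0)].
Proof.
pose O : set (R * R) := [set 0] `*` [set 0].
have mO : measurable O by apply: measurableX; exact: measurable_set1.
have LO : plane_intensity hlambda O = 0%E.
  rewrite plane_intensityE product_measure1E ?mule_eq0; try exact: measurable_set1.
  by have := lebesgue_measure_set1 (0 : R) => /= ->; rewrite mul0e mule0.
pose N0 := [set w | point_measure R (fun i => X i : Omega -> R * R) w O = (0%:R : R)%:E].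
have mN0 : measurable N0.
  rewrite -[X in measurable X]setTI.
  have mXi i0 : measurable_fun setT (X i0 : Omega -> R * R) by [].
  have := measurable_point_measure mXi mO measurableT (emeasurable_set1 ((0%:R : R)%:E)).
  by rewrite !setTI.
exists (~` N0); split; first exact: measurableC.
  rewrite probability_setC// (_ : P N0 = 1%E) ?subee//.
  have := hX.1 O 0%N mO; rewrite LO ltry => /(_ erefl) /= ->.
  by rewrite oppr0 expR0 expr0 fact0 divr1 mulr1.
move=> w /= Xi; rewrite /N0 /= => H.
have : (\sum_(0 <= k < i.+1) (X k w \in O)%:R%:E <= (0%:R : R)%:E)%E.
  by rewrite -H point_measureE; apply: nneseries_lim_ge => k _ _; rewrite lee_fin.
rewrite big_nat_recr//= Xi mem_set// sumEFin -EFinD lee_fin => le.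
suff : (1 : R) <= 0 by rewrite ler10.
by apply: le_trans le; rewrite lerDr sumr_ge0.
Qed.

Let mXG j i : measurable_fun setT (X i : g_sigma_algebraType (G j) -> R * R).
Proof.
move=> _ B mB; rewrite setTI; apply: sub_sigma_algebra.
apply: cylinders_without_base.
apply: sub_sigma_algebra; exists i => //; exists B => //.
by rewrite setTI.
Qed.

Let mTG j i : i != j -> measurable_fun setT (Theta i : g_sigma_algebraType (G j) -> R).
Proof.
move=> ij _ B mB; rewrite setTI; apply: sub_sigma_algebra.
by apply: cylinders_without_mark => //; exact: base_sigmaT.
Qed.

(** Freeze the positions and all headings but the j-th, and with them a and r:
as a is nonzero and X j is not the origin, the equation has finitely many
solutions Theta j in one turn. *)
Lemma heading_avoids_level j (a r : Omega -> R) :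
  measurable_fun setT (a : g_sigma_algebraType (G j) -> R) ->
  measurable_fun setT (r : g_sigma_algebraType (G j) -> R) ->
  P.-negligible [set w | a w != 0 /\
    a w * ((X j w).1 * cos (Theta j w) + (X j w).2 * sin (Theta j w)) = r w].
Proof.
move=> ma mr.
pose f (z : g_sigma_algebraType (G j) * R) :=
  a z.1 * ((X j z.1).1 * cos z.2 + (X j z.1).2 * sin z.2) - r z.1.
have mX1 : measurable_fun setT (fun z : g_sigma_algebraType (G j) * R => X j z.1).
  by apply: (measurableT_comp (@mXG j j)); exact: measurable_fst.
have mf : measurable_fun setT f.
  apply: measurable_funB; last by apply: (measurableT_comp mr); exact: measurable_fst.
  apply: measurable_funM; first by apply: (measurableT_comp ma); exact: measurable_fst.
  apply: measurable_funD; apply: measurable_funM.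
  - by apply: (measurableT_comp _ mX1); exact: measurable_fst.
  - apply: measurableT_comp; last exact: measurable_snd.
    exact: (continuous_measurable_fun (@continuous_cos R)).
  - by apply: (measurableT_comp _ mX1); exact: measurable_snd.
  - apply: measurableT_comp; last exact: measurable_snd.
    exact: (continuous_measurable_fun (@continuous_sin R)).
pose S := ((fun z : g_sigma_algebraType (G j) * R => a z.1) @^-1` (~` [set 0])) `&` f @^-1` [set 0].
have mS : measurable S.
  apply: measurableI; rewrite -[X in measurable X]setTI.
    apply: (measurableT_comp ma measurable_fst) => //.
    by apply: measurableC; exact: measurable_set1.
  by apply: mf => //; exact: measurable_set1.
pose E := [set w : Omega | S (w, Theta j w)].
have mTh : measurable_fun setT (fun w : Omega => (w : g_sigma_algebraType (G j), Theta j w)).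
  apply/measurable_fun_pairP; split => //=.
  move=> _ B mB; rewrite setTI.
  have : G j `<=` measurable.
    apply: cylinders_without_measurable; exact: base_sigma_measurable.
  by move=> /(smallest_sub (@sigma_algebra_measurable _ Omega)); apply.
have mE : measurable E.
  by have := mTh measurableT _ mS; rewrite setTI.
have subE : [set w | a w != 0 /\
    a w * ((X j w).1 * cos (Theta j w) + (X j w).2 * sin (Theta j w)) = r w] `<=` E.
  by move=> w /= [/eqP a0 H]; split=> //; rewrite /f/= H subrr.
apply: (negligibleS subE).
apply/negligibleP => //.
transitivity (\int[P]_w (\1_E w)%:E)%E; first by rewrite integral_indic// setIT.
pose F (z : g_sigma_algebraType (G j) * R) := (\1_S z)%:E : \bar R.
transitivity (\int[P]_w F (w, Theta j w))%E.
  by apply: eq_integral => w _; rewrite /F !indicE; congr ((nat_of_bool _)%:R%:E).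
rewrite (@integral_freeze _ _ _ _ _ P (G j) (Theta j))//; last 4 first.
- apply: cylinders_without_measurable; exact: base_sigma_measurable.
- move=> A B; apply: cylinders_without_indep => //.
  + exact: base_sigma_measurable.
  + exact: base_sigmaI.
  + exact: base_sigma_indep.
- exact/measurable_EFinP.
- by move=> z; rewrite lee_fin.
have [Nul [mNul Nul0 NulX]] := station_off_origin j.
transitivity (\int[P]_w (cst 0 w : \bar R))%E; last exact: integral0.
apply: (ge0_integral_eq_off_null mNul Nul0) => //.
- by move=> w; apply: integral_ge0 => y _; rewrite lee_fin.
move=> w Nw; have Xn0 : ((X j w).1 != 0) || ((X j w).2 != 0).
  rewrite -negb_and; apply/negP => /andP[/eqP X1 /eqP X2]; apply: Nw; apply: NulX => /=.
  by rewrite [LHS]surjective_pairing X1 X2.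
transitivity (distribution P (Theta j) (xsection S w)).
  transitivity (\int[distribution P (Theta j)]_y (\1_(xsection S w) y)%:E)%E.
    by apply: eq_integral => y _; rewrite /F !indicE /xsection mem_setE.
  by rewrite integral_indic ?setIT//; exact: measurable_xsection.
rewrite hU; last exact: measurable_xsection.
have [a0|a0] := eqVneq (a w) 0.
  rewrite (_ : xsection _ _ = set0) ?measure0//; apply/seteqP; split => // y.
  by rewrite /xsection/= inE /S/= a0 => -[].
have aXn0 : (a w * (X j w).1 != 0) || (a w * (X j w).2 != 0).
  by rewrite !mulf_eq0 !negb_or a0.
rewrite -[RHS](uniform_cos_sin_level (r w) aXn0); congr (angle_law _).
apply/seteqP; split => y /=; rewrite /xsection/= ?inE/= /S /f/= mulrDr !mulrA.
  by move=> [_ /eqP]; rewrite subr_eq0 => /eqP.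
by move=> ->; split; [exact/eqP|rewrite subrr].
Qed.

Let mcoord j i : i != j ->
  measurable_fun setT ((fun w => foot v (Z i w)) : g_sigma_algebraType (G j) -> R) /\
  measurable_fun setT ((fun w => miss (Z i w)) : g_sigma_algebraType (G j) -> R).
Proof.
move=> ij; have mZ : measurable_fun setT (Z i : g_sigma_algebraType (G j) -> R * R * R).
  by apply/measurable_fun_pairP; split; [exact: mXG|exact: mTG].
split.
  by apply: (measurableT_comp _ mZ); exact: measurable_foot.
by apply: (measurableT_comp _ mZ); exact: measurable_miss.
Qed.

Lemma foot_neq i j : i != j -> P.-negligible [set w | foot v (Z i w) = foot v (Z j w)].
Proof.
move=> ij; have [mfi _] := mcoord ij.
have mr : measurable_fun setT ((fun w => - v * foot v (Z i w)) : g_sigma_algebraType (G j) -> R).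
  exact: measurable_funM.
apply: negligibleS (heading_avoids_level (a := cst 1) (measurable_cst _) mr).
move=> w /= E; split; first exact: oner_neq0.
by rewrite E /foot /marked/=; field; rewrite gt_eqF.
Qed.

Lemma foot_neq0 i : P.-negligible [set w | foot v (Z i w) = 0].
Proof.
apply: negligibleS (heading_avoids_level (j := i) (a := cst 1) (r := cst 0)
  (measurable_cst _) (measurable_cst _)).
move=> w /= /eqP H; split; first exact: oner_neq0.
move: H; rewrite /foot mulNr oppr_eq0 mulf_eq0 invr_eq0 (gt_eqF hv) orbF => /eqP.
by rewrite mul1r mulrC [X in _ + X]mulrC.
Qed.

(** Expanding the squared distance of station j at the time s = foot v (Z i w)
gives an equation for Theta j whose coefficient 2 * v * s vanishes only if
s = 0. *)
Lemma sqdist_neq_miss i j : i != j ->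
  P.-negligible [set w | sqdist v (foot v (Z i w)) (Z j w) = miss (Z i w) ^+ 2].
Proof.
move=> ij; have [mfi mmi] := mcoord ij.
pose a w := 2 * v * foot v (Z i w).
pose r w := miss (Z i w) ^+ 2 - (v * foot v (Z i w)) ^+ 2
  - ((X j w).1 ^+ 2 + (X j w).2 ^+ 2).
have ma : measurable_fun setT (a : g_sigma_algebraType (G j) -> R) by exact: measurable_funM.
have mr : measurable_fun setT (r : g_sigma_algebraType (G j) -> R).
  apply: measurable_funB; last first.
    apply: measurable_funD; apply: measurable_funX.
      by apply: (measurableT_comp _ (@mXG j j)); exact: measurable_fst.
    by apply: (measurableT_comp _ (@mXG j j)); exact: measurable_snd.
  by apply: measurable_funB; apply: measurable_funX => //; exact: measurable_funM.
apply: negligibleS (negligibleU (foot_neq0 i) (heading_avoids_level ma mr)).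
move=> w /= E; have [t0|t0] := eqVneq (foot v (Z i w)) 0; [by left|right].
split.
  apply: mulf_neq0; last exact: t0.
  by apply: mulf_neq0; rewrite ?pnatr_eq0// gt_eqF.
rewrite /= /r /a -E /sqdist /marked/=; have := cos2Dsin2 (Theta j w).
move: (cos _) (sin _) => c s cs.
have s2 : s ^+ 2 = 1 - c ^+ 2 by rewrite -cs; ring.
by ring: s2.
Qed.

End null_events.

(** * Discretized Mecke formula for the number of interferers *)

(** Evaluates a sum over grid cells as the integral of a discretized function. *)
Lemma sum_level_sets d (T : measurableType d) (R : realType)
    (mu : {measure set T -> \bar R}) (A : set T) (q : T -> nat) (g : nat -> R) K :
  measurable A -> measurable_fun setT q -> (forall x, A x -> (q x < K)%N) ->
  (forall b, 0 <= g b) ->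
  (\sum_(b < K) (g b)%:E * mu (A `&` q @^-1` [set nat_of_ord b]) =
   \int[mu]_(x in A) (g (q x))%:E)%E.
Proof.
move=> mA mq qK g0; pose C b := A `&` q @^-1` [set b].
have mC b : measurable (C b).
  by apply: measurableI => //; rewrite -[X in measurable X]setTI; exact: mq.
transitivity (\int[mu]_(x in A) \sum_(b < K) (g b * \1_(C b) x)%:E)%E.
  rewrite ge0_integral_sum//; last 2 first.
  - by move=> b; apply/measurable_EFinP; apply: measurable_funM.
  - by move=> b x _; rewrite lee_fin mulr_ge0.
  apply: eq_bigr => b _; under [RHS]eq_integral do rewrite EFinM.
  rewrite ge0_integralZl_EFin//; last exact/measurable_EFinP.
  by rewrite integral_indic//; congr (_ * mu _)%E; rewrite /C setIAC setIid.
apply: eq_integral => x /set_mem Ax; rewrite sumEFin; congr (_%:E).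
rewrite (bigD1 (Ordinal (qK x Ax)))//= indicE mem_set ?mulr1; last by split.
rewrite big1 ?addr0// => b bq; rewrite indicE memNset ?mulr0// => -[_ /= qb].
by move: bq; rewrite -val_eqE/= qb eqxx.
Qed.

Section grid.
Context (R : realType).

(** The grid of mesh 1 / (n + 1): [grid n x] is x rounded down, and [gridn n x]
its index. *)
Definition gridn (n : nat) (x : R) : nat := Num.truncn (n.+1%:R * x).

Definition grid (n : nat) (x : R) : R := (gridn n x)%:R / n.+1%:R.

Lemma measurable_gridn n : measurable_fun setT (gridn n).
Proof.
rewrite (_ : gridn n = @ereal_nat R \o (EFin \o (fun x => n.+1%:R * x)))//.
apply: measurableT_comp; first exact: measurable_ereal_nat.
by apply/measurable_EFinP; exact: measurable_funM.
Qed.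

Lemma grid_itv n x : 0 <= x -> grid n x <= x < grid n x + n.+1%:R^-1.
Proof.
move=> x0; have n0 : 0 < n.+1%:R :> R by rewrite ltr0n.
have /andP[h1 h2] := truncn_itv (mulr_ge0 (ltW n0) x0).
rewrite /grid ler_pdivrMr// [x * _]mulrC h1/= -[X in _ + X]mul1r -mulrDl ltr_pdivlMr//.
by rewrite mulrC natr1.
Qed.

Lemma grid_ge0 n x : 0 <= grid n x.
Proof. by rewrite /grid divr_ge0. Qed.

Lemma grid_cvg x : 0 <= x -> grid n x @[n --> \oo] --> x.
Proof.
move=> x0; apply/cvgrPdist_le => e e0; near=> n.
have /andP[h1 h2] := grid_itv n x0.
rewrite ger0_norm ?subr_ge0// lerBlDl (le_trans (ltW h2))// lerD2l.
rewrite -[leRHS]invrK lef_pV2 ?posrE ?invr_gt0//.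
rewrite (le_trans (ltW (truncnS_gt e^-1)))// ler_nat ltnS.
by near: n; exact: nbhs_infty_ge.
Unshelve. all: by end_near. Qed.

Lemma measurable_grid n : measurable_fun setT (grid n).
Proof.
apply: measurable_funM => //.
apply: (@measurableT_comp _ _ _ _ _ _ (fun k => k%:R : R)); first by move=> *.
exact: measurable_gridn.
Qed.

End grid.

Section discretization.
Context (R : realType) d (Omega : measurableType d) (P : probability Omega R).
Variables (lambda v : R) (hlambda : 0 < lambda) (hv : 0 < v).
Variables (X : nat -> {RV P >-> (R * R)%type}) (Theta : nat -> {RV P >-> R}).
Hypothesis hX : poisson_point_process P (plane_intensity hlambda)
  (fun i => X i : Omega -> R * R).
Hypothesis hU : forall i (A : set R), measurable A ->
  distribution P (Theta i) A = angle_law A.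
Hypothesis hiid : mutually_independent P (fun i => Theta i : Omega -> R).
Hypothesis hindep : independent_sigma P
  (sigma_family (fun i => X i : Omega -> R * R))
  (sigma_family (fun i => Theta i : Omega -> R)).

Local Notation mu := (@lebesgue_measure R).
Local Notation Z := (marked X Theta).
Local Notation NZ := (point_measure R (marked X Theta)).
Local Notation M := (plane_intensity hlambda \x (@angle_law R))%E.

Definition closer (t h : R) : set (R * R * R) := [set z | sqdist v t z < h ^+ 2].

(** The probability that a Poisson variable of mean lambda pi h^2 equals one. *)
Definition one_closer_prob (h : R) : R :=
  lambda * (pi * h ^+ 2) * expR (- (lambda * (pi * h ^+ 2))).

Lemma measurable_closer t h : measurable (closer t h).
Proof.
rewrite (_ : closer t h = (fun z => sqdist v t z < h ^+ 2) @^-1` [set true]); last first.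
  by apply/seteqP; split => z.
rewrite -[X in measurable X]setTI; apply: measurable_fun_ltr => //.
exact: measurable_sqdist.
Qed.

Lemma one_closer_prob_ge0 h : 0 <= one_closer_prob h.
Proof.
apply: mulr_ge0; last exact: expR_ge0.
by apply: mulr_ge0; [exact: ltW|apply: mulr_ge0; [exact: pi_ge0|exact: sqr_ge0]].
Qed.

Lemma one_closer_prob_le1 h : one_closer_prob h <= 1.
Proof.
rewrite /one_closer_prob; set y := lambda * _.
have := expR_ge1Dx y; have e0 := expR_gt0 y; rewrite expRN ler_pdivrMr// mul1r.
by move=> ?; lra.
Qed.

Lemma one_closer_prob_continuous : continuous one_closer_prob.
Proof.
have c1 : continuous (fun h : R => lambda * (pi * h ^+ 2)).
  move=> x; apply: cvgM; first exact: cvg_cst.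
  by apply: cvgM; [exact: cvg_cst|exact: exprn_continuous].
move=> x; apply: cvgM; first exact: c1.
exact: (cvg_comp _ expR (cvgN (c1 x)) (@continuous_expR R _)).
Qed.

Lemma measurable_one_closer_prob : measurable_fun setT one_closer_prob.
Proof. exact: continuous_measurable_fun one_closer_prob_continuous. Qed.

Variable m : nat.

(** During the unit time window a station moves by v at most, so only stations
starting in the box can come within distance m of the origin. *)
Definition box : set (R * R) :=
  `[- (m%:R + v), m%:R + v]%classic `*` `[- (m%:R + v), m%:R + v]%classic.

Lemma measurable_box : measurable box.
Proof. by apply: measurableX; exact: measurable_itv. Qed.

Lemma plane_intensity_box : (plane_intensity hlambda box < +oo)%E.
Proof.
rewrite plane_intensityE product_measure1E; [|exact: measurable_itv..].
have Iy : (mu `[(- (m%:R + v))%R, (m%:R + v)%R]%classic < +oo)%E.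
  by rewrite lebesgue_measure_itv/=; case: ifP => _; rewrite -?EFinB ?ltry.
apply: lte_mul_pinfty; rewrite ?lee_fin ?ltW//.
by apply: lte_mul_pinfty => //; rewrite ge0_fin_numE.
Qed.

Lemma sqdist_box t h z : 0 <= t <= 1 -> 0 <= h <= m%:R ->
  sqdist v t z <= h ^+ 2 -> box z.1.
Proof.
move=> /andP[t0 t1] /andP[h0 hm] le.
have key (x c : R) : -1 <= c <= 1 -> (x + v * t * c) ^+ 2 <= h ^+ 2 ->
    - (m%:R + v) <= x <= m%:R + v.
  move=> /andP[c0 c1] H.
  have : `|x + v * t * c| <= h by rewrite -ler_sqr ?nnegrE// real_normK ?num_real.
  rewrite ler_norml => /andP[H1 H2].
  have vt0 : 0 <= v * t by rewrite mulr_ge0// ltW.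
  have vt1 : v * t <= v by rewrite ler_piMr// ltW.
  apply/andP; split; nra.
split; rewrite /= in_itv/=; [apply: (key _ (cos z.2))|apply: (key _ (sin z.2))].
- by rewrite cos_geN1 cos_le1.
- by apply: le_trans le; rewrite /sqdist lerDl sqr_ge0.
- by rewrite sin_geN1 sin_le1.
- by apply: le_trans le; rewrite /sqdist lerDr sqr_ge0.
Qed.

Lemma miss_le_sqdist t z : miss z ^+ 2 <= sqdist v t z.
Proof. by rewrite sqdistE// lerDl sqr_ge0. Qed.

Variables (J : set R) (mJ : measurable J) (Jm : J `<=` `[0, m%:R]).

Let tcell n a : set R := `[0, 1]%classic `&` gridn n @^-1` [set a].
Let hcell n b : set R := J `&` gridn n @^-1` [set b].

(** Marked points whose foot and miss are rounded to a / (n + 1) and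
b / (n + 1). *)
Definition cell n a b : set (R * R * R) :=
  [set z | tcell n a (foot v z) /\ hcell n b (miss z)].

Let mtcell n a : measurable (tcell n a).
Proof.
apply: measurableI; first exact: measurable_itv.
by rewrite -[X in measurable X]setTI; exact: measurable_gridn.
Qed.

Let mhcell n b : measurable (hcell n b).
Proof.
apply: measurableI => //.
by rewrite -[X in measurable X]setTI; exact: measurable_gridn.
Qed.

Lemma measurable_cell n a b : measurable (cell n a b).
Proof.
rewrite (_ : cell n a b = (foot v @^-1` tcell n a) `&` (@miss R @^-1` hcell n b))//.
by apply: measurableI; rewrite -[X in measurable X]setTI;
  [exact: measurable_foot|exact: measurable_miss].
Qed.

Lemma cell_box n a b : cell n a b `<=` box `*` setT.
Proof.
move=> z [[]]; rewrite /= in_itv/= => f01 _ [/Jm]; rewrite /= in_itv/= => m0m _.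
split => //; apply: (sqdist_box f01 m0m).
by rewrite sqdistE// subrr mulr0 expr0n addr0.
Qed.

Definition gtime n (a : nat) : R := a%:R / n.+1%:R.

Let n0 n : 0 < n.+1%:R :> R. Proof. by rewrite ltr0n. Qed.

Lemma closer_box n a b : (a <= n.+1)%N -> (b <= n.+1 * m)%N ->
  closer (gtime n a) (gtime n b) `<=` box `*` setT.
Proof.
move=> an bm z /ltW le; split => //; apply: sqdist_box le.
  by rewrite divr_ge0//= ler_pdivrMr// mul1r ler_nat.
by rewrite divr_ge0//= ler_pdivrMr// -natrM ler_nat mulnC.
Qed.

(** Rounding the distance down matters here: a station of the cell is never
closer than its miss distance, which is at least b / (n + 1). *)
Lemma cell_closer_disjoint n a b : cell n a b `&` closer (gtime n a) (gtime n b) = set0.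
Proof.
rewrite -subset0 => z [[_ [/Jm]]]; rewrite /= in_itv/= => /andP[m0 _] gb.
rewrite /closer/= ltNge => /negP; apply.
apply: le_trans (miss_le_sqdist _ _); rewrite ler_sqr ?nnegrE//; last by rewrite divr_ge0.
rewrite (_ : gtime n b = grid n (miss z)); last by rewrite /grid gb.
by have /andP[] := grid_itv n m0.
Qed.

Let cnt C w := ereal_nat (NZ w C).

Let term n a b w : R :=
  (cnt (cell n a b) w)%:R * (cnt (closer (gtime n a) (gtime n b)) w == 1%N)%:R.

(** The number of stations with foot in [0, 1] and miss in J that see one closer
station, where closer is decided by the rounded foot and miss; as a sum over
cells, every term is a function of two independent counts. *)
Definition grid_sum n w : R :=
  \sum_(a < n.+2) \sum_(b < (n.+1 * m).+1) term n a b w.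

Let mcnt C (u : nat -> R) : measurable C -> measurable_fun setT (fun w => u (cnt C w)).
Proof.
move=> mC; apply: (@measurableT_comp _ _ _ _ _ _ u); first by move=> *.
apply: measurableT_comp; first exact: measurable_ereal_nat.
apply: measurable_point_measure => //; exact: measurable_marked.
Qed.

Let mterm n a b : measurable_fun setT (term n a b).
Proof.
apply: measurable_funM.
  exact: (mcnt (fun k => k%:R) (measurable_cell n a b)).
exact: (mcnt (fun k => (k == 1%N)%:R) (measurable_closer _ _)).
Qed.

Lemma measurable_grid_sum n : measurable_fun setT (grid_sum n).
Proof.
by apply: measurable_sum => a; apply: measurable_sum => b; exact: mterm.
Qed.

Let int_term n a b : (a <= n.+1)%N -> (b <= n.+1 * m)%N ->
  (\int[P]_w (term n a b w)%:E =
   (lambda * (v * 2))%:E *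
     (mu (tcell n a) * ((one_closer_prob (gtime n b))%:E * mu (hcell n b))))%E.
Proof.
move=> an bm.
rewrite (integral_marked_count_single hX hU hiid hindep measurable_box plane_intensity_box
  (measurable_cell n a b) (measurable_closer _ _) (@cell_box n a b) (closer_box an bm)
  (cell_closer_disjoint n a b)).
have hb0 : 0 <= gtime n b by rewrite divr_ge0.
rewrite (@marked_intensity_ball R lambda v hlambda _ _ hb0) /=.
have Jge0 x : hcell n b x -> 0 <= x.
  by move=> [/Jm]; rewrite /= in_itv/= => /andP[].
rewrite -/(one_closer_prob _) EFinM fineK; last first.
  rewrite ge0_fin_numE//.
  exact: (@marked_measure_fin _ _ _ _ _ (plane_intensity hlambda) (@angle_law R) _
    measurable_box plane_intensity_box _ (measurable_cell n a b) (@cell_box n a b)).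
have -> := marked_intensity_foot_miss hlambda hv (mtcell n a) (mhcell n b) Jge0.
move: (one_closer_prob _) => p; rewrite !EFinM !muleA [LHS]muleAC; congr (_ * _ * _)%E.
exact: muleAC.
Qed.

Lemma integral_grid_sum n :
  (\int[P]_w (grid_sum n w)%:E =
   (lambda * (v * 2))%:E * \int[mu]_(x in J) (one_closer_prob (grid n x))%:E)%E.
Proof.
have t0 a b w : (0 <= (term n a b w)%:E)%E by rewrite lee_fin mulr_ge0.
transitivity (\sum_(a < n.+2) \sum_(b < (n.+1 * m).+1) \int[P]_w (term n a b w)%:E)%E.
  under eq_integral do rewrite /grid_sum -sumEFin.
  rewrite ge0_integral_sum//; last 2 first.
  - by move=> a; apply/measurable_EFinP; apply: measurable_sum => b; exact: mterm.
  - by move=> a w _; rewrite lee_fin; apply: sumr_ge0 => b _; rewrite -lee_fin.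
  apply: eq_bigr => a _; under eq_integral do rewrite -sumEFin.
  rewrite ge0_integral_sum// => b; exact/measurable_EFinP/mterm.
transitivity ((lambda * (v * 2))%:E * ((\sum_(a < n.+2) 1%:E * mu (tcell n a)) *
   (\sum_(b < (n.+1 * m).+1) (one_closer_prob (gtime n b))%:E * mu (hcell n b))))%E.
  rewrite ge0_sume_distrl; last by move=> a _; rewrite mul1e.
  rewrite ge0_sume_distrr; last first.
    move=> a _; rewrite mule_ge0 ?mul1e// sume_ge0// => b _.
    by rewrite mule_ge0// lee_fin one_closer_prob_ge0.
  apply: eq_bigr => a _; rewrite mul1e ge0_sume_distrr; last first.
    by move=> b _; rewrite mule_ge0// lee_fin one_closer_prob_ge0.
  rewrite ge0_sume_distrr; last first.
    by move=> b _; rewrite !mule_ge0// lee_fin one_closer_prob_ge0.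
  by apply: eq_bigr => b _; rewrite int_term// -ltnS.
congr (_ * _)%E.
have m01 : (mu `[0%R, 1%R]%classic = 1)%E.
  by rewrite lebesgue_measure_itv/= lte_fin ltr01 oppr0 adde0.
have -> : (\sum_(a < n.+2) 1%:E * mu (tcell n a) = 1)%E.
  rewrite (@sum_level_sets _ _ _ mu `[0, 1]%classic (gridn n) (cst 1))//.
  - by rewrite (integral_cst mu (measurable_itv _) (1%R)%:E) mul1e.
  - exact: measurable_gridn.
  - move=> x /=; rewrite in_itv/= => /andP[x0 x1].
    rewrite /gridn truncn_lt_nat; last by rewrite mulr_ge0.
    by rewrite (@le_lt_trans _ _ n.+1%:R) ?ltr_nat// ler_piMr.
rewrite mul1e (@sum_level_sets _ _ _ mu J (gridn n) (fun b => one_closer_prob (gtime n b)))//.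
- exact: measurable_gridn.
- move=> x /Jm /=; rewrite in_itv/= => /andP[x0 x1].
  rewrite /gridn truncn_lt_nat; last by rewrite mulr_ge0.
  by rewrite (@le_lt_trans _ _ (n.+1 * m)%:R) ?ltr_nat// natrM ler_wpM2l.
- by move=> b; exact: one_closer_prob_ge0.
Qed.

Lemma integral_grid_sum_cvg : (\int[P]_w (grid_sum n w)%:E @[n --> \oo] -->
  (lambda * (v * 2))%:E * \int[mu]_(x in J) (one_closer_prob x)%:E)%E.
Proof.
under eq_fun do rewrite integral_grid_sum.
have Jy : (mu J < +oo)%E.
  apply: (@le_lt_trans _ _ (mu `[0%R, m%:R]%classic)).
    by apply: le_measure; rewrite ?inE//; exact: measurable_itv.
  by rewrite lebesgue_measure_itv/=; case: ifP => _; rewrite -?EFinB ltry.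
apply: cvgeZl => //.
have J0 x : J x -> 0 <= x by move=> /Jm; rewrite /= in_itv/= => /andP[].
pose f n x := one_closer_prob (grid n x) * \1_J x.
have fE (g : R -> R) : (\int[mu]_(x in J) (g x)%:E = \int[mu]_x (g x * \1_J x)%:E)%E.
  rewrite integral_mkcond; apply: eq_integral => x _; rewrite patchE indicE.
  by case: ifPn => _; rewrite ?mulr1 ?mulr0.
under eq_fun do rewrite fE; rewrite fE.
apply: (@dominated_cvg_real _ _ _ mu set0 f (fun x => one_closer_prob x * \1_J x) (\1_J)) => //.
- move=> n; apply: measurable_funM => //.
  by apply: measurableT_comp; [exact: measurable_one_closer_prob|exact: measurable_grid].
- by apply: measurable_funM => //; exact: measurable_one_closer_prob.
- exact: integrable_indic_fin.
- move=> n x _; rewrite /f ger0_norm; first by rewrite ler_piMl// one_closer_prob_le1.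
  by apply: mulr_ge0 => //; exact: one_closer_prob_ge0.
move=> x _; have [xJ|xJ] := boolP (x \in J); last first.
  rewrite /f indicE (negbTE xJ) mulr0.
  by under eq_fun do rewrite mulr0; exact: cvg_cst.
rewrite /f; apply: cvgM; last exact: cvg_cst.
apply: (cvg_comp _ one_closer_prob (grid_cvg (J0 x (set_mem xJ)))).
exact: one_closer_prob_continuous.
Qed.

(** Exactly one station is closer to the origin than station i at the closest
approach of i. *)
Definition sees_one i w : bool :=
  cnt (closer (foot v (Z i w)) (miss (Z i w))) w == 1%N.

Definition interferer_event (B : set R) i w : bool :=
  [&& 0 <= foot v (Z i w) <= 1, miss (Z i w) \in B & sees_one i w].

Definition interferer_sum (B : set R) w : \bar R :=
  (\sum_(i <oo) (interferer_event B i w)%:R%:E)%E.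

Lemma cell_memE n a b z : (z \in cell n a b) =
  [&& 0 <= foot v z <= 1, miss z \in J, a == gridn n (foot v z) & b == gridn n (miss z)].
Proof.
apply/idP/idP.
  move=> /set_mem[[f01 fa] [mz mb]]; move: f01 fa mb.
  by rewrite /preimage/= in_itv/= => -> -> ->; rewrite !eqxx mem_set.
move=> /and4P[f01 zJ /eqP fa /eqP mb]; apply/mem_set.
split; split; [by rewrite /= in_itv|by []|exact: set_mem|by []].
Qed.

Let cntE C w K : C `<=` box `*` setT -> (forall k, (K <= k)%N -> X k w \notin box) ->
  cnt C w = (\sum_(i < K) (Z i w \in C))%N.
Proof.
move=> CB hK; rewrite /cnt point_measureE (@eseries_bool_stationaryE _ _ K) ?ereal_natK//.
by move=> k /hK; apply: contraNF => /set_mem/CB[/= Xk _]; exact: mem_set.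
Qed.

(** Regroups the sum over cells as a sum over stations, each of which is in
exactly one cell. *)
Lemma grid_sum_stationary n w K : (forall k, (K <= k)%N -> X k w \notin box) ->
  grid_sum n w = \sum_(i < K) ((0 <= foot v (Z i w) <= 1) && (miss (Z i w) \in J))%:R *
    (cnt (closer (grid n (foot v (Z i w))) (grid n (miss (Z i w)))) w == 1%N)%:R.
Proof.
move=> hK; rewrite /grid_sum.
transitivity (\sum_(a < n.+2) \sum_(b < (n.+1 * m).+1) \sum_(i < K)
    (Z i w \in cell n a b)%:R *
    (cnt (closer (gtime n a) (gtime n b)) w == 1%N)%:R : R).
  apply: eq_bigr => a _; apply: eq_bigr => b _; rewrite /term.
  by rewrite (cntE (@cell_box n a b) hK) natr_sum mulr_suml.
under eq_bigr do rewrite exchange_big/=; rewrite exchange_big/=.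
apply: eq_bigr => i _; have [/andP[f01 mJi]|nA] := boolP (_ && _); last first.
  rewrite mul0r big1// => a _; rewrite big1// => b _; rewrite cell_memE andbA (negbTE nA).
  by rewrite mul0r.
have /andP[f0 f1] := f01.
have /andP[m0 m1] : 0 <= miss (Z i w) <= m%:R by have := Jm (set_mem mJi); rewrite /= in_itv.
have aK : (gridn n (foot v (Z i w)) < n.+2)%N.
  rewrite /gridn truncn_lt_nat; last by rewrite mulr_ge0.
  by rewrite (@le_lt_trans _ _ n.+1%:R) ?ltr_nat// ler_piMr.
have bK : (gridn n (miss (Z i w)) < (n.+1 * m).+1)%N.
  rewrite /gridn truncn_lt_nat; last by rewrite mulr_ge0.
  by rewrite (@le_lt_trans _ _ (n.+1 * m)%:R) ?ltr_nat// natrM ler_wpM2l.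
rewrite (bigD1 (Ordinal aK))//= [X in _ + X]big1 ?addr0; last first.
  move=> a an; rewrite big1// => b _; rewrite cell_memE.
  suff -> : (nat_of_ord a == gridn n (foot v (Z i w))) = false by rewrite !andbF mul0r.
  by apply: contraNF an => /eqP E; apply/eqP/val_inj.
rewrite (bigD1 (Ordinal bK))//= [X in _ + X]big1 ?addr0; last first.
  move=> b bn; rewrite cell_memE.
  suff -> : (nat_of_ord b == gridn n (miss (Z i w))) = false by rewrite !andbF mul0r.
  by apply: contraNF bn => /eqP E; apply/eqP/val_inj.
by rewrite cell_memE f01 mJi !eqxx.
Qed.

(** Closeness is a strict inequality between continuous functions, so it survives
rounding unless the limit is a tie. A station is never closer than itself,
whether rounded or not. *)
Lemma closer_eventually i j w :
  0 <= foot v (Z i w) ->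
  (i != j -> sqdist v (foot v (Z i w)) (Z j w) != miss (Z i w) ^+ 2) ->
  \forall n \near \oo,
    (Z j w \in closer (grid n (foot v (Z i w))) (grid n (miss (Z i w)))) =
    (Z j w \in closer (foot v (Z i w)) (miss (Z i w))).
Proof.
move=> f0 ne.
have memE t h z : (z \in closer t h) = (0 < h ^+ 2 - sqdist v t z).
  by rewrite subr_gt0; apply/idP/idP => [/set_mem//|?]; exact: mem_set.
have m0 : 0 <= miss (Z i w) by exact: normr_ge0.
have [ij|ij] := eqVneq i j.
  rewrite -ij; apply: nearW => n; rewrite !memE.
  rewrite [RHS]ltNge subr_le0 miss_le_sqdist/=.
  rewrite ltNge subr_le0 (le_trans _ (miss_le_sqdist _ _))//.
  by rewrite ler_sqr ?nnegrE ?grid_ge0//; have /andP[] := grid_itv n m0.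
have {}ne := ne ij.
pose u n := grid n (miss (Z i w)) ^+ 2 - sqdist v (grid n (foot v (Z i w))) (Z j w).
pose l := miss (Z i w) ^+ 2 - sqdist v (foot v (Z i w)) (Z j w).
have ul : u n @[n --> \oo] --> l.
  rewrite /u /l; apply: cvgB.
    exact: (cvg_comp _ (fun x : R => x ^+ 2) (grid_cvg m0) (@exprn_continuous R 2 _)).
  under eq_fun do rewrite sqdistE//; rewrite sqdistE//.
  apply: cvgD; first exact: cvg_cst.
  have h : v * (grid n (foot v (Z i w)) - foot v (Z j w)) @[n --> \oo] -->
      v * (foot v (Z i w) - foot v (Z j w)).
    apply: cvgM; first exact: cvg_cst.
    by apply: cvgB; [exact: grid_cvg|exact: cvg_cst].
  exact: (cvg_comp _ (fun x : R => x ^+ 2) h (@exprn_continuous R 2 _)).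
have l0 : l != 0 by rewrite subr_eq0 eq_sym.
have e0 : 0 < `|l| by rewrite normr_gt0.
move/cvgrPdist_lt : ul => /(_ _ e0); apply: filterS => n; rewrite !memE -/(u n) -/l.
case: (ltrgt0P l) => [lp|ln|le0]; last by rewrite le0 eqxx in l0.
  by rewrite ltr_norml => /andP[? ?]; lra.
by rewrite ltr_norml => /andP[? ?]; apply/negbTE; rewrite -leNgt; lra.
Qed.

Definition good_config w := forall i j, i != j ->
  foot v (Z i w) != foot v (Z j w) /\
  sqdist v (foot v (Z i w)) (Z j w) != miss (Z i w) ^+ 2.

Lemma bad_config_negligible : P.-negligible [set w | ~ good_config w].
Proof.
pose bad i j := if i == j then set0 else [set w | foot v (Z i w) = foot v (Z j w)] `|`
  [set w | sqdist v (foot v (Z i w)) (Z j w) = miss (Z i w) ^+ 2].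
have nbad : P.-negligible (\bigcup_i \bigcup_j bad i j).
  apply: negligible_bigcup => i; apply: negligible_bigcup => j; rewrite /bad.
  case: eqVneq => ij; first exact: negligible_set0.
  by apply: negligibleU; [exact: (foot_neq hv hX hU hiid hindep)|
                          exact: (sqdist_neq_miss hv hX hU hiid hindep)].
apply: negligibleS nbad => w /= ng; apply: contrapT => nb; apply: ng => i j ij.
have nbij : ~ bad i j w by move=> b; apply: nb; exists i => //; exists j.
move: nbij; rewrite /bad (negbTE ij) => /= nbij.
by split; apply/eqP => h; apply: nbij; [left|right].
Qed.

Lemma measurable_interferer_event (B : set R) i : measurable B ->
  measurable_fun setT (interferer_event B i).
Proof.
move=> mB; have [m1 m2 m3 m4] := measurable_coords R.
have mZ k : measurable_fun setT (Z k) by exact: measurable_marked.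
have mf : measurable_fun setT (fun w => foot v (Z i w)).
  by apply: measurableT_comp => //; exact: measurable_foot.
have mm : measurable_fun setT (fun w => miss (Z i w)).
  by apply: measurableT_comp => //; exact: measurable_miss.
apply: measurable_and.
  by apply: measurable_and; exact: measurable_fun_ler.
apply: measurable_and.
  rewrite (_ : (fun w => _) = (fun w => (0 < (\1_B (miss (Z i w)) : R))%R)).
    by apply: measurable_fun_ltr => //; apply: measurableT_comp => //.
  by apply/funext => w; rewrite indicE; case: (_ \in _); rewrite /= ?ltr01 ?ltxx.
apply: (@measurableT_comp _ _ _ _ _ _ (fun k => k == 1%N)); first by move=> *.
apply: measurableT_comp; first exact: measurable_ereal_nat.
under eq_fun do rewrite point_measureE.
apply: ge0_emeasurable_sum => [j w _ _|j _]; first by rewrite lee_fin.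
apply/measurable_EFinP.
apply: (@measurableT_comp _ _ _ _ _ _ (fun b : bool => b%:R : R)); first by move=> *.
rewrite (_ : (fun w => _) =
    (fun w => sqdist v (foot v (Z i w)) (Z j w) < miss (Z i w) ^+ 2)); last first.
  by apply/funext => w; apply/idP/idP => [/set_mem|?]; [|exact: mem_set].
apply: measurable_fun_ltr; last exact: measurable_funX.
apply: measurable_funD; apply: measurable_funX; apply: measurable_funD.
- exact: (measurableT_comp m1 (mZ j)).
- by apply: measurable_funM; [exact: measurable_funM|exact: (measurableT_comp m3 (mZ j))].
- exact: (measurableT_comp m2 (mZ j)).
- by apply: measurable_funM; [exact: measurable_funM|exact: (measurableT_comp m4 (mZ j))].
Qed.

Lemma measurable_interferer_sum (B : set R) : measurable B ->
  measurable_fun setT (interferer_sum B).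
Proof.
move=> mB; apply: ge0_emeasurable_sum => [i w _ _|i _]; first by rewrite lee_fin.
apply/measurable_EFinP.
apply: (@measurableT_comp _ _ _ _ _ _ (fun b : bool => b%:R : R)); first by move=> *.
exact: measurable_interferer_event.
Qed.

Lemma interferer_sum_ge0 (B : set R) w : (0 <= interferer_sum B w)%E.
Proof. by apply: nneseries_ge0 => i _ _; rewrite lee_fin. Qed.

(** The Mecke formula for distances bounded by m: almost surely the grid sums
are eventually equal to the sum over interferers, and they are dominated by
the number of stations in the box. *)
Lemma integral_interferer_sum :
  (\int[P]_w interferer_sum J w =
   (lambda * (v * 2))%:E * \int[mu]_(x in J) (one_closer_prob x)%:E)%E.
Proof.
have [N1 [mN1 N10 hN1]] := poisson_count_fin hX measurable_box plane_intensity_box.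
have [N2 [mN2 N20 hN2]] := bad_config_negligible.
pose Nul := N1 `|` N2.
have mNul : measurable Nul by exact: measurableU.
have Nul0 : P Nul = 0%E by rewrite null_set_setU.
pose NB w := point_measure R (fun i => X i : Omega -> R * R) w box.
have outside w : ~ Nul w -> exists2 K, forall k, (K <= k)%N -> X k w \notin box &
    ereal_nat (NB w) = (\sum_(i < K) (X i w \in box))%N.
  move=> nN; have /point_measure_stationary[K [hK hc _]] := hN1 w (fun h => nN (or_introl h)).
  by exists K => //; rewrite (hc K).
have good w : ~ Nul w -> good_config w.
  by move=> nN; apply: contrapT => ng; apply: nN; right; exact: hN2.
have inbox i w : 0 <= foot v (Z i w) <= 1 -> miss (Z i w) \in J -> X i w \in box.
  move=> f01 /set_mem/Jm/=; rewrite in_itv/= => m0m; apply/mem_set.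
  by apply: (sqdist_box (z := Z i w) f01 m0m); rewrite sqdistE// subrr mulr0 expr0n addr0.
have sumE w K : (forall k, (K <= k)%N -> X k w \notin box) ->
    interferer_sum J w = (\sum_(i < K) (interferer_event J i w)%:R : R)%:E.
  move=> hK; rewrite /interferer_sum (@eseries_bool_stationaryE _ _ K) ?natr_sum// => k /hK.
  by apply: contraNF => /and3P[f01 mJk _]; exact: inbox.
have c2 : (\int[P]_w (grid_sum n w)%:E @[n --> \oo] -->
    \int[P]_w (fine (interferer_sum J w))%:E)%E.
  apply: (@dominated_cvg_real _ _ _ P Nul grid_sum (fine \o interferer_sum J)
    (fun w => (ereal_nat (NB w))%:R)) => //.
  - by move=> n; exact: measurable_grid_sum.
  - by apply: measurableT_comp; [exact: fine_measurable|exact: measurable_interferer_sum].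
  - exact: (poisson_count_integrable hX measurable_box plane_intensity_box).
  - move=> n w nN; have [K hK ->] := outside w nN.
    rewrite (grid_sum_stationary n hK) ger0_norm; last by apply: sumr_ge0 => i _; rewrite mulr_ge0.
    rewrite natr_sum; apply: ler_sum => i _; rewrite -natrM ler_nat.
    case: (boolP (_ && _)) => //= /andP[f01 mJi]; rewrite inbox// mul1n.
    exact: leq_b1.
  move=> w nN; have [K hK _] := outside w nN; have gw := good w nN.
  apply: cvg_near_cst; rewrite /= (sumE w K hK)/=.
  have ev (i j : 'I_K) : 0 <= foot v (Z i w) <= 1 -> \forall n \near \oo,
      (Z j w \in closer (grid n (foot v (Z i w))) (grid n (miss (Z i w)))) =
      (Z j w \in closer (foot v (Z i w)) (miss (Z i w))).
    by move=> /andP[f0 _]; apply: closer_eventually => // ij; have [] := gw i j ij.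
  have evi (i : 'I_K) : \forall n \near \oo,
      ((0 <= foot v (Z i w) <= 1) && (miss (Z i w) \in J))%:R *
      (cnt (closer (grid n (foot v (Z i w))) (grid n (miss (Z i w)))) w == 1%N)%:R =
      (interferer_event J i w)%:R :> R.
    rewrite /interferer_event; case: (boolP (_ <= _ <= _)) => f01; last first.
      by apply: nearW => n; rewrite mul0r.
    case: (boolP (_ \in J)) => mJi /=; last by apply: nearW => n; rewrite mul0r.
    have /andP[f0 f1] := f01.
    have /andP[m0 m1] : 0 <= miss (Z i w) <= m%:R.
      by have := Jm (set_mem mJi); rewrite /= in_itv.
    have evj : \forall n \near \oo, forall j : 'I_K,
        (Z j w \in closer (grid n (foot v (Z i w))) (grid n (miss (Z i w)))) =
        (Z j w \in closer (foot v (Z i w)) (miss (Z i w))).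
      by apply: filter_forall => j; exact: ev.
    apply: filterS evj => n evn.
    rewrite mul1r /sees_one !(cntE _ hK).
    - congr (_ == _)%:R; by apply: eq_bigr => j _; rewrite evn.
    - move=> z /ltW le; split => //; apply: (sqdist_box _ _ le) => //.
      by rewrite m0.
    - move=> z /ltW le; split => //; apply: (sqdist_box _ _ le); rewrite grid_ge0/=.
        by have /andP[h _] := grid_itv n f0; exact: le_trans f1.
      by have /andP[h _] := grid_itv n m0; exact: le_trans m1.
  have evK : \forall n \near \oo, forall i : 'I_K,
      ((0 <= foot v (Z i w) <= 1) && (miss (Z i w) \in J))%:R *
      (cnt (closer (grid n (foot v (Z i w))) (grid n (miss (Z i w)))) w == 1%N)%:R =
      (interferer_event J i w)%:R :> R.
    exact: filter_forall.
  apply: filterS evK => n evn.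
  by rewrite (grid_sum_stationary n hK); apply: eq_bigr => i _.
rewrite -(cvg_lim _ integral_grid_sum_cvg)// (cvg_lim _ c2)//.
apply: (ge0_integral_eq_off_null mNul Nul0).
- apply/measurable_EFinP.
  by apply: measurableT_comp; [exact: fine_measurable|exact: measurable_interferer_sum].
- by move=> w; exact: interferer_sum_ge0.
- by move=> w; rewrite lee_fin fine_ge0// interferer_sum_ge0.
by move=> w nN; have [K hK _] := outside w nN; rewrite (sumE w K hK).
Qed.

End discretization.

(** * Max interference process of a fixed configuration *)

(** An infinite sum is consistent with this characterization, as it is read as
0. *)
Lemma ereal_nat_eq1P (R : realType) (b : nat -> bool) :
  (ereal_nat (\sum_(i <oo) (b i)%:R%:E : \bar R)%E == 1%N) <-> exists! j, b j.
Proof.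
split=> [/eqP E1|[j [bj uj]]].
  have [|K hK] := @eseries_bool_stationary R b.
    rewrite ltey; apply/eqP => Eoo.
    by move: E1; rewrite Eoo /ereal_nat /= truncn0.
  move: E1; rewrite (@eseries_bool_stationaryE R _ _ hK) ereal_natK.
  move=> /eqP/sum_nat_eq1[i [_ bi un]].
  exists i; split; first by move: bi; case: (b i).
  move=> k bk; case: (ltnP k K) => [kK|/hK]; last by rewrite bk.
  have := un (Ordinal kK); rewrite -val_eqE/= bk; case: eqVneq => [->//|_].
  by move=> /(_ isT isT).
rewrite (@eseries_bool_stationaryE R b j.+1) ?ereal_natK.
  rewrite big_ord_recr/= bj big1// => i _; apply/eqP; rewrite eqb0; apply/negP => bi.
  by have := uj _ bi => ji; have := ltn_ord i; rewrite -ji ltnn.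
by move=> k jk; apply/negbTE/negP => /uj kj; rewrite kj ltnn in jk.
Qed.

Section stations.
Context (R : realType) (v : R) (hv : 0 < v) (x : nat -> R * R) (a : nat -> R).
Local Notation z i := (x i, a i).

Lemma dist_sqdist i t : dist v x a i t = Num.sqrt (sqdist v t (z i)).
Proof. by []. Qed.

Lemma dist_lt i t h : 0 <= h -> (dist v x a i t < h) = (sqdist v t (z i) < h ^+ 2).
Proof.
move=> h0; rewrite dist_sqdist -{1}(ger0_norm h0) -sqrtr_sqr.
case: (eqVneq h 0) => [->|hn].
  rewrite expr0n/= sqrtr0 [LHS]ltNge sqrtr_ge0/=; apply/esym/negbTE.
  by rewrite -leNgt /sqdist addr_ge0// sqr_ge0.
by rewrite ltr_sqrt// exprn_even_gt0.
Qed.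

(** By [sqdistE] the squared distance is a strictly convex parabola in time. *)
Lemma closest_time_foot i : closest_time v x a i = foot v (z i).
Proof.
have s0 t : 0 <= sqdist v t (z i) by rewrite /sqdist addr_ge0// sqr_ge0.
apply: xget_unique => [s|y hy].
  rewrite !dist_sqdist ler_sqrt// !sqdistE// subrr mulr0 expr0n addr0.
  by rewrite lerDl sqr_ge0.
have := hy (foot v (z i)); rewrite !dist_sqdist ler_sqrt// !sqdistE// subrr mulr0 expr0n addr0.
rewrite gerDl => le0; have /eqP : (v * (y - foot v (z i))) ^+ 2 == 0.
  by rewrite eq_le le0 sqr_ge0.
move/eqP; rewrite sqrf_eq0 mulf_eq0 gt_eqF//= subr_eq0 => /eqP//.
Qed.

Lemma closest_dist_miss i : closest_dist v x a i = miss (z i).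
Proof.
rewrite /closest_dist closest_time_foot dist_sqdist sqdistE// subrr mulr0 expr0n addr0.
by rewrite sqrtr_sqr ger0_norm// normr_ge0.
Qed.

Lemma max_interference_atE i s : max_interference_at v x a i s <->
  s = foot v (z i) /\ exists! j, sqdist v s (z j) < miss (z i) ^+ 2.
Proof.
have m0 : 0 <= miss (z i) by exact: normr_ge0.
rewrite /max_interference_at closest_time_foot closest_dist_miss.
split=> -[-> [j [hj uj]]]; (split=> //; exists j; split;
  [by move: hj; rewrite dist_lt|by move=> k hk; apply: uj; move: hk; rewrite dist_lt]).
Qed.

Hypothesis foot_inj : forall i j, i != j -> foot v (z i) != foot v (z j).

Lemma interferer_dist_foot i : max_interference_at v x a i (foot v (z i)) ->
  interferer_dist v x a (foot v (z i)) = miss (z i).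
Proof.
move=> hi; apply: xget_unique => [|_ [j hj ->]]; first by exists i; rewrite ?closest_dist_miss.
rewrite closest_dist_miss; case: (eqVneq j i) => [->//|/foot_inj].
by have /max_interference_atE[-> _] := hj; rewrite eqxx.
Qed.

(** As the closest times are distinct, they index the points of the process
injectively by the stations that see exactly one closer station. *)
Lemma esum_max_interference (f : R -> \bar R) : (forall t, 0 <= f t)%E ->
  (\esum_(t in max_interference v x a `&` `[0%R, 1%R]) f (interferer_dist v x a t) =
   \sum_(i <oo | (0 <= foot v (z i) <= 1)%R &&
      (ereal_nat (\sum_(j <oo) (sqdist v (foot v (z i)) (z j) < miss (z i) ^+ 2)%R%:R%:E : \bar R)
        == 1%N)) f (miss (z i)))%E.
Proof.
move=> f0.
pose I := [set i | (0 <= foot v (z i) <= 1) && (ereal_nat (\sum_(j <oo)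
  (sqdist v (foot v (z i)) (z j) < miss (z i) ^+ 2)%R%:R%:E : \bar R)%E == 1%N)].
have VE : max_interference v x a `&` `[0, 1] = [set foot v (z i) | i in I].
  apply/seteqP; split => t.
    move=> [[i /max_interference_atE[-> ui]]]; rewrite /= in_itv/= => t01.
    by exists i => //; rewrite /I/= t01; apply/ereal_nat_eq1P.
  move=> [i /andP[t01 /ereal_nat_eq1P ui] <-]; split; last by rewrite /= in_itv.
  by exists i; apply/max_interference_atE.
rewrite VE esum_set_image; last 2 first.
- by move=> i _; exact: f0.
- by move=> i j _ _ /eqP E; apply: contraTeq E => /foot_inj.
rewrite eseries_mkcond [RHS]eseries_mkcond; apply: eq_eseriesr => i _.
have [iI|iI] := boolP (i \in I); last by rewrite ifN//; apply: contraNN iI; exact: mem_set.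
have /andP[t01 ui] := set_mem iI; rewrite t01 ui /=; move/ereal_nat_eq1P : ui => ui.
by congr f; apply: interferer_dist_foot; exact/max_interference_atE.
Qed.

End stations.

(** * Mean number of points with their distances *)

Section interferers.
Context (R : realType) d (Omega : measurableType d) (P : probability Omega R).
Variables (lambda v : R) (hlambda : 0 < lambda) (hv : 0 < v).
Variables (X : nat -> {RV P >-> (R * R)%type}) (Theta : nat -> {RV P >-> R}).
Hypothesis hX : poisson_point_process P (plane_intensity hlambda)
  (fun i => X i : Omega -> R * R).
Hypothesis hU : forall i (A : set R), measurable A ->
  distribution P (Theta i) A = angle_law A.
Hypothesis hiid : mutually_independent P (fun i => Theta i : Omega -> R).
Hypothesis hindep : independent_sigma P
  (sigma_family (fun i => X i : Omega -> R * R))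
  (sigma_family (fun i => Theta i : Omega -> R)).

Local Notation mu := (@lebesgue_measure R).
Local Notation Z := (marked X Theta).

Local Notation isum := (interferer_sum v X Theta).

(** Cuts B into the pieces of [0, 1), [1, 2) and so on; a distance lies in only
one of them. *)
Lemma integral_interferer_sum_all (B : set R) : measurable B ->
  (\int[P]_w isum B w =
   (lambda * (v * 2))%:E * \int[mu]_(x in B `&` `[0%R, +oo[) (one_closer_prob lambda x)%:E)%E.
Proof.
move=> mB; pose C m := B `&` `[m%:R, m.+1%:R[%classic : set R.
have mC m : measurable (C m) by apply: measurableI => //; exact: measurable_itv.
have CE m x : 0 <= x -> (x \in C m) = (x \in B) && (m == Num.truncn x).
  move=> x0; rewrite in_setI; congr andb; rewrite eq_sym truncn_eq//.
  by rewrite mem_setE in_itv.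
have C0 m x : C m x -> 0 <= x.
  by move=> [_]; rewrite /= in_itv/= => /andP[h _]; exact: le_trans h.
have psi0 x : (0 <= (one_closer_prob lambda x)%:E)%E by rewrite lee_fin one_closer_prob_ge0.
transitivity (\sum_(m <oo) \int[P]_w isum (C m) w)%E.
  rewrite -integral_nneseries//; last 2 first.
  - by move=> m; exact: measurable_interferer_sum.
  - by move=> m w _; exact: interferer_sum_ge0.
  apply: eq_integral => w _; rewrite /interferer_sum nneseries_interchange//.
  apply: eq_eseriesr => i _; have h0 : 0 <= miss (Z i w) by exact: normr_ge0.
  rewrite (@eseries_bool_stationaryE R (fun m => interferer_event v X Theta (C m) i w)
    (Num.truncn (miss (Z i w))).+1).
    rewrite big_ord_recr/= big1 => [|m _].
      by rewrite add0n /interferer_event CE// eqxx andbT.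
    apply/eqP; rewrite eqb0 /interferer_event CE// ltn_eqF ?andbF//; exact: ltn_ord.
  move=> k tk; rewrite /interferer_event CE// gtn_eqF ?andbF//.
transitivity (\sum_(m <oo) ((lambda * (v * 2))%:E *
    \int[mu]_(x in C m) (one_closer_prob lambda x)%:E))%E.
  apply: eq_eseriesr => m _.
  apply: (integral_interferer_sum hv hX hU hiid hindep (m := m.+1) (mC m)).
  move=> x [_]; rewrite /= !in_itv/= => /andP[h1 /ltW ->]; rewrite andbT.
  exact: le_trans h1.
rewrite nneseriesZl//; last by move=> m _; exact: integral_ge0.
congr (_ * _)%E.
have tC : trivIset setT C.
  apply/trivIsetP => i j _ _ ij; rewrite -subset0 => x [xi xj].
  have x0 := C0 _ _ xi; move: xi xj => /mem_set + /mem_set.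
  by rewrite !CE// => /andP[_ /eqP Ei] /andP[_ /eqP Ej]; move: ij; rewrite Ei Ej eqxx.
rewrite -ge0_integral_bigcup//; last first.
  apply: measurable_funTS; apply/measurable_EFinP; exact: measurable_one_closer_prob.
congr (integral _ _ _); apply/seteqP; split => x.
  move=> [m _ Cm]; split; first by case: Cm.
  by rewrite /= in_itv/= (C0 _ _ Cm).
move=> [Bx]; rewrite /= in_itv/= andbT => x0; exists (Num.truncn x) => //.
by apply/set_mem; rewrite CE// eqxx mem_set.
Qed.

Local Notation V := (fun w : Omega => max_interference v (X ^~ w) (Theta ^~ w)).
Local Notation H := (fun w : Omega => interferer_dist v (X ^~ w) (Theta ^~ w)).

Lemma unit_window_sum_interferer (B : set R) : measurable B ->
  unit_window_sum P V (fun w t => (\1_B (H w t))%:E) =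
  ((lambda * (v * 2))%:E * \int[mu]_(x in B `&` `[0%R, +oo[) (one_closer_prob lambda x)%:E)%E.
Proof.
move=> mB; rewrite -integral_interferer_sum_all// /unit_window_sum.
have [N [mN N0 hN]] := bad_config_negligible hv hX hU hiid hindep.
apply: (ge0_integral_eq_off_null mN N0).
- exact: measurable_interferer_sum.
- by move=> w; apply: esum_ge0 => t _; rewrite lee_fin.
- by move=> w; exact: interferer_sum_ge0.
move=> w nN; have gw : good_config v X Theta w by apply: contrapT => ng; apply: nN; exact: hN.
have inj i j : i != j -> foot v (X i w, Theta i w) != foot v (X j w, Theta j w).
  by move=> /gw[].
rewrite (@esum_max_interference R v hv (X ^~ w) (Theta ^~ w) inj
  (fun h => (\1_B h)%:E)); last by move=> t; rewrite lee_fin.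
rewrite eseries_mkcond; apply: eq_eseriesr => i _.
have -> : interferer_event v X Theta B i w = [&& 0 <= foot v (Z i w) <= 1,
    miss (Z i w) \in B & ereal_nat (\sum_(j <oo) (sqdist v (foot v (Z i w)) (Z j w) <
      miss (Z i w) ^+ 2)%R%:R%:E : \bar R)%E == 1%N].
  rewrite /interferer_event /sees_one point_measureE; congr [&& _, _ & ereal_nat _ == _].
  apply: eq_eseriesr => j _; congr ((nat_of_bool _)%:R%:E).
  by apply/idP/idP => [/set_mem|?]; [|exact: mem_set].
rewrite indicE -[(X i w, Theta i w)]/(Z i w).
by case: (_ <= _ <= _) => //=; case: (_ == 1%N); case: (_ \in B).
Qed.

End interferers.

(** * Normalization of the Nakagami density *)

Section nakagami_three_halves.
Context (R : realType).
Local Notation mu := (@lebesgue_measure R).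

(** The integrand of Gamma (3/2), extended continuously to 0. *)
Definition gamma_density (x : R) : R := Num.sqrt x * expR (- x).

Lemma gamma_density_ge0 x : 0 <= gamma_density x.
Proof. by rewrite mulr_ge0 ?sqrtr_ge0 ?expR_ge0. Qed.

Lemma continuous_gamma_density : continuous gamma_density.
Proof.
move=> x; apply: cvgM; first exact: sqrt_continuous.
exact: (cvg_comp _ expR (cvgN cvg_id) (@continuous_expR R _)).
Qed.

Lemma measurable_gamma_density : measurable_fun setT gamma_density.
Proof. exact: continuous_measurable_fun continuous_gamma_density. Qed.

(** From 2 sqrt x <= 1 + x <= 2 (1 + x / 2) and 1 + x / 2 <= expR (x / 2), the
integrand is at most 4 times the exponential density of rate 1/2. *)
Lemma integral_gamma_density_lty : (\int[mu]_(x in `[0%R, +oo[) (gamma_density x)%:E < +oo)%E.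
Proof.
have h0 : (0 : R) < 2^-1 by rewrite invr_gt0.
apply: (@le_lt_trans _ _ (\int[mu]_x (4 * exponential_pdf 2^-1 x)%:E)%E); last first.
  under eq_integral do rewrite EFinM.
  rewrite ge0_integralZl_EFin//; last 2 first.
  - by move=> x _; rewrite lee_fin; apply: exponential_pdf_ge0.
  - by apply/measurable_EFinP; exact: measurable_exponential_pdf.
  by rewrite integral_exponential_pdf// mule1 ltry.
rewrite integral_mkcond; apply: ge0_le_integral => //.
- by move=> x _; rewrite patchE; case: ifP => // _; rewrite lee_fin gamma_density_ge0.
- apply/measurable_restrict => //; apply: measurable_funTS; apply/measurable_EFinP.
  exact: measurable_gamma_density.
- apply/measurable_EFinP; apply: measurable_funM => //; exact: measurable_exponential_pdf.
move=> x _; rewrite patchE; case: ifPn => [/set_mem|_]; last first.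
  by rewrite lee_fin mulr_ge0// exponential_pdf_ge0.
rewrite /= in_itv/= andbT => x0; rewrite lee_fin.
have -> : exponential_pdf 2^-1 x = 2^-1 * expR (- 2^-1 * x).
  by rewrite /exponential_pdf patchE mem_set//= in_itv/= andbT.
rewrite /gamma_density mulrA (_ : expR (- x) = expR (- 2^-1 * x) * expR (- 2^-1 * x)); last first.
  by rewrite -expRD; congr expR; field.
rewrite mulrA ler_pM2r ?expR_gt0//.
have e1 := expR_ge1Dx (2^-1 * x); have s1 := sqr_sqrtr x0.
have ep : 0 < expR (2^-1 * x) := expR_gt0 _.
rewrite mulNr expRN ler_pdivrMr//.
have := sqr_ge0 (Num.sqrt x - 1); rewrite sqrrB1 s1; lra.
Qed.

Lemma integral_gamma_densityE :
  (\int[mu]_(x in `[0%R, +oo[) (gamma_density x)%:E = (Gamma_fun (3 / 2 : R))%:E)%E.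
Proof.
rewrite /Gamma_fun /Rintegral.
have E : (\int[mu]_(x in `]0%R, +oo[) (x `^ (3 / 2 - 1) * expR (- x))%:E =
    \int[mu]_(x in `[0%R, +oo[) (gamma_density x)%:E)%E.
  rewrite -integral_itv_obnd_cbnd; last first.
    by apply: measurable_funTS; apply/measurable_EFinP; exact: measurable_gamma_density.
  apply: eq_integral => x; rewrite inE/= in_itv/= andbT => x0.
  by rewrite (_ : 3 / 2 - 1 = 2^-1) ?powR12_sqrt ?ltW//; field.
rewrite E fineK// ge0_fin_numE; first exact: integral_gamma_density_lty.
by apply: integral_ge0 => x _; rewrite lee_fin gamma_density_ge0.
Qed.

Variables (lambda : R) (hlambda : 0 < lambda).
Let c := lambda * pi.
Let c0 : 0 < c. Proof. by rewrite mulr_gt0 ?pi_gt0. Qed.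

(** The substitution x = c * h ^+ 2, whose derivative is unbounded: it is
performed on bounded intervals, which then grow to the half-line. *)
Lemma integral_one_closer_prob_Gamma :
  ((2 * Num.sqrt c)%:E * \int[mu]_(x in `[0%R, +oo[) (one_closer_prob lambda x)%:E =
   (Gamma_fun (3 / 2 : R))%:E)%E.
Proof.
rewrite -integral_gamma_densityE.
pose F h : R := c * h ^+ 2.
have sc0 : 0 <= 2 * Num.sqrt c by rewrite mulr_ge0 ?sqrtr_ge0.
have psi0 x : (0 <= (one_closer_prob lambda x)%:E)%E by rewrite lee_fin one_closer_prob_ge0.
have mpsi : measurable_fun setT (fun x => (one_closer_prob lambda x)%:E).
  by apply/measurable_EFinP; exact: measurable_one_closer_prob.
have dF (h : R) : is_derive h 1 F (2 * c * h).
  by rewrite /F; apply: is_derive_eq; rewrite /GRing.scale/=; ring.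
have F'E : F^`()%classic = (fun h => 2 * c * h).
  by apply/funext => h; rewrite derive1E; apply: derive_val.
have cF' : continuous (fun h => 2 * c * h : R).
  by move=> h; apply: cvgM; [exact: cvg_cst|exact: cvg_id].
have sub n : (\int[mu]_(x in `[0%R, F n%:R]) (gamma_density x)%:E =
    (2 * Num.sqrt c)%:E * \int[mu]_(x in `[0%R, n%:R]) (one_closer_prob lambda x)%:E)%E.
  have {1}-> : 0%R = F 0 by rewrite /F expr0n mulr0.
  rewrite integration_by_substitution_increasing; first last.
  - by apply: continuous_subspaceT; exact: continuous_gamma_density.
  - by apply: derivable_LRcontinuous => h.
  - by rewrite F'E; apply/cvg_ex; exists (2 * c * n%:R); apply: cvg_at_left_filter; exact: cF'.
  - by rewrite F'E; apply/cvg_ex; exists (2 * c * 0); apply: cvg_at_right_filter; exact: cF'.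
  - by rewrite F'E => x _; exact: cF'.
  - move=> x y; rewrite !in_itv/= => /andP[x0 _] /andP[y0 _] xy.
    by rewrite /F ltr_pM2l// ltr_sqr.
  - by [].
  rewrite -ge0_integralZl_EFin//; last exact: measurable_funTS.
  apply: eq_integral => x; rewrite inE/= in_itv/= => /andP[x0 _].
  rewrite -EFinM F'E; congr (_%:E).
  transitivity (gamma_density (F x) * (2 * c * x)) => //.
  rewrite /gamma_density /F sqrtrM ?ltW// sqrtr_sqr ger0_norm//.
  rewrite /one_closer_prob (mulrA lambda) -/c; ring.
pose I n : set R := `[0, F n%:R]%classic.
have Fnd m n : (m <= n)%N -> F m%:R <= F n%:R.
  by move=> mn; rewrite ler_pM2l// ler_sqr ?nnegrE// ler_nat.
have IU : \bigcup_n I n = `[0, +oo[%classic.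
  apply/seteqP; split => x.
    by move=> [n _]; rewrite /I/= !in_itv/= => /andP[->].
  rewrite /= in_itv/= andbT => x0; exists (Num.truncn (x / c)).+1 => //.
  rewrite /I/= in_itv/= x0/= /F -ler_pdivrMl// mulrC.
  have h1 := ltW (truncnS_gt (x / c)); apply: (le_trans h1).
  by rewrite expr2 ler_peMr// ler1n.
have l1 : (\int[mu]_(x in I n) (gamma_density x)%:E @[n --> \oo] -->
    \int[mu]_(x in `[0%R, +oo[) (gamma_density x)%:E)%E.
  rewrite -IU; apply: ge0_nondecreasing_set_cvg_integral.
  - move=> m n mn; apply/subsetPset => x; rewrite /I/= !in_itv/= => /andP[-> /= h].
    exact: le_trans (Fnd _ _ mn).
  - by move=> n; exact: measurable_itv.
  - by move=> n; apply: measurable_funTS; apply/measurable_EFinP; exact: measurable_gamma_density.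
  - by move=> n x _; rewrite lee_fin gamma_density_ge0.
have l2 : ((2 * Num.sqrt c)%:E * \int[mu]_(x in `[0%R, n%:R]) (one_closer_prob lambda x)%:E
    @[n --> \oo] -->
    (2 * Num.sqrt c)%:E * \int[mu]_(x in `[0%R, +oo[) (one_closer_prob lambda x)%:E)%E.
  apply: cvgeZl => //; apply: ge0_cvgn_integral; last exact: measurable_one_closer_prob.
  by move=> x; exact: one_closer_prob_ge0.
rewrite -(cvg_lim _ l1)// -(cvg_lim _ l2)//; congr (lim (_ @ \oo)).
by apply/funext => n; rewrite sub.
Qed.

Lemma Gamma_three_halves_gt0 : 0 < Gamma_fun (3 / 2 : R).
Proof.
rewrite -lte_fin -integral_gamma_densityE.
apply: (@lt_le_trans _ _ (\int[mu]_(x in `[1%R, 2%R]) (expR (- 2))%:E)%E).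
  rewrite (integral_cst mu (measurable_itv _) (expR (-2))%:E) /=.
  have -> : mu `[1%R, 2%R]%classic = 1%E.
    by rewrite lebesgue_measure_itv/= lte_fin ltr1n -EFinB; congr (_%:E); ring.
  by rewrite mule1 lte_fin expR_gt0.
apply: (@le_trans _ _ (\int[mu]_(x in `[1%R, 2%R]) (gamma_density x)%:E)%E).
  apply: ge0_le_integral => //.
  - by apply: measurable_funTS; apply/measurable_EFinP; exact: measurable_gamma_density.
  move=> x; rewrite /= in_itv/= => /andP[x1 x2]; rewrite lee_fin /gamma_density.
  rewrite -[leLHS]mul1r ler_pM ?expR_ge0// ?ler_expR ?lerN2//.
  by rewrite -sqrtr1 ler_sqrt// (le_trans ler01).
apply: ge0_subset_integral => //.
- by apply: measurable_funTS; apply/measurable_EFinP; exact: measurable_gamma_density.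
- by move=> x _; rewrite lee_fin gamma_density_ge0.
by move=> x; rewrite /= !in_itv/= => /andP[x1 _]; rewrite andbT (le_trans ler01).
Qed.

(** The powers of m = 3/2 and of omega = m / c combine to c^(3/2). *)
Lemma nakagami_pdf_one_closer_prob (x : R) :
  nakagami_pdf (3 / 2) (3 / (2 * lambda * pi)) x =
  if 0 <= x then 2 * Num.sqrt c / Gamma_fun (3 / 2) * one_closer_prob lambda x else 0.
Proof.
rewrite /nakagami_pdf; case: ifPn => // x0.
have ln : lambda != 0 by rewrite gt_eqF.
have pn : (pi : R) != 0 by rewrite gt_eqF ?pi_gt0.
have Gn : Gamma_fun (3 / 2 : R) != 0 by rewrite gt_eqF ?Gamma_three_halves_gt0.
have m0 : (0 : R) <= 3 / 2 by rewrite divr_ge0.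
have -> : 2 * (3 / 2) - 1 = 2%:R :> R by field.
rewrite powR_mulrn//.
have -> : 3 / 2 * x ^+ 2 / (3 / (2 * lambda * pi)) = lambda * (pi * x ^+ 2).
  by move: (pi : R) pn => p pn0; field; rewrite ln pn0.
have -> : 3 / (2 * lambda * pi) = (3 / 2) / c.
  by rewrite /c; move: (pi : R) pn => p pn0; field; rewrite ln pn0.
set w := 3 / 2 / c; have w0 : 0 < w by rewrite !divr_gt0.
have -> : (3 / 2) `^ (3 / 2) = w `^ (3 / 2) * (c * Num.sqrt c) :> R.
  have {1}-> : 3 / 2 = w * c by rewrite /w divfK// gt_eqF.
  rewrite powRM ?ltW//; congr (_ * _); rewrite -(mulr_powRB1 (ltW c0)) ?divr_gt0//.
  by rewrite (_ : 3 / 2 - 1 = 2^-1) ?powR12_sqrt ?ltW//; field.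
have wn : w `^ (3 / 2) != 0 by rewrite gt_eqF// powR_gt0.
rewrite /one_closer_prob /c.
move: (w `^ _) wn (Gamma_fun _) Gn (Num.sqrt _) (expR _) => p pn0 G Gn s e.
by field; rewrite Gn pn0.
Qed.

Definition nakagami_const : R := 2 * Num.sqrt c / Gamma_fun (3 / 2).

Lemma nakagami_probE (B : set R) : measurable B ->
  (nakagami_prob (3 / 2) (3 / (2 * lambda * pi)) B =
   nakagami_const%:E * \int[mu]_(x in B `&` `[0%R, +oo[) (one_closer_prob lambda x)%:E)%E.
Proof.
move=> mB; have k0 : 0 <= nakagami_const.
  by rewrite divr_ge0 ?mulr_ge0 ?sqrtr_ge0// ltW// Gamma_three_halves_gt0.
rewrite -ge0_integralZl_EFin//; last 3 first.
- by apply: measurableI => //; exact: measurable_itv.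
- by move=> x _; rewrite lee_fin one_closer_prob_ge0.
- by apply: measurable_funTS; apply/measurable_EFinP; exact: measurable_one_closer_prob.
rewrite /nakagami_prob setIC integral_mkcondl; apply: eq_integral => x _.
rewrite nakagami_pdf_one_closer_prob patchE; case: ifPn => x0; case: ifPn => //.
- by move=> /negP; case; rewrite mem_set//= in_itv/= x0.
- by move=> /set_mem; rewrite /= in_itv/= andbT (negbTE x0).
Qed.

Lemma integral_one_closer_prob_bounds :
  (0 < \int[mu]_(x in `[0%R, +oo[) (one_closer_prob lambda x)%:E < +oo)%E.
Proof.
have s0 : 0 < 2 * Num.sqrt c by rewrite mulr_gt0 ?sqrtr_gt0.
have G0 := Gamma_three_halves_gt0; have := integral_one_closer_prob_Gamma.
case: (integral _ _ _) => [r| |] /=.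
- by rewrite -EFinM => -[] E; rewrite lte_fin ltry andbT -(pmulr_rgt0 _ s0) E.
- by rewrite mulry gtr0_sg// mul1e.
- by rewrite mulrNy gtr0_sg// mul1e.
Qed.

End nakagami_three_halves.

(** * Palm distribution *)

Theorem proposition3 (R : realType) (d : measure_display)
    (Omega : measurableType d) (P : probability Omega R) (lambda v : R)
    (X : nat -> {RV P >-> (R * R)%type}) (Theta : nat -> {RV P >-> R})
    (hlambda : 0 < lambda) (hv : 0 < v)
    (hX : poisson_point_process P
      (fun B : set (R * R) =>
        (lambda%:E * (lebesgue_measure \x lebesgue_measure) B)%E)
      (fun i => X i : Omega -> R * R))
    (hunif : forall (i : nat) (B : set R), measurable B ->
      distribution P (Theta i) B = uniform_prob (ltNpi R) B)
    (hiid : mutually_independent P (fun i => Theta i : Omega -> R))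
    (hindep : independent_sigma P
      (sigma_family (fun i => X i : Omega -> R * R))
      (sigma_family (fun i => Theta i : Omega -> R))) :
  let V := fun w : Omega => max_interference v (X ^~ w) (Theta ^~ w) in
  let H := fun w : Omega => interferer_dist v (X ^~ w) (Theta ^~ w) in
  (0 < intensity P V < +oo)%E /\
  forall B : set R, measurable B ->
    palm_distribution P V H B =
    nakagami_prob (3 / 2) (3 / (2 * lambda * pi)) B.
Proof.
move=> V H; have k0 : 0 < lambda * (v * 2) by rewrite !mulr_gt0.
have hX' : poisson_point_process P (plane_intensity hlambda)
    (fun i => X i : Omega -> R * R) by exact: hX.
have hU (i : nat) (A : set R) : measurable A ->
    distribution P (Theta i) A = angle_law A by exact: hunif.
have window B : measurable B -> unit_window_sum P V (fun w t => (\1_B (H w t))%:E) =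
    ((lambda * (v * 2))%:E *
     \int[lebesgue_measure]_(x in B `&` `[0%R, +oo[) (one_closer_prob lambda x)%:E)%E.
  exact: (unit_window_sum_interferer hv hX' hU hiid hindep).
have intE : (intensity P V = (lambda * (v * 2))%:E *
    \int[lebesgue_measure]_(x in `[0%R, +oo[) (one_closer_prob lambda x)%:E)%E.
  rewrite -[X in integral _ X]setTI -window// /intensity.
  by congr unit_window_sum; apply/funext => w; apply/funext => t; rewrite indicT.
have /andP[I0 Ioo] := integral_one_closer_prob_bounds hlambda.
have IG := integral_one_closer_prob_Gamma hlambda.
move: intE I0 Ioo IG; case: (integral _ _ _) => // I intE; rewrite lte_fin => I0 _ [IG].
split; first by rewrite intE -EFinM lte_fin mulr_gt0//= ltry.
move=> B mB; rewrite /palm_distribution /palm_expectation window// intE nakagami_probE//.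
rewrite -EFinM inver gt_eqF ?mulr_gt0// muleA -EFinM; congr (_%:E * _)%E.
rewrite /nakagami_const -IG.
have s0 : Num.sqrt (lambda * pi) != 0 by rewrite gt_eqF// sqrtr_gt0 mulr_gt0// pi_gt0.
move: (Num.sqrt _) s0 => s s0.
have In : I != 0 by rewrite gt_eqF.
have ln : lambda != 0 by rewrite gt_eqF.
have vn : v != 0 by rewrite gt_eqF.
by field; rewrite s0 In ln vn.
Qed.
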